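(* Let $0<\alpha<1/2$ and let $\{X_n\}_{n\ge 1}$ be independent $\{0,1\}$-valued random variables on a probability space $\Omega$ with expectations $\mathbb{E}X_n=\sigma_n=n^{-\alpha}$; let $a_n(\omega)$ be the associated counting function. Let $\mathcal{B}$ be an approximable set of functions $b:\mathbb{N}\to\mathbb{C}$ bounded in magnitude by $1$, and suppose in addition that \[ \sup_{b\in\mathcal{B}}\Big|\frac1N\sum_{n\le N}b(n)\Big|\longrightarrow 0\quad\text{as }N\to\infty . \] Then, for almost every $\omega\in\Omega$, the following holds: for every measure-preserving system $(X,\mu,T)$ and every $f\in L^1(X)$, \[ \sup_{b\in\mathcal{B}}\Big|\frac1N\sum_{n\le N} b(n)\,T^{a_n(\omega)}f\Big|\longrightarrow 0\quad\text{as } N\to\infty \] $\mu$-almost everywhere.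
   Context: $\mathbb{N}=\{1,2,3,\dots\}$. The counting function $a_n(\omega)$ is the smallest integer such that $X_1(\omega)+\dots+X_{a_n(\omega)}(\omega)=n$. A measure-preserving system $(X,\mu,T)$ is a probability space $(X,\mu)$ with a measure-preserving transformation $T:X\to X$; $T^nf:=f\circ T^n$. Approximable: a collection $\mathcal{B}$ of functions $b:\mathbb{N}\to\mathbb{C}$ is approximable if for every $\delta>0$ there exists $\kappa=\kappa(\delta)>0$, together with constants $C_\delta$ (depending only on $\delta$) and $C_\kappa=C_{\kappa(\delta)}$, such that for every sufficiently large integer $N$ there is a finite subset $\mathcal{B}_N\subset\mathcal{B}$ with: (i) $|\mathcal{B}_N|\le C_\delta e^{N^\delta}$; (ii) for every $b\in\mathcal{B}$ there is $b_0\in\mathcal{B}_N$ with $\sup_{t\le N}|b(t)-b_0(t)|\le C_\kappa N^{-\kappa}$ (the supremum over $t\in\mathbb{N}$, $t\le N$). The exceptional null set of $\omega$ does not depend on the measure-preserving system or on $f$. *)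

(* Defs.v *)
From HB Require Import structures.
From mathcomp Require Import all_boot all_order all_algebra.
From mathcomp Require Import finmap complex.
From mathcomp Require Import all_classical all_reals all_analysis.

Set Implicit Arguments.
Unset Strict Implicit.
Unset Printing Implicit Defensive.

Import Order.TTheory GRing.Theory Num.Theory.
Import numFieldNormedType.Exports.

Local Open Scope classical_set_scope.
Local Open Scope ring_scope.

(* The norm `|z| of z : R[i] lives in R[i]; this is the R-valued modulus. *)
Notation cmod := (@ComplexField.Normc.normc _).

(* Mutual independence of the subfamily of X indexed by D, through the product
   rule over finite sets of indices. *)
Definition mutually_independent (R : realType) (d : measure_display)
    (Omega : measurableType d) (P : probability Omega R)
    (D : set nat) (X : nat -> {RV P >-> R}) : Prop :=
  forall (J : {fset nat}) (A : nat -> set R),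
    [set` J] `<=` D ->
    (forall i, measurable (A i)) ->
    P (\bigcap_(i in [set` J]) (X i @^-1` A i)) =
      (\prod_(i <- J) P (X i @^-1` A i))%E.

(* Smallest m with x_1 + ... + x_m = n (x_0 is ignored); the value is 0 when
   no such m exists. *)
Definition counting_function (R : realType) (x : nat -> R) (n : nat) : nat :=
  xget 0%N [set m | \sum_(1 <= k < m.+1) x k = n%:R /\
              forall m', (m' < m)%N -> \sum_(1 <= k < m'.+1) x k <> n%:R].

(* Functions on {1, 2, ...} are encoded as functions on nat, of which only
   the values at positive integers are ever constrained or used. *)
Definition approximable (R : realType) (B : set (nat -> R[i])) : Prop :=
  forall delta : R, 0 < delta ->
  exists kappa : R, 0 < kappa /\
  exists C_delta C_kappa : R,
    \forall N \near \oo, exists BN : set (nat -> R[i]),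
      [/\ BN `<=` B,
          finite_set BN,
          (#|` fset_set BN|)%fset%:R <= C_delta * expR (N%:R `^ delta) &
          forall b, B b -> exists2 b0, BN b0 &
            forall t, (1 <= t <= N)%N ->
              cmod (b t - b0 t) <= C_kappa * N%:R `^ (- kappa)].

Definition average (R : realType) (u : nat -> R[i]) (N : nat) : R[i] :=
  N%:R^-1 * \sum_(1 <= n < N.+1) u n.

(* In \bar R, so that an unbounded family gets the supremum +oo. *)
Definition sup_modulus (R : realType) (B : set (nat -> R[i]))
    (F : (nat -> R[i]) -> R[i]) : \bar R :=
  ereal_sup [set (cmod (F b))%:E | b in B].

Definition measure_preserving (R : realType) (d : measure_display)
    (Y : measurableType d) (mu : probability Y R) (T : Y -> Y) : Prop :=
  measurable_fun setT T /\
  forall A, measurable A -> mu (T @^-1` A) = mu A.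

(* Complex-valued L^1 functions, as R[i] carries no measurable structure. *)
Definition complex_integrable (R : realType) (d : measure_display)
    (Y : measurableType d) (mu : probability Y R) (f : Y -> R[i]) : Prop :=
  mu.-integrable setT (fun y => (complex.Re (f y))%:E) /\
  mu.-integrable setT (fun y => (complex.Im (f y))%:E).

(* Main.v *)
Require Import Defs.
From HB Require Import structures.
From mathcomp Require Import all_boot all_order all_algebra.
From mathcomp Require Import finmap complex.
From mathcomp Require Import all_classical all_reals all_analysis.
From mathcomp Require Import measurable_realfun ring lra zify.

Import Order.TTheory GRing.Theory Num.Theory.
Import numFieldNormedType.Exports.

Local Open Scope classical_set_scope.
Local Open Scope ring_scope.

Set Implicit Arguments.
Unset Strict Implicit.
Unset Printing Implicit Defensive.

(** Put [gamma = 1 / 2 - alpha > 0], let [S_k] be the number of hits up to time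
    [k] and let [W_M], of order [M ^ (1 - alpha)], be the expectation of [S_M].
    Counting the samples by time instead of by number, the sum to study is
    [\sum_(k <= M) X_k b(S_k) f(T^k y)], to be compared with [W_M].  The next
    hit has number [S_(k-1) + 1], which is known before [X_k] is drawn; hence
    [coef b k = (X_k - k ^ (- alpha)) b(S_(k-1) + 1)] is a martingale difference,
    and so is [coef b k * coef b' (k + j)] as a function of the later time.  The
    conditional variances of the latter sum up to about [M ^ (2 * gamma)], so
    Freedman's inequality bounds all correlations by [M ^ (3 * gamma / 2)],
    outside an event of probability about [exp (- M ^ (gamma / 2))].  This
    absorbs the [exp (M ^ (gamma / 4))] weights of an approximating family, and
    [ae_good] follows by Borel-Cantelli.  From there on the random sequence is
    fixed, which is why the exceptional set does not depend on the system.

    Correlation bounds give two [L^2] estimates.  With the weight chosen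
    arbitrarily at each point, Schur's test for the operator composed with its
    dual ([l2_bound_choice], [mean_max_le]) bounds the supremum of the martingale
    parts over a whole family: the diagonal contributes [1 / W_M] and the rest
    [M * M ^ (3 * gamma / 2) / W_M ^ 2 <= M ^ (- gamma / 2)], which is small
    because [alpha < 1 / 2].  With the constant weight, the composition in the
    other order ([second_moment_le]) also sees the size of the averages of [f],
    and yields the control of [L^1] functions in [sampled_average_le].

    The averages tend to [0] for invariant [f] by the assumption on the means of
    the weights, and for coboundaries [u - u o T] of bounded [u]: the martingale
    part is small along the lengths [(j + 1) ^ p], and the remaining sum, with
    weights [k ^ (- alpha) b(S_(k-1) + 1)] that jump only at the hits, is summed
    by parts ([coboundary_uniformly_null]).  By Birkhoff's theorem these
    functions are dense in [L^1] ([invariant_coboundary_approx]), and the set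
    of functions for which the theorem holds is closed in [L^1] by
    [sampled_average_le] and the maximal ergodic inequality
    ([closure_uniformly_null]).  Everything is done for real weights and
    functions; the complex case follows by taking real and imaginary parts. *)

(** * Elementary real estimates *)

Section RealEstimates.
Context {R : realType}.
Implicit Types (c s x : R) (n M : nat).

Lemma powRD_nat c s n : (0 < n)%N -> n%:R `^ (c + s) = n%:R `^ c * n%:R `^ s :> R.
Proof. by move=> n0; rewrite powRD// pnatr_eq0 -lt0n n0 implybT. Qed.

Lemma powR_nat_gt0 c n : (0 < n)%N -> 0 < n%:R `^ c :> R.
Proof. by move=> n0; rewrite powR_gt0// ltr0n. Qed.

Lemma powR_nat_le c s n : (0 < n)%N -> c <= s -> n%:R `^ c <= n%:R `^ s :> R.
Proof. by move=> n0; apply: ler_powR; rewrite ler1n. Qed.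

Lemma powR_nat_mono c n M : 0 <= c -> (n <= M)%N -> n%:R `^ c <= M%:R `^ c :> R.
Proof. by move=> c0 nM; rewrite ge0_ler_powR ?nnegrE ?ler_nat. Qed.

Lemma powR_near_infty c A : 0 < c -> \forall M \near \oo, A <= M%:R `^ c :> R.
Proof.
move=> c0; near=> M.
have M0 : `|A| `^ c^-1 <= M%:R by near: M; exact: nbhs_infty_ger.
rewrite (le_trans (ler_norm A))//.
have -> : `|A| = (`|A| `^ c^-1) `^ c by rewrite -powRrM mulVf ?powRr1// lt0r_neq0.
by apply: ge0_ler_powR; rewrite ?nnegrE ?powR_ge0 ?ler0n ?(ltW c0).
Unshelve. all: by end_near. Qed.

Lemma powR_near_infty0 c A : 0 < c -> 0 < A -> \forall M \near \oo, M%:R `^ (- c) <= A :> R.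
Proof.
move=> c0 A0; near=> M.
have M0 : (0 < M)%N by near: M; exact: nbhs_infty_gt.
rewrite powRN -[A]invrK lef_pV2 ?posrE ?powR_nat_gt0 ?invr_gt0//.
by near: M; exact: powR_near_infty.
Unshelve. all: by end_near. Qed.

(** Convexity of [u |-> exp u] between [0] and [ln (1 - x)]. *)
Lemma powR_bernoulli s x : 0 < s <= 1 -> 0 <= x < 1 -> (1 - x) `^ s <= 1 - s * x.
Proof.
move=> /andP[s0 s1] /andP[x0 x1].
have s01 : 0 <= s <= 1 by rewrite ltW.
have x1' : 0 < 1 - x by rewrite subr_gt0.
have si : Itv.spec (@Itv.num_sem R) (Itv.Real `[Posz 0, Posz 1]%Z) s.
  by rewrite /= /Itv.num_sem /= num_real /= in_itv /= s01.
have := @convex_expR R (Itv.mk si) (ln (1 - x)) 0.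
by rewrite !convRE /= /unstable.onem lnK ?posrE// expR0 mulr0 addr0 {1}/powR gt_eqF//=; lra.
Qed.

(** The increments of [k ^ s / s] dominate the terms, by [powR_bernoulli]. *)
Lemma sum_powR_le s M : 0 < s <= 1 ->
  \sum_(1 <= k < M.+1) k%:R `^ (s - 1) <= M%:R `^ s / s.
Proof.
move=> s01; have /andP[s0 s1] := s01.
elim: M => [|M IH]; first by rewrite big_geq// divr_ge0 ?powR_ge0 ?ltW.
rewrite big_nat_recr//= (le_trans (lerD IH (lexx _)))//.
rewrite ler_pdivlMr// mulrDl divfK ?gt_eqF//.
have n0 : 0 < M.+1%:R :> R by rewrite ltr0n.
have := @powR_bernoulli s (M.+1%:R^-1) s01.
rewrite invr_ge0 ler0n/=; case: M IH n0 => [|M] IH n0.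
  move=> _; rewrite !powR1 mul1r.
  by rewrite powR0 ?gt_eqF// add0r.
rewrite invf_lt1// ltr1n => /(_ isT).
have e2 : M.+2%:R = M.+1%:R + 1 :> R by rewrite -natr1.
have -> : 1 - M.+2%:R^-1 = M.+1%:R / M.+2%:R :> R.
  have m0 : 0 < M.+1%:R :> R by rewrite ltr0n.
  by rewrite e2; move: (M.+1%:R : R) m0 => a a0; field; rewrite gt_eqF//; lra.
rewrite powRM ?invr_ge0// -powR_inv1// -powRrM mulN1r powRN.
rewrite ler_pdivrMr ?powR_nat_gt0// => H; rewrite (le_trans (lerD H (lexx _)))//.
rewrite powRD_nat// powR_inv1//.
by move: (_^-1) (_ `^ s) => a b; lra.
Qed.

Lemma sum_invsq_le n : \sum_(k < n) (k.+1%:R ^+ 2)^-1 <= 2 :> R.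
Proof.
suff : \sum_(k < n) (k.+1%:R ^+ 2)^-1 <= 2 - n%:R^-1 :> R.
  by move/le_trans; apply; rewrite lerBlDr lerDl invr_ge0.
elim: n => [|[_|n IH]]; first by rewrite big_ord0 invr0; lra.
  by rewrite big_ord1 expr1n invr1; lra.
rewrite big_ord_recr/= (le_trans (lerD IH (lexx _)))//.
have a0 : 0 < n.+1%:R :> R by rewrite ltr0n.
have ab : n.+2%:R = n.+1%:R + 1 :> R by rewrite -natr1.
rewrite ab; move: (n.+1%:R : R) a0 => a a0.
have -> : 2 - (a + 1)^-1 = 2 - a^-1 + (a * (a + 1))^-1.
  by field; rewrite !gt_eqF//; lra.
by rewrite lerD// lef_pV2 ?posrE; nra.
Qed.

(** From [exp u <= 1 / (1 - u)]; the factor [2] leaves room for [u] up to [1 / 2]. *)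
Lemma expR_le_quad u : u <= 1 / 2 -> expR u <= 1 + u + 2 * u ^+ 2 :> R.
Proof.
move=> u2; have := @expR_ge1Dx R (- u) => H.
have u1 : 0 < 1 - u by lra.
have : expR u <= (1 - u)^-1.
  rewrite -[u in expR u]opprK expRN lef_pV2 ?posrE ?expR_gt0//.
by move/le_trans; apply; rewrite -div1r ler_pdivrMr//; nra.
Qed.

(** Comparison with a term of the exponential series. *)
Lemma expR_powR_decay c B : 0 < c ->
  \forall M \near \oo, expR (- (M%:R `^ c)) <= M%:R `^ (- B) :> R.
Proof.
move=> c0; pose n := (Num.truncn ((`|B| + 1) / c)).+1.
have nB : B + 1 <= c * n%:R.
  rewrite mulrC -ler_pdivrMr//; apply: (@le_trans _ _ ((`|B| + 1) / c)).
    by rewrite ler_pM2r ?invr_gt0// lerD2r ler_norm.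
  by apply/ltW/Num.Theory.truncnS_gt.
near=> M.
have M0 : (0 < M)%N by near: M; exact: nbhs_infty_gt.
rewrite expRN powRN lef_pV2 ?posrE ?expR_gt0 ?powR_nat_gt0//.
have := @expR_ge1Dxn R (M%:R `^ c) n.-1 (powR_ge0 _ _); rewrite prednK//.
move/(le_trans _); apply; rewrite -[leLHS]add0r lerD//.
rewrite -powR_mulrn ?powR_ge0// -powRrM ler_pdivlMr ?ltr0n ?fact_gt0//.
apply: (@le_trans _ _ (M%:R `^ B * M%:R `^ 1)); last by rewrite -powRD_nat// powR_nat_le.
by rewrite ler_pM2l ?powR_nat_gt0// powRr1// ; near: M; exact: nbhs_infty_ger.
Unshelve. all: by end_near. Qed.

End RealEstimates.

(** * Bit histories and Ville's inequality *)

Section SparseSequence.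
Context {R : realType}.

(** Bit sequences are read from index [1] on; [sigma al k] is the probability that
    the bit [k] is set. *)
Definition sigma (al : R) (k : nat) : R := k%:R `^ (- al).
Definition Ehits (al : R) (m : nat) : R := \sum_(1 <= k < m.+1) sigma al k.
Definition hits (e : nat -> bool) (m : nat) : nat := \sum_(1 <= k < m.+1) e k.
Definition hist (e : nat -> bool) (m : nat) : seq bool := mkseq (fun i => e i.+1) m.

Lemma histS e m : hist e m.+1 = rcons (hist e m) (e m.+1).
Proof. exact: mkseqS. Qed.

Lemma size_hist e m : size (hist e m) = m.
Proof. exact: size_mkseq. Qed.

Lemma take_hist e n m : (n <= m)%N -> take n (hist e m) = hist e n.
Proof. by move=> nm; rewrite /hist /mkseq -map_take take_iota (minn_idPl nm). Qed.

Lemma nth_hist e m i : (i < m)%N -> nth false (hist e m) i = e i.+1.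
Proof. exact: nth_mkseq. Qed.

Lemma hitsS e m : hits e m.+1 = (hits e m + e m.+1)%N.
Proof. by rewrite /hits big_nat_recr. Qed.

Lemma hits0 e : hits e 0 = 0%N.
Proof. by rewrite /hits big_geq. Qed.

Lemma count_hist e m : count id (hist e m) = hits e m.
Proof.
elim: m => [|m IH]; first by rewrite hits0.
by rewrite histS -cats1 count_cat IH /= addn0 hitsS.
Qed.

Lemma sigma_gt0 al k : (0 < k)%N -> 0 < sigma al k.
Proof. exact: powR_nat_gt0. Qed.

Lemma sigma_le1 al k : 0 <= al -> (0 < k)%N -> sigma al k <= 1.
Proof.
move=> al0 k0; rewrite /sigma powRN invf_le1 ?powR_nat_gt0//.
by rewrite -[leLHS](powRr0 k%:R) powR_nat_le.
Qed.

Lemma sigma_mono al k m : 0 <= al -> (0 < k <= m)%N -> sigma al m <= sigma al k.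
Proof.
move=> al0 /andP[k0 km]; rewrite /sigma !powRN lef_pV2 ?posrE ?powR_nat_gt0//.
  by rewrite powR_nat_mono.
exact: leq_trans km.
Qed.

End SparseSequence.

Section Bernoulli.
Context {R : realType} {d : measure_display} {Omega : measurableType d}.
Context {P : probability Omega R} (al : R) (X : nat -> {RV P >-> R}).
Hypothesis X_01 : forall n w, (1 <= n)%N -> X n w = 0 \/ X n w = 1.
Hypothesis X_indep : mutually_independent [set n | (1 <= n)%N] X.
Hypothesis X_mean : forall n, (1 <= n)%N -> ('E_P[X n] = (n%:R `^ (- al))%:E)%E.

Definition bits (w : Omega) (k : nat) : bool := X k w == 1.

Lemma bitsE k w : (0 < k)%N -> X k w = (bits w k)%:R.
Proof. by move=> /(X_01 w); rewrite /bits => -[] ->; rewrite ?eqxx// eq_sym oner_eq0. Qed.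

Lemma measurable_X_preimage k (A : set R) : measurable A -> measurable (X k @^-1` A).
Proof. by move=> mA; rewrite -[X in measurable X]setTI; exact: measurable_funP. Qed.

Lemma measurable_bits k : measurable [set w | bits w k].
Proof.
rewrite (_ : [set _ | _] = X k @^-1` [set 1]); first exact: measurable_X_preimage.
by apply/seteqP; split => w /=; rewrite /bits => /eqP.
Qed.

Lemma measurable_hist (Q : seq bool -> bool) m : measurable [set w | Q (hist (bits w) m)].
Proof.
elim: m Q => [|m IH] Q.
  have [q|/negbTE q] := boolP (Q [::]).
    by rewrite (_ : [set _ | _] = setT)//; apply/seteqP; split => w//=; rewrite q.
  by rewrite (_ : [set _ | _] = set0)//; apply/seteqP; split => w//=; rewrite q.
rewrite (_ : [set _ | _] =
  ([set w | bits w m.+1] `&` [set w | Q (rcons (hist (bits w) m) true)]) `|`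
  (~` [set w | bits w m.+1] `&` [set w | Q (rcons (hist (bits w) m) false)])).
  apply: measurableU; apply: measurableI; first exact: measurable_bits.
  - exact: (IH (fun h => Q (rcons h true))).
  - by apply: measurableC; exact: measurable_bits.
  - exact: (IH (fun h => Q (rcons h false))).
apply/seteqP; split => w /=; rewrite histS; case: (bits w m.+1).
- by left.
- by right.
- by case=> -[].
- by case=> -[].
Qed.

Definition law (k : nat) (b : bool) : R := if b then sigma al k else 1 - sigma al k.

Lemma P_bits k b : (0 < k)%N -> P [set w | bits w k = b] = (law k b)%:E.
Proof.
move=> k0.
have P1 : P [set w | bits w k] = (sigma al k)%:E.
  rewrite -(expectation_indic P (measurable_bits k)) -X_mean//.
  congr expectation; apply/funext => w; rewrite indicE bitsE//=.
  by congr ((nat_of_bool _)%:R); apply/idP/idP; rewrite inE.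
case: b => //=.
rewrite (_ : [set _ | _] = ~` [set w | bits w k]).
  by rewrite probability_setC ?P1//; exact: measurable_bits.
by apply/seteqP; split => w /=; [move=> ->|move/negP/negbTE].
Qed.

Fixpoint first_indices (m : nat) : {fset nat} :=
  if m is n.+1 then (n.+1 |` first_indices n)%fset else fset0.

Lemma in_first_indices m k : (k \in first_indices m) = (0 < k <= m)%N.
Proof.
elim: m => [|m IH] /=; first by rewrite inE; lia.
by rewrite !inE IH; lia.
Qed.

Lemma hist_eqP w (s : seq bool) : hist (bits w) (size s) = s <->
  (forall i, (0 < i <= size s)%N -> bits w i = nth false s i.-1).
Proof.
split=> [<- i|h].
  by rewrite size_hist => ?; rewrite nth_hist ?prednK//; lia.
apply: (@eq_from_nth _ false); rewrite size_hist// => i iS.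
by rewrite nth_hist// h.
Qed.

(** Independence, for the events that the first bits take given values. *)
Lemma P_hist (s : seq bool) : P [set w | hist (bits w) (size s) = s] =
  (\prod_(i <- first_indices (size s)) (law i (nth false s i.-1)))%:E.
Proof.
pose A i := [set (nth false s i.-1)%:R : R].
have bA i w : (0 < i)%N -> (X i w = (nth false s i.-1)%:R) <-> (bits w i = nth false s i.-1).
  move=> i0; rewrite bitsE//; split => [|->//].
  by case: (bits w i) (nth _ _ _) => -[]// /eqP; rewrite ?oner_eq0// eq_sym oner_eq0.
rewrite (_ : [set _ | _] = \bigcap_(i in [set` first_indices (size s)]) (X i @^-1` A i)).
  rewrite X_indep.
  - rewrite (big_morph EFin (@EFinM R) erefl); apply: eq_big_seq => i; rewrite in_first_indices
      => /andP[i0 _].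
    rewrite -P_bits//; congr (P _); apply/seteqP; split => w /=.
      by move/(bA i w i0).
    by move=> h; apply/bA.
  - by move=> i /=; rewrite in_first_indices => /andP[].
  - by move=> i; exact: measurable_set1.
apply/seteqP; split => w /=.
  move=> /hist_eqP h i /=; rewrite in_first_indices => /[dup] /andP[i0 _] ii.
  by apply/bA => //; exact: h.
move=> h; apply/hist_eqP => i /[dup] /andP[i0 _] ii.
by apply/bA => //; apply: h => /=; rewrite in_first_indices.
Qed.

Lemma P_hist_rcons s b : (P [set w | hist (bits w) (size s).+1 = rcons s b] =
  P [set w | hist (bits w) (size s) = s] * (law (size s).+1 b)%:E)%E.
Proof.
have := P_hist (rcons s b); rewrite size_rcons => ->; rewrite P_hist -EFinM; congr (_ %:E).
rewrite big_fsetU1 /=; last by rewrite in_first_indices; lia.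
rewrite nth_rcons ltnn eqxx mulrC; congr (_ * _).
apply: eq_big_seq => i; rewrite in_first_indices => /andP[i0 im].
by rewrite nth_rcons ifT// prednK.
Qed.

(** Ville's inequality, by induction on the number of bits still to come: the
    event is split according to the next bit. *)
Lemma ville (G : seq bool -> R) (a : R) m :
  (forall h, 0 <= G h) ->
  (forall h, sigma al (size h).+1 * G (rcons h true) +
             (1 - sigma al (size h).+1) * G (rcons h false) <= G h) ->
  (a%:E * P [set w | (a <= G (hist (bits w) m))%R] <= (G [::])%:E)%E.
Proof.
move=> G0 superG.
suff H k s : (a%:E * P [set w | (hist (bits w) (size s) == s) &&
                       (a <= G (hist (bits w) (size s + k)))%R] <=
   (G s)%:E * P [set w | hist (bits w) (size s) = s])%E.
  have := H m [::]; rewrite /= add0n (_ : [set w | _ = _] = setT) ?probability_setT ?mule1//.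
  by apply/seteqP; split.
have mh s' b : measurable [set w | hist (bits w) (size s').+1 = rcons s' b].
  rewrite (_ : [set _ | _] = [set w | hist (bits w) (size s').+1 == rcons s' b]).
    exact: (measurable_hist (fun h => h == rcons s' b)).
  by apply/seteqP; split => w /= /eqP.
elim: k s => [|k IH] s.
  rewrite addn0; have [aG|/negbTE aG] := boolP (a <= G s).
    rewrite (_ : [set w | _ && _] = [set w | hist (bits w) (size s) = s]).
      by rewrite lee_wpmul2r// lee_fin.
    apply/seteqP; split => w /=; first by case/andP => /eqP.
    by move=> ->; rewrite eqxx.
  rewrite (_ : [set w | _ && _] = set0) ?measure0 ?mule0 ?mule_ge0 ?lee_fin//.
  by apply/seteqP; split => w //= /andP[/eqP ->]; rewrite aG.
pose E b := [set w | (hist (bits w) (size (rcons s b)) == rcons s b) &&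
                     (a <= G (hist (bits w) (size (rcons s b) + k)))].
have mE b : measurable (E b).
  pose Q h := (take (size (rcons s b)) h == rcons s b) && (a <= G h).
  rewrite (_ : E b = [set w | Q (hist (bits w) (size (rcons s b) + k))]).
    exact: measurable_hist.
  rewrite /E /Q; apply/seteqP; split => w /=; rewrite take_hist ?leq_addr//.
rewrite (_ : [set w | _ && _] = E true `|` E false); last first.
  rewrite /E !size_rcons; apply/seteqP; split => w /=; rewrite histS ?addSnnS.
    move=> /andP[/eqP -> ->]; case: (bits w _); [left|right]; by rewrite eqxx.
  by rewrite !eqseq_rcons; case=> /andP[/andP[-> _] ->].
rewrite measureU//; last first.
  apply/seteqP; split => w //= [] /andP[/eqP + _] /andP[/eqP + _].
  by rewrite !size_rcons => -> /eqP; rewrite eqseq_rcons andbF.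
rewrite ge0_muleDr//.
apply: (le_trans (leeD (IH (rcons s true)) (IH (rcons s false)))).
rewrite !size_rcons !P_hist_rcons.
have Pf : P [set w | hist (bits w) (size s) = s] \is a fin_num by rewrite P_hist.
rewrite -(fineK Pf) -!EFinM -EFinD lee_fin /law.
have p0 : 0 <= fine (P [set w | hist (bits w) (size s) = s]) by rewrite fine_ge0.
by have := ler_wpM2r p0 (superG s); lra.
Qed.

End Bernoulli.

(** * Freedman's inequality and the Borel-Cantelli lemma *)

Section Martingale.
Context {R : realType} (al : R).

(** The value on a bit history of the martingale transform of the centred bits
    by the predictable sequence [c], and its compensator. *)
Definition mart (c : seq bool -> R) (h : seq bool) : R :=
  \sum_(n < size h) c (take n h) * ((nth false h n)%:R - sigma al n.+1).
Definition qvar (c : seq bool -> R) (h : seq bool) : R :=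
  \sum_(n < size h) c (take n h) ^+ 2 * sigma al n.+1.

Lemma mart_rcons c h b :
  mart c (rcons h b) = mart c h + c h * (b%:R - sigma al (size h).+1).
Proof.
rewrite /mart size_rcons big_ord_recr/= nth_rcons ltnn eqxx -cats1 take_size_cat//.
congr (_ + _); apply: eq_bigr => i _; rewrite nth_cat ltn_ord takel_cat//.
exact: ltnW.
Qed.

Lemma qvar_rcons c h b :
  qvar c (rcons h b) = qvar c h + c h ^+ 2 * sigma al (size h).+1.
Proof.
rewrite /qvar size_rcons big_ord_recr/= -cats1 take_size_cat//.
congr (_ + _); apply: eq_bigr => i _; rewrite takel_cat//.
exact: ltnW.
Qed.

Lemma mart_hist c e m : mart c (hist e m) =
  \sum_(n < m) c (hist e n) * ((e n.+1)%:R - sigma al n.+1).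
Proof.
rewrite /mart size_hist; apply: eq_bigr => i _.
by rewrite take_hist ?nth_hist// ltnW.
Qed.

Lemma qvar_hist c e m : qvar c (hist e m) =
  \sum_(n < m) c (hist e n) ^+ 2 * sigma al n.+1.
Proof.
rewrite /qvar size_hist; apply: eq_bigr => i _.
by rewrite take_hist// ltnW.
Qed.

Lemma martN c h : mart (fun s => - c s) h = - mart c h.
Proof. by rewrite /mart -sumrN; apply: eq_bigr => i _; rewrite mulNr. Qed.

Lemma qvarN c h : qvar (fun s => - c s) h = qvar c h.
Proof. by rewrite /qvar; apply: eq_bigr => i _; rewrite sqrrN. Qed.

(** One step of the exponential supermartingale, for a centred Bernoulli variable. *)
Lemma bernoulli_mgf (p u : R) : 0 <= p <= 1 -> u <= 1 / 2 ->
  p * expR (u * (1 - p)) + (1 - p) * expR (u * (0 - p)) <= expR (2 * u ^+ 2 * p).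
Proof.
move=> /andP[p0 p1] u2.
have -> : expR (u * (1 - p)) = expR u * expR (- (u * p)) by rewrite -expRD; congr expR; ring.
have -> : u * (0 - p) = - (u * p) by ring.
rewrite mulrA -mulrDl expRN ler_pdivrMr ?expR_gt0// -expRD.
apply: le_trans (expR_ge1Dx _).
have /(ler_wpM2l p0) := expR_le_quad u2; lra.
Qed.

End Martingale.

Section Freedman.
Context {R : realType} {d : measure_display} {Omega : measurableType d}.
Context {P : probability Omega R} (al : R) (X : nat -> {RV P >-> R}).
Hypothesis al0 : 0 <= al.
Hypothesis X_01 : forall n w, (1 <= n)%N -> X n w = 0 \/ X n w = 1.
Hypothesis X_indep : mutually_independent [set n | (1 <= n)%N] X.
Hypothesis X_mean : forall n, (1 <= n)%N -> ('E_P[X n] = (n%:R `^ (- al))%:E)%E.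

(** Freedman's inequality: Ville's inequality for the supermartingale
    [exp (t * mart - 2 * t ^ 2 * qvar)]. *)
Lemma freedman (c : seq bool -> R) (t a v : R) m :
  (forall h, `|c h| <= 1) -> 0 <= t <= 1 / 2 ->
  (P [set w | ((a <= mart al c (hist (bits X w) m)) &&
              (qvar al c (hist (bits X w) m) <= v))%R] <=
   (expR (- (t * a) + 2 * t ^+ 2 * v))%:E)%E.
Proof.
move=> c1 /andP[t0 t2].
pose G h := expR (t * mart al c h - 2 * t ^+ 2 * qvar al c h).
have G0 h : 0 <= G h by exact: expR_ge0.
have := @ville R d Omega P al X X_01 X_indep X_mean G (expR (t * a - 2 * t ^+ 2 * v)) m G0.
have -> : (G [::])%:E = 1%E.
  by rewrite /G /mart /qvar !big_ord0 !mulr0 subr0 expR0.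
move=> V.
have {}V : ((expR (t * a - 2 * t ^+ 2 * v))%:E *
   P [set w | (expR (t * a - 2 * t ^+ 2 * v) <= G (hist (bits X w) m))%R] <= 1)%E.
  apply: V => h; rewrite /G !mart_rcons !qvar_rcons.
  set s := sigma al (size h).+1; set A := mart al c h; set B := qvar al c h; set C := c h.
  have s01 : 0 <= s <= 1 by rewrite ltW ?sigma_gt0// sigma_le1.
  have E b : expR (t * (A + C * (b%:R - s)) - 2 * t ^+ 2 * (B + C ^+ 2 * s)) =
     expR (t * A - 2 * t ^+ 2 * B) * (expR ((t * C) * (b%:R - s)) * expR (- (2 * (t * C) ^+ 2 *
         s))).
    by rewrite -!expRD; congr expR; ring.
  rewrite !E [s * _]mulrCA [(1 - s) * _]mulrCA -mulrDr -[leRHS]mulr1.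
  rewrite ler_pM2l ?expR_gt0// [s * (_ * _)]mulrA [(1 - s) * (_ * _)]mulrA -mulrDl expRN
      ler_pdivrMr ?expR_gt0// mul1r.
  apply: bernoulli_mgf => //.
  rewrite (le_trans (ler_norm _))// normrM (ger0_norm t0).
  by rewrite (le_trans _ t2)// ler_piMr// c1.
have -> : - (t * a) + 2 * t ^+ 2 * v = - (t * a - 2 * t ^+ 2 * v) by ring.
rewrite expRN -[leRHS]mule1 -lee_pdivrMl; last first.
  by rewrite invr_gt0 expR_gt0.
rewrite invrK (le_trans _ V)// lee_pmul2l ?lte_fin ?expR_gt0//.
apply: le_measure; rewrite ?inE.
- exact: (@measurable_hist _ _ _ P X (fun h => (a <= mart al c h) && (qvar al c h <= v))).
- exact: (@measurable_hist _ _ _ P X (fun h => expR (t * a - 2 * t ^+ 2 * v) <= G h)).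
move=> w /= /andP[aM qv]; rewrite ler_expR lerB// ler_wpM2l//.
by rewrite mulr_ge0// sqr_ge0.
Qed.

(** Union bound over [L] and the two signs. *)
Lemma freedman_union (L : seq (seq bool -> R)) (t a v : R) m :
  (forall c, c \in L -> forall h, `|c h| <= 1) -> 0 <= t <= 1 / 2 ->
  (P [set w | has (fun c => (a <= `|mart al c (hist (bits X w) m)|)%R &&
              (qvar al c (hist (bits X w) m) <= v)%R) L] <=
   ((size L)%:R * 2 * expR (- (t * a) + 2 * t ^+ 2 * v))%:E)%E.
Proof.
move=> + t2; elim: L => [|c L IH] c1.
  rewrite (_ : [set _ | _] = set0) ?measure0 ?lee_fin /= ?mul0r//.
  by apply/seteqP; split => w.
have {}IH := IH (fun c' h => c1 c' (@mem_behead _ (c :: L) c' h)).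
have c1' : forall h, `|c h| <= 1 by apply: c1; rewrite mem_head.
have cN1' : forall h, `|- c h| <= 1 by move=> h; rewrite normrN.
have F1 := freedman a v m c1' t2; have F2 := freedman a v m cN1' t2.
have mE c' : measurable [set w | ((a <= mart al c' (hist (bits X w) m)) &&
              (qvar al c' (hist (bits X w) m) <= v))%R].
  exact: (@measurable_hist _ _ _ P X (fun h => (a <= mart al c' h) && (qvar al c' h <= v))).
have mL : measurable [set w | has (fun c => (a <= `|mart al c (hist (bits X w) m)|)%R &&
              (qvar al c (hist (bits X w) m) <= v)%R) L].
  exact: (@measurable_hist _ _ _ P X
    (fun h => has (fun c => (a <= `|mart al c h|) && (qvar al c h <= v)) L)).
rewrite /= -natr1 mulrDl mul1r mulrDl.
rewrite (_ : [set w | _] = ([set w | ((a <= mart al c (hist (bits X w) m)) &&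
              (qvar al c (hist (bits X w) m) <= v))%R] `|`
   [set w | ((a <= mart al (fun h => - c h) (hist (bits X w) m)) &&
              (qvar al (fun h => - c h) (hist (bits X w) m) <= v))%R]) `|`
   [set w | has (fun c => (a <= `|mart al c (hist (bits X w) m)|)%R &&
              (qvar al c (hist (bits X w) m) <= v)%R) L]); last first.
  apply/seteqP; split => w /=; rewrite martN qvarN ler_normr andb_orl.
    by move=> /orP[/orP[->|->]|->]; [left; left|left; right|right].
  by move=> [[->//|->]|->]; rewrite ?orbT.
apply: le_trans; first by apply: measureU2 => //; exact: measurableU.
rewrite addrC EFinD leeD//.
apply: le_trans; first exact: measureU2.
by rewrite mulrDl mul1r EFinD leeD.
Qed.

End Freedman.

Section BorelCantelli.
Context {R : realType} {d : measure_display} {Omega : measurableType d}.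
Context {P : probability Omega R}.

(** Quadratic decay of the probabilities makes them summable; every application
    below has much faster decay. *)
Lemma borel_cantelli_invsq (E : nat -> set Omega) (K : R) :
  (forall M, measurable (E M)) ->
  (\forall M \near \oo, (P (E M) <= (K * M%:R `^ (- 2))%:E)%E) ->
  {ae P, forall w, \forall M \near \oo, ~ E M w}.
Proof.
move=> mE [M0 _ H].
pose F n := E (n + M0).+1.
have F0 : P (lim_sup_set F) = 0.
  apply: lim_sup_set_cvg0; first by move=> k; exact: mE.
  apply: (@le_lt_trans _ _ (`|K| * 2)%:E); last by rewrite ltry.
  apply: lime_le; first exact: is_cvg_nneseries.
  near=> n; rewrite big_mkord.
  apply: (@le_trans _ _ (\sum_(i < n) (`|K| * (i.+1%:R ^+ 2)^-1)%:E)%E).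
    apply: lee_sum => i _; apply: (le_trans (H _ _)) => /=; first by rewrite ltnW// ltnS leq_addl.
    rewrite lee_fin powRN powR_mulrn//.
    apply: (@le_trans _ _ (`|K| * ((i + M0).+1%:R ^+ 2)^-1)).
      by rewrite ler_wpM2r// ?ler_norm// invr_ge0 exprn_ge0.
    rewrite ler_wpM2l// lef_pV2 ?posrE ?exprn_gt0 ?ltr0n//.
    by rewrite lerXn2r ?nnegrE// ler_nat ltnS leq_addr.
  by rewrite sumEFin lee_fin -mulr_sumr ler_wpM2l// sum_invsq_le.
have mF : measurable (lim_sup_set F).
  by apply: bigcap_measurable => // k _; apply: bigcup_measurable => // j _; exact: mE.
exists (lim_sup_set F); split => // w /= nE k _ /=.
apply: contrapT => nU; apply: nE.
exists (k + M0).+1 => // M /= kM EM; apply: nU.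
exists (M - M0.+1)%N => /=; first by lia.
by rewrite /F (_ : (M - M0.+1 + M0).+1 = M)//; lia.
Unshelve. all: by end_near. Qed.

End BorelCantelli.

(** * Almost every sequence is good *)

Section Weights.
Context {R : realType} (al : R).
Hypotheses (al_gt0 : 0 < al) (al_lt : al < 1 / 2).

Lemma Ehits_ord m : Ehits al m = \sum_(n < m) sigma al n.+1.
Proof. by rewrite /Ehits big_add1 big_mkord. Qed.

Lemma EhitsS m : Ehits al m.+1 = Ehits al m + sigma al m.+1.
Proof. by rewrite /Ehits big_nat_recr. Qed.

Lemma Ehits_ge m : m%:R `^ (1 - al) <= Ehits al m.
Proof.
have a1 : 1 - al != 0 by rewrite gt_eqF//; have := al_lt; lra.
case: m => [|m]; first by rewrite /Ehits big_geq// powR0.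
rewrite powRD_nat// powRr1// Ehits_ord -/(sigma al m.+1) mulr_natl -[X in _ *+ X]card_ord
    -sumr_const.
by apply: ler_sum => i _; apply: sigma_mono; [exact: ltW|exact: ltn_ord].
Qed.

Lemma Ehits_gt0 m : (0 < m)%N -> 0 < Ehits al m.
Proof. by move=> m0; apply: lt_le_trans (Ehits_ge m); exact: powR_nat_gt0. Qed.

Lemma Ehits_ge0 m : 0 <= Ehits al m.
Proof. exact: le_trans (powR_ge0 _ _) (Ehits_ge m). Qed.

Lemma Ehits_le m : Ehits al m <= m%:R `^ (1 - al) / (1 - al).
Proof.
have := @sum_powR_le R (1 - al) m; rewrite /Ehits.
rewrite (_ : 1 - al - 1 = - al); last by ring.
by apply; have := al_lt; have := al_gt0; lra.
Qed.

(** [Ehits m / m] decreases, being an average of a decreasing sequence. *)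
Lemma Ehits_ratio m n : (0 < m <= n)%N -> Ehits al n * m%:R <= Ehits al m * n%:R.
Proof.
move=> /andP[m0 /subnK <-]; elim: (n - m)%N => [|k IH]; first by rewrite add0n.
rewrite addSn EhitsS mulrDl -natr1 mulrDr mulr1 lerD//.
rewrite Ehits_ord mulr_natr -[X in _ *+ X]card_ord -sumr_const.
apply: ler_sum => i _; apply: sigma_mono; first exact: ltW.
by rewrite /= ltnS (leq_trans (ltnW (ltn_ord i)))// leq_addl.
Qed.

Lemma sum_sigma_sqr_le m : \sum_(1 <= k < m.+1) sigma al k ^+ 2 <=
  m%:R `^ (2 * (1 / 2 - al)) / (2 * (1 / 2 - al)).
Proof.
have := @sum_powR_le R (2 * (1 / 2 - al)) m.
rewrite (_ : _ - 1 = - al * 2); last by field.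
move=> H; apply: le_trans (H _); last by have := al_lt; have := al_gt0; lra.
by apply: ler_sum => i _; rewrite powRrM powR_mulrn// powR_ge0.
Qed.

End Weights.

Section GoodSequences.
Context {R : realType} (al : R).

(** The martingale differences attached to the weight [b]: the index
    [(hits e k.-1).+1] of the next hit is known before the bit [e k] is. *)
Definition coef (e : nat -> bool) (b : nat -> R) (k : nat) : R :=
  ((e k)%:R - sigma al k) * b (hits e k.-1).+1.

(** The three properties of the random sequence on which everything else rests:
    a law of large numbers, a bound on the weighted hits, and square root cancellation
    in the correlations of the martingale differences. *)
Definition good (fam : nat -> seq (nat -> R)) (e : nat -> bool) : Prop :=
  [/\ \forall M \near \oo,
        `|(hits e M)%:R - Ehits al M| <= 2 * M%:R `^ (- (1 / 8)) * Ehits al M,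
      \forall M \near \oo,
        \sum_(1 <= k < M.+1) sigma al k * (e k)%:R <=
          (2 + (1 / 2 - al)^-1) * M%:R `^ (2 * (1 / 2 - al)) &
      \forall M \near \oo, forall b b', b \in fam M -> b' \in fam M ->
        forall j, (0 < j)%N ->
        `|\sum_(1 <= k < (M - j).+1) coef e b k * coef e b' (k + j)| <=
          M%:R `^ (3 / 2 * (1 / 2 - al))].

(** [coef b k * b' _], read off the history of length [n.-1], where [n = k + j];
    multiplied by the centred bit [n] it gives [coef b k * coef b' n]. *)
Definition corr_coef (j : nat) (b b' : nat -> R) (h : seq bool) : R :=
  if (j <= size h)%N then
    let k := ((size h).+1 - j)%N in
    ((nth false h k.-1)%:R - sigma al k) * b (count id (take k.-1 h)).+1 *
      b' (count id h).+1
  else 0.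

Lemma corr_coef_hist j b b' e n : (0 < j)%N -> corr_coef j b b' (hist e n) =
  if (j <= n)%N then coef e b (n.+1 - j) * b' (hits e n).+1 else 0.
Proof.
move=> j0; rewrite /corr_coef size_hist; case: ifP => // jn.
rewrite nth_hist; last by lia.
by rewrite take_hist ?count_hist ?prednK //; lia.
Qed.

Lemma mart_corr j b b' e M : (0 < j)%N ->
  mart al (corr_coef j b b') (hist e M) =
  \sum_(1 <= k < (M - j).+1) coef e b k * coef e b' (k + j).
Proof.
move=> j0; rewrite mart_hist -(big_mkord xpredT (fun n => corr_coef j b b' (hist e n) *
  ((e n.+1)%:R - sigma al n.+1))) big_add1/=.
have [Mj|jM] := leqP M j.
  rewrite (_ : M - j = 0)%N; last by lia.
  rewrite [RHS]big_geq// big_nat big1// => i /andP[_ iM].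
  by rewrite corr_coef_hist// ifF ?mul0r//; apply/negbTE; rewrite -ltnNge; exact: leq_trans Mj.
rewrite (big_cat_nat (n := j))//=; last exact: ltnW.
rewrite big_nat big1 ?add0r; last first.
  by move=> i /andP[_ iM]; rewrite corr_coef_hist// ifF ?mul0r//; apply/negbTE; rewrite -ltnNge.
rewrite -{1}[j]add0n big_addn; apply: eq_bigr => i _.
rewrite corr_coef_hist// leq_addl -addSn addnK -mulrA; congr (_ * _).
by rewrite mulrC /coef addSn.
Qed.

Lemma hits_le e m : (hits e m <= m)%N.
Proof. by elim: m => [|m IH]; rewrite ?hits0// hitsS -addn1 leq_add// leq_b1. Qed.

End GoodSequences.

Section AlmostSurelyGood.
Context {R : realType} {d : measure_display} {Omega : measurableType d}.
Context {P : probability Omega R} (al : R) (X : nat -> {RV P >-> R}).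
Hypotheses (al_gt0 : 0 < al) (al_lt : al < 1 / 2).
Hypothesis X_01 : forall n w, (1 <= n)%N -> X n w = 0 \/ X n w = 1.
Hypothesis X_indep : mutually_independent [set n | (1 <= n)%N] X.
Hypothesis X_mean : forall n, (1 <= n)%N -> ('E_P[X n] = (n%:R `^ (- al))%:E)%E.

Let g : R := 1 / 2 - al.
Let g_gt0 : 0 < g. Proof. by rewrite subr_gt0. Qed.
Let al_ge0 : 0 <= al. Proof. exact: ltW. Qed.

Lemma ae_freedman (L : nat -> seq (seq bool -> R)) (t a v : nat -> R) (K : R) :
  (forall M c, c \in L M -> forall h, `|c h| <= 1) ->
  (\forall M \near \oo, 0 <= t M <= 1 / 2) ->
  (\forall M \near \oo,
    (size (L M))%:R * 2 * expR (- (t M * a M) + 2 * t M ^+ 2 * v M) <= K * M%:R `^ (- 2)) ->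
  {ae P, forall w, \forall M \near \oo, forall c, c \in L M ->
    qvar al c (hist (bits X w) M) <= v M -> `|mart al c (hist (bits X w) M)| <= a M}.
Proof.
move=> c1 t2 small.
pose Q M h := has (fun c => (a M <= `|mart al c h|) && (qvar al c h <= v M)) (L M).
have := @borel_cantelli_invsq R d Omega P
  (fun M => [set w | Q M (hist (bits X w) M)]) K.
have mQ M : measurable [set w | Q M (hist (bits X w) M)] by exact: measurable_hist.
have small' : \forall M \near \oo,
  (P [set w | Q M (hist (bits X w) M)] <= (K * M%:R `^ (- 2))%:E)%E.
  near=> M; apply: le_trans; first apply: (freedman_union al_ge0 X_01 X_indep X_mean (t := t M)).
  - by move=> c cL h; exact: (c1 M).
  - by near: M.
  - by rewrite lee_fin; near: M.
move=> /(_ mQ small'); apply: filterS => w; apply: filterS => M nQ c cL qc.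
rewrite leNgt; apply/negP => /ltW ac; apply: nQ => /=.
by apply/hasP; exists c => //; rewrite ac qc.
Unshelve. all: by end_near. Qed.

Let expR_le_powR (c A : R) (a : nat -> R) : 0 < c -> 0 < A ->
  (\forall M \near \oo, a M <= A - M%:R `^ c) ->
  \forall M \near \oo, expR (a M) <= expR A * M%:R `^ (- 3).
Proof.
move=> c0 A0 H; near=> M.
apply: (@le_trans _ _ (expR A * expR (- (M%:R `^ c)))).
  by rewrite -expRD ler_expR; near: M.
by rewrite ler_pM2l ?expR_gt0//; near: M; exact: expR_powR_decay.
Unshelve. all: by end_near. Qed.

(** The constants are such that the exponent in Freedman's inequality is
    [- M ^ (- 1 / 4) * Ehits M / 2], of size at least [M ^ (1 / 4) / 2]. *)
Lemma ae_law_of_large_numbers : {ae P, forall w, \forall M \near \oo,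
  `|(hits (bits X w) M)%:R - Ehits al M| <= 2 * M%:R `^ (- (1 / 8)) * Ehits al M}.
Proof.
have := @ae_freedman (fun=> [:: fun=> 1]) (fun M => M%:R `^ (- (1 / 8)) / 2)
  (fun M => 2 * M%:R `^ (- (1 / 8)) * Ehits al M) (fun M => Ehits al M) (2 * expR 1).
have E1 e M : mart al (fun=> 1) (hist e M) = (hits e M)%:R - Ehits al M.
  rewrite mart_hist Ehits_ord /hits natr_sum big_add1 big_mkord -sumrB.
  by apply: eq_bigr => i _; rewrite mul1r.
have E2 e M : qvar al (fun=> 1) (hist e M) = Ehits al M.
  by rewrite qvar_hist Ehits_ord; apply: eq_bigr => i _; rewrite expr1n mul1r.
move=> H; have : {ae P, forall w, \forall M \near \oo, forall c,
    c \in [:: (fun=> 1) : seq bool -> R] ->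
    qvar al c (hist (bits X w) M) <= Ehits al M ->
    `|mart al c (hist (bits X w) M)| <= 2 * M%:R `^ (- (1 / 8)) * Ehits al M}.
  apply: H.
  - by move=> _ c; rewrite inE => /eqP -> h; rewrite normr1.
  - near=> M; rewrite divr_ge0 ?powR_ge0//= ler_pM2r ?invr_gt0//.
    have M0 : (0 < M)%N by near: M; exact: nbhs_infty_gt.
    by rewrite -[leRHS](powRr0 M%:R) powR_nat_le//; lra.
  near=> M.
  have M0 : (0 < M)%N by near: M; exact: nbhs_infty_gt.
  have -> : - (M%:R `^ (- (1 / 8)) / 2 * (2 * M%:R `^ (- (1 / 8)) * Ehits al M)) +
     2 * (M%:R `^ (- (1 / 8)) / 2) ^+ 2 * Ehits al M = - (M%:R `^ (- (1 / 8)) ^+ 2 * Ehits al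
         M) / 2.
    by field.
  rewrite /= -mulrA [leLHS]mul1r -[leRHS]mulrA ler_pM2l//.
  apply: (@le_trans _ _ (expR 1 * M%:R `^ (- 3))); last first.
    by rewrite ler_pM2l ?expR_gt0// powR_nat_le//; lra.
  near: M; apply: (@expR_le_powR (1 / 8)) => //.
  near=> M.
  have M0 : (0 < M)%N by near: M; exact: nbhs_infty_gt.
  have M2 : 2 <= M%:R `^ (1 / 8) :> R by near: M; exact: powR_near_infty.
  have -> : - (M%:R `^ (- (1 / 8)) ^+ 2 * Ehits al M) / 2 = - ((M%:R `^ (- (1 / 8)) ^+ 2 *
      Ehits al M) / 2).
    by rewrite mulNr.
  apply: (@le_trans _ _ (- M%:R `^ (1 / 8))); last by rewrite lerDr.
  rewrite lerN2 ler_pdivlMr//.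
  apply: (@le_trans _ _ (M%:R `^ (- (1 / 8)) ^+ 2 * M%:R `^ (1 - al))); last first.
    by rewrite ler_pM2l ?exprn_gt0 ?powR_nat_gt0// Ehits_ge.
  apply: (@le_trans _ _ (M%:R `^ (1 / 8) * M%:R `^ (1 / 8))); first by rewrite ler_pM2l
      ?powR_nat_gt0.
  rewrite expr2 -!powRD_nat// powR_nat_le//; have := al_lt; lra.
apply: filterS => w; apply: filterS => M /(_ (fun=> 1)).
by rewrite E1 E2 mem_head; apply.
Unshelve. all: by end_near. Qed.

(** Freedman's inequality for the predictable sequence [sigma], which turns the
    deterministic bound on the sum of the squares into the random one. *)
Lemma ae_weighted_hits_le : {ae P, forall w, \forall M \near \oo,
  \sum_(1 <= k < M.+1) sigma al k * (bits X w k)%:R <= (2 + g^-1) * M%:R `^ (2 * g)}.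
Proof.
pose c (h : seq bool) := sigma al (size h).+1.
pose V M : R := M%:R `^ (2 * g) / (2 * g).
have E1 e M : mart al c (hist e M) =
    \sum_(1 <= k < M.+1) sigma al k * (e k)%:R - \sum_(1 <= k < M.+1) sigma al k ^+ 2.
  rewrite mart_hist !big_add1 !big_mkord -sumrB.
  by apply: eq_bigr => i _; rewrite /c size_hist mulrBr expr2.
have c01 h : 0 <= c h <= 1 by rewrite ltW ?sigma_gt0//= sigma_le1.
have E2 e M : qvar al c (hist e M) <= V M.
  apply: le_trans (sum_sigma_sqr_le al_gt0 al_lt M).
  rewrite qvar_hist big_add1 big_mkord; apply: ler_sum => i _.
  rewrite /c size_hist ler_piMr ?sqr_ge0//.
  by have := c01 (hist e i); rewrite /c size_hist => /andP[].
have := @ae_freedman (fun=> [:: c]) (fun=> 1 / 2) (fun M => V M + 2 * M%:R `^ (2 * g)) V (2 *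
    expR 1).
move=> H; have {H} : {ae P, forall w, \forall M \near \oo, forall c', c' \in [:: c] ->
    qvar al c' (hist (bits X w) M) <= V M ->
    `|mart al c' (hist (bits X w) M)| <= V M + 2 * M%:R `^ (2 * g)}.
  apply: H.
  - by move=> _ c'; rewrite inE => /eqP -> h; have /andP[? ?] := c01 h; rewrite ger0_norm.
  - by apply: nearW => _; rewrite lexx andbT; lra.
  near=> M.
  have M0 : (0 < M)%N by near: M; exact: nbhs_infty_gt.
  have -> : - (1 / 2 * (V M + 2 * M%:R `^ (2 * g))) + 2 * (1 / 2) ^+ 2 * V M = - M%:R `^ (2 * g).
    by field.
  rewrite /= -mulrA [leLHS]mul1r -[leRHS]mulrA ler_pM2l//.
  apply: (@le_trans _ _ (expR 1 * M%:R `^ (- 3))); last first.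
    by rewrite ler_pM2l ?expR_gt0// powR_nat_le//; lra.
  near: M; apply: (@expR_le_powR (2 * g)) => //; first by rewrite mulr_gt0.
  by apply: nearW => M; rewrite lerDr.
apply: filterS => w; apply: filterS => M /(_ c).
rewrite E1 E2 mem_head => /(_ isT isT) /(le_trans (ler_norm _)).
rewrite lerBlDr => /le_trans; apply.
have := sum_sigma_sqr_le al_gt0 al_lt M; rewrite -/g -/(V M) => VM.
apply: (@le_trans _ _ (2 * V M + 2 * M%:R `^ (2 * g))).
  by move: (V M) VM => v; lra.
by rewrite /V invfM; move: (g^-1) (_ `^ _) => p q; lra.
Unshelve. all: by end_near. Qed.

(** The square of a centred bit is at most [e k + sigma k], and [sigma] decreases, so
    the shift by [j] may be dropped: the bound is uniform in [j] and the weights. *)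
Lemma qvar_corr_le b b' j e M : (forall n, (0 < n)%N -> `|b n| <= 1) ->
  (forall n, (0 < n)%N -> `|b' n| <= 1) -> (0 < j)%N ->
  qvar al (corr_coef al j b b') (hist e M) <=
  \sum_(1 <= k < M.+1) sigma al k * (e k)%:R + \sum_(1 <= k < M.+1) sigma al k ^+ 2.
Proof.
move=> b1 b'1 j0.
rewrite qvar_hist -(big_mkord xpredT (fun n => corr_coef al j b b' (hist e n) ^+ 2 * sigma al
    n.+1)).
have nn k : (0 < k)%N -> 0 <= sigma al k * (e k)%:R + sigma al k ^+ 2.
  by move=> k0; rewrite addr_ge0 ?sqr_ge0// mulr_ge0// ltW// sigma_gt0.
rewrite -big_split/= big_add1/=.
have [Mj|jM] := leqP M j.
  rewrite [leLHS]big_nat big1; first by apply: sumr_ge0 => k _; exact: nn.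
  move=> i /andP[_ iM]; rewrite corr_coef_hist// ifF ?expr0n ?mul0r//.
  by apply/negbTE; rewrite -ltnNge; exact: leq_trans Mj.
rewrite (big_cat_nat (n := j))//=; last exact: ltnW.
rewrite big_nat big1 ?add0r; last first.
  move=> i /andP[_ iM]; rewrite corr_coef_hist// ifF ?expr0n ?mul0r//.
  by apply/negbTE; rewrite -ltnNge.
rewrite -{1}[j]add0n big_addn [leRHS](big_cat_nat (n := M - j))//= ?leq_subr//.
rewrite -[leLHS]addr0 lerD ?sumr_ge0//; last by move=> k _; exact: nn.
apply: ler_sum => i _; rewrite corr_coef_hist// leq_addl -addSn addnK.
have s0 : 0 < sigma al i.+1 by rewrite sigma_gt0.
have s1 : sigma al i.+1 <= 1 by rewrite sigma_le1.
have sm : sigma al (i.+1 + j) <= sigma al i.+1 by rewrite sigma_mono// leq_addr.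
have sj : 0 <= sigma al (i.+1 + j) by rewrite ltW// sigma_gt0.
apply: (@le_trans _ _ (((e i.+1)%:R - sigma al i.+1) ^+ 2 * sigma al (i.+1 + j))).
  rewrite ler_wpM2r// /coef -!mulrA exprMn ler_piMr ?sqr_ge0// -real_normK ?num_real//.
  by rewrite exprn_ile1 ?normr_ge0// normrM mulr_ile1 ?normr_ge0 ?b1 ?b'1.
apply: (@le_trans _ _ (((e i.+1)%:R - sigma al i.+1) ^+ 2 * sigma al i.+1)).
  by rewrite ler_wpM2l ?sqr_ge0.
by case: (e i.+1) => /=; nra.
Qed.

(** All correlations at a given length form a family of
    about [M * exp (2 * M ^ (g / 4))] martingale transforms, each exceeding
    [M ^ (3 * g / 2)] with probability about [exp (- M ^ (g / 2))]. *)
Lemma ae_good (fam : nat -> seq (nat -> R)) (C : R) :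
  (\forall M \near \oo, (size (fam M))%:R <= C * expR (M%:R `^ (g / 4))) ->
  (forall M b, b \in fam M -> forall n, (0 < n)%N -> `|b n| <= 1) ->
  {ae P, forall w, good al fam (bits X w)}.
Proof.
move=> szfam fam1.
pose L M := [seq corr_coef al p.1 p.2.1 p.2.2 | p <- allpairs pair (iota 1 M)
  (allpairs pair (fam M) (fam M))].
pose c2 : R := 2 + g^-1 + (2 * g)^-1.
have c2_gt0 : 0 < c2 by rewrite !addr_gt0 ?invr_gt0 ?mulr_gt0.
have L1 M c : c \in L M -> forall h, `|c h| <= 1.
  move=> /mapP[[j p] /allpairsP[[j' p'] /= [jM /allpairsP[[b b'] /= [bF b'F ->]]]]].
  move=> [-> ->] -> h /=; rewrite /corr_coef.
  have j0 : (0 < j')%N by move: jM; rewrite mem_iota => /andP[].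
  case: ifP => // jh; last by rewrite normr0.
  have k0 : (0 < (size h).+1 - j')%N by rewrite subn_gt0.
  rewrite !normrM !mulr_ile1 ?normr_ge0 ?mulr_ge0//; last 2 first.
    exact: (fam1 M).
    exact: (fam1 M).
  have := @sigma_le1 _ al _ al_ge0 k0; have := @sigma_gt0 _ al _ k0.
  by case: (nth _ _ _) => /= s0 s1; rewrite ler_norml; apply/andP; split; lra.
have szL M : (size (L M))%:R = M%:R * ((size (fam M))%:R * (size (fam M))%:R) :> R.
  by rewrite /L size_map !size_allpairs size_iota !natrM.
pose K : R := 2 * (C * C) * expR (2 * c2 + 1).
have small : \forall M \near \oo, (size (L M))%:R * 2 *
    expR (- (M%:R `^ (- g) * M%:R `^ (3 / 2 * g)) +
          2 * (M%:R `^ (- g)) ^+ 2 * (c2 * M%:R `^ (2 * g))) <= K * M%:R `^ (- 2).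
  near=> M.
  have M0 : (0 < M)%N by near: M; exact: nbhs_infty_gt.
  have -> : M%:R `^ (- g) * M%:R `^ (3 / 2 * g) = M%:R `^ (g / 2) :> R.
    by rewrite -powRD_nat//; congr (_ `^ _); field.
  have -> : 2 * (M%:R `^ (- g)) ^+ 2 * (c2 * M%:R `^ (2 * g)) = 2 * c2 :> R.
    rewrite -mulrA [_ * (c2 * _)]mulrCA expr2 -!powRD_nat//.
    by rewrite (_ : _ + _ = 0) ?powRr0 ?mulr1//; ring.
  have S : (size (fam M))%:R <= C * expR (M%:R `^ (g / 4)) by near: M.
  rewrite szL.
  set q := M%:R `^ (g / 4).
  have -> : M%:R `^ (g / 2) = q ^+ 2 by rewrite expr2 -powRD_nat//; congr (_ `^ _); field.
  have C0 : 0 <= C by rewrite -(pmulr_lge0 _ (expR_gt0 q)) (le_trans _ S).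
  apply: (@le_trans _ _ (M%:R * ((C * expR q) * (C * expR q)) * 2 * expR (- q ^+ 2 + 2 * c2))).
    by rewrite ler_wpM2r ?expR_ge0// ler_wpM2r// ler_wpM2l// ler_pM.
  have -> : M%:R * ((C * expR q) * (C * expR q)) * 2 * expR (- q ^+ 2 + 2 * c2) =
      2 * (C * C) * (M%:R * expR (2 * c2 + (2 * q - q ^+ 2))).
    rewrite (_ : expR (2 * c2 + _) = expR q * expR q * expR (- q ^+ 2 + 2 * c2)); first by ring.
    by rewrite -!expRD; congr expR; ring.
  rewrite /K -[leRHS]mulrA ler_wpM2l ?mulr_ge0//.
  have -> : M%:R `^ (- 2) = M%:R * M%:R `^ (- 3) :> R.
    by rewrite -[X in _ = X * _]powRr1// -powRD_nat//; congr (_ `^ _); ring.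
  rewrite mulrCA ler_wpM2l//.
  rewrite /q; near: M; apply: (@expR_le_powR (g / 4) (2 * c2 + 1) (fun M =>
    2 * c2 + (2 * M%:R `^ (g / 4) - M%:R `^ (g / 4) ^+ 2))) => //; first by rewrite divr_gt0.
    by rewrite addr_gt0// mulr_gt0.
  near=> M.
  have q3 : 3 <= M%:R `^ (g / 4) by near: M; apply: powR_near_infty; rewrite divr_gt0.
  by move: (_ `^ _) q3 => r r3; nra.
have t2 : \forall M \near \oo, 0 <= (M%:R : R) `^ (- g) <= 1 / 2.
  near=> M; rewrite powR_ge0/=.
  by near: M; apply: powR_near_infty0 => //; lra.
have := ae_freedman L1 t2 small.
have := ae_law_of_large_numbers; have := ae_weighted_hits_le.
apply: filterS3 => w g2 g1 H; split => //.
near=> M; move=> b b' bF b'F j j0.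
have [Mj|jM] := leqP M j.
  by rewrite (_ : M - j = 0)%N; [rewrite big_geq// normr0 powR_ge0|lia].
rewrite -mart_corr//.
have H' : forall c, c \in L M -> qvar al c (hist (bits X w) M) <= c2 * M%:R `^ (2 * g) ->
    `|mart al c (hist (bits X w) M)| <= M%:R `^ (3 / 2 * g) by near: M.
apply: H'.
  apply/mapP; exists (j, (b, b')) => //.
  by apply/allpairs_f; [rewrite mem_iota; lia|exact/allpairs_f].
apply: le_trans (qvar_corr_le _ _ _ _ j0) _; [exact: fam1 bF|exact: fam1 b'F|].
rewrite /c2 [leRHS]mulrDl lerD//; first by near: M.
by rewrite mulrC; exact: sum_sigma_sqr_le.
Unshelve. all: by end_near. Qed.

End AlmostSurelyGood.

(** * Sums along a bit sequence *)

Section Reindexing.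
Context {R : realType}.
Variables (x : nat -> R) (e : nat -> bool).
Hypothesis xe : forall k, (0 < k)%N -> x k = (e k)%:R.

Lemma sum_hits m : \sum_(1 <= k < m.+1) x k = (hits e m)%:R.
Proof.
by rewrite /hits natr_sum; apply: eq_big_nat => k /andP[k0 _]; exact: xe.
Qed.

Lemma hits_mono m n : (m <= n)%N -> (hits e m <= hits e n)%N.
Proof.
move=> /subnK <-; elim: (n - m)%N => // k IH.
by rewrite addSn hitsS (leq_trans IH)// leq_addr.
Qed.

Lemma counting_function_hit m : (0 < m)%N -> e m -> counting_function x (hits e m) = m.
Proof.
case: m => // m _ em.
have lt m' : (m' < m.+1)%N -> (hits e m' < hits e m.+1)%N.
  by rewrite ltnS hitsS em addn1 ltnS; exact: hits_mono.
rewrite /counting_function; apply: xget_unique.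
  split; first by rewrite sum_hits.
  by move=> m' /lt; rewrite sum_hits => H /eqP; rewrite eqr_nat => /eqP H'; rewrite H' ltnn in H.
move=> y [+ miny]; rewrite sum_hits => /eqP; rewrite eqr_nat => /eqP hy.
have [/lt|/miny|//] := ltngtP y m.+1; first by rewrite hy ltnn.
by rewrite sum_hits.
Qed.

(** At a hit [k] the number of hits is [n] exactly when [k] is the time of the
    [n]-th hit. *)
Lemma sum_counting (phi : nat -> nat -> R) m :
  \sum_(1 <= k < m.+1) (e k)%:R * phi (hits e k) k =
  \sum_(1 <= n < (hits e m).+1) phi n (counting_function x n).
Proof.
elim: m => [|m IH]; first by rewrite hits0 !big_geq.
rewrite big_nat_recr//= IH; have [em|em] := boolP (e m.+1).
  have E : hits e m.+1 = (hits e m).+1 by rewrite hitsS em addn1.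
  rewrite mul1r E [in RHS]big_nat_recr//=; congr (_ + phi _ _).
  by rewrite -E counting_function_hit.
by rewrite mul0r addr0 hitsS (negbTE em) addn0.
Qed.

End Reindexing.

Section Correlations.
Context {R : realType}.

Lemma sum_shift (G : nat -> R) a m N : (forall z, (z <= a)%N -> G z = 0) ->
  (forall z, (a + m < z)%N -> G z = 0) -> (a + m < N)%N ->
  \sum_(z < N) G z = \sum_(1 <= k < m.+1) G (k + a)%N.
Proof.
move=> G0 G1 aN; rewrite -(big_mkord xpredT G).
rewrite (big_cat_nat (n := a.+1))//=; last exact: leq_ltn_trans (leq_addr _ _) aN.
rewrite big_nat big1 ?add0r; last by move=> i /andP[_ ia]; rewrite G0.
rewrite (big_cat_nat (n := (a + m).+1))//=; last by rewrite ltnS leq_addr.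
rewrite [X in _ + X]big_nat [X in _ + X]big1 ?addr0; last by move=> i /andP[ia _]; rewrite G1.
by rewrite -[a.+1]add1n big_addn (_ : (a + m).+1 - a = m.+1)%N//; lia.
Qed.

(** The dual of the operator [F |-> (x |-> \sum_k c (iota x) k * F (x + k))] is
    bounded by Schur's test: the entries of the composition of the operator
    with its dual are the correlations of the coefficients.  The choice [iota]
    of the coefficients at each point is arbitrary. *)
Lemma l2_bound_choice (I : Type) (c : I -> nat -> R) (M : nat) (r0 r D : R)
    (L : nat) (iota : nat -> I) (F : nat -> R) :
  (forall i, \sum_(1 <= k < M.+1) c i k ^+ 2 <= r0) ->
  (forall i i' j, (0 < j)%N -> `|\sum_(1 <= k < (M - j).+1) c i k * c i' (k + j)%N| <= r) ->
  0 < D -> r0 + L%:R * r <= D ->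
  \sum_(x < L) (\sum_(1 <= k < M.+1) c (iota x) k * F (k + x)%N) ^+ 2 <=
  D * \sum_(z < L + M) F z ^+ 2.
Proof.
move=> c0 c1 D0 rD.
have r_ge0 : 0 <= r.
  case: (pselect (exists i : I, True)) => [[i _]|nI]; first exact: le_trans (c1 i i 1%N isT).
  by exfalso; apply: nI; exists (iota 0%N).
(* Extended by zero, the coefficients can be summed over all points of the orbit. *)
pose ct i k := if (0 < k <= M)%N then c i k else 0.
have ct0 i : ct i 0%N = 0 by [].
pose U (x : nat) := \sum_(1 <= k < M.+1) c (iota x) k * F (k + x)%N.
have ctE (f : nat -> R) i x : (x < L)%N ->
    \sum_(1 <= k < M.+1) c i k * f (k + x)%N = \sum_(z < L + M) ct i (z - x)%N * f z.
  move=> xL; rewrite (@sum_shift (fun z => ct i (z - x)%N * f z) x M).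
  - rewrite big_nat [RHS]big_nat; apply: eq_bigr => k kM.
    by rewrite addnK /ct -ltnS kM.
  - by move=> z /eqP ->; rewrite ct0 mul0r.
  - by move=> z xz; rewrite /ct ifF ?mul0r//; lia.
  - by rewrite ltn_add2r.
pose Q := \sum_(x < L) U x ^+ 2.
pose V (z : nat) := \sum_(x < L) U x * ct (iota x) (z - x)%N.
have QE : Q = \sum_(z < L + M) F z * V z.
  rewrite /Q /V; under [RHS]eq_bigr do rewrite mulr_sumr.
  rewrite exchange_big/=; apply: eq_bigr => x _.
  rewrite expr2 {2}/U ctE// mulr_sumr; apply: eq_bigr => z _; ring.
pose cor (x y : nat) := \sum_(z < L + M) ct (iota x) (z - x)%N * ct (iota y) (z - y)%N.
have corC x y : cor x y = cor y x by apply: eq_bigr => z _; rewrite mulrC.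
have cor0 x : (x < L)%N -> cor x x <= r0.
  move=> xL; rewrite /cor -(ctE (fun z => ct (iota x) (z - x)%N))//; apply: le_trans (c0 (iota
      x)).
  rewrite big_nat [leRHS]big_nat; apply: ler_sum => k kM.
  by rewrite addnK /ct -ltnS kM expr2.
have cor1 x y : (x < y < L)%N -> `|cor x y| <= r.
  move=> /andP[xy yL]; pose j := (y - x)%N.
  have := c1 (iota y) (iota x) j; rewrite subn_gt0 => /(_ xy); congr (`|_| <= _).
  rewrite corC /cor.
  have [Mj|jM] := leqP M j.
    rewrite (_ : M - j = 0)%N; last by lia.
    rewrite [LHS]big_geq// big1// => z _; rewrite /ct.
    by case: ifP => zy; rewrite ?mul0r// ifF ?mulr0//; move: Mj; rewrite /j; lia.
  rewrite (@sum_shift (fun z => ct (iota y) (z - y)%N * ct (iota x) (z - x)%N) y (M - j)).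
  - rewrite big_nat [RHS]big_nat; apply: eq_bigr => k kM.
    rewrite addnK /ct ifT; last by lia.
    rewrite ifT; last by move: kM; rewrite /j; lia.
    by congr (_ * c _ _); rewrite /j; lia.
  - by move=> z /eqP ->; rewrite ct0 mul0r.
  - move=> z xz; rewrite [X in _ * X]/ct ifF ?mulr0//; move: xz jM; rewrite /j; lia.
  - by lia.
have VE : \sum_(z < L + M) V z ^+ 2 = \sum_(x < L) \sum_(y < L) U x * U y * cor x y.
  rewrite /V /cor; under eq_bigr do rewrite expr2 mulr_suml.
  rewrite exchange_big/=; apply: eq_bigr => x _.
  under eq_bigr do rewrite mulr_sumr.
  rewrite exchange_big/=; apply: eq_bigr => y _.
  by rewrite mulr_sumr; apply: eq_bigr => z _; ring.
have VQ : \sum_(z < L + M) V z ^+ 2 <= D * Q.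
  rewrite VE.
  pose b (x y : nat) : R := if x == y then r0 else r.
  have b0 (x y : nat) : (x < L)%N -> (y < L)%N -> U x * U y * cor x y <= (U x ^+ 2 + U y ^+ 2)
      / 2 * b x y.
    move=> xL yL; rewrite /b; case: (ltngtP x y) => xy.
    - have H := cor1 x y; rewrite xy yL in H; have := H isT => {H}.
      rewrite ler_norml => /andP[H1 H2].
      rewrite -subr_ge0 (_ : _ - _ = ((U x - U y) ^+ 2 * (r + cor x y) +
        (U x + U y) ^+ 2 * (r - cor x y)) / 4); last by field.
      by rewrite divr_ge0// addr_ge0// mulr_ge0 ?sqr_ge0//; lra.
    - have H := cor1 y x; rewrite xy xL in H; have := H isT => {H}.
      rewrite corC ler_norml => /andP[H1 H2].
      rewrite -subr_ge0 (_ : _ - _ = ((U x - U y) ^+ 2 * (r + cor x y) +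
        (U x + U y) ^+ 2 * (r - cor x y)) / 4); last by field.
      by rewrite divr_ge0// addr_ge0// mulr_ge0 ?sqr_ge0//; lra.
    - rewrite -xy -expr2 (_ : (_ + _) / 2 = U x ^+ 2); last by field.
      by rewrite ler_wpM2l ?sqr_ge0// cor0.
  have sb x : (x < L)%N -> \sum_(y < L) b x y <= D.
    move=> xL; apply: le_trans rD; rewrite (bigD1 (Ordinal xL))//= {1}/b eqxx lerD2l.
    apply: (@le_trans _ _ (\sum_(y < L | y != Ordinal xL) r)).
      apply: ler_sum => y yx; rewrite /b ifF//; apply/negbTE; apply: contra yx => /eqP xy.
      by apply/eqP/val_inj.
    apply: (@le_trans _ _ (\sum_(y < L) r)); last by rewrite sumr_const card_ord mulr_natl.
    by rewrite [leRHS](bigD1 (Ordinal xL))//= lerDr.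
  apply: (@le_trans _ _ (\sum_(x < L) \sum_(y < L) (U x ^+ 2 + U y ^+ 2) / 2 * b x y)).
    by apply: ler_sum => x _; apply: ler_sum => y _; exact: b0.
  have -> : \sum_(x < L) \sum_(y < L) (U x ^+ 2 + U y ^+ 2) / 2 * b x y =
     \sum_(x < L) U x ^+ 2 * \sum_(y < L) b x y.
    transitivity ((\sum_(x < L) \sum_(y < L) U x ^+ 2 * b x y) / 2 +
                  (\sum_(x < L) \sum_(y < L) U y ^+ 2 * b x y) / 2).
      rewrite !mulr_suml -big_split/=; apply: eq_bigr => x _.
      rewrite !mulr_suml -big_split/=; apply: eq_bigr => y _; ring.
    rewrite [in X in _ + X]exchange_big/=.
    have -> : \sum_(y < L) \sum_(x < L) U y ^+ 2 * b x y = \sum_(x < L) \sum_(y < L) U x ^+ 2 *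
        b x y.
      by apply: eq_bigr => y _; apply: eq_bigr => x _; rewrite /b eq_sym.
    by rewrite -splitr; apply: eq_bigr => x _; rewrite mulr_sumr.
  rewrite /Q mulr_sumr; apply: ler_sum => x _.
  by rewrite mulrC ler_wpM2r ?sqr_ge0// sb.
(* Cauchy-Schwarz in the form 2 F V <= D F^2 + V^2 / D. *)
have H : Q <= (D * \sum_(z < L + M) F z ^+ 2 + Q) / 2.
  apply: (@le_trans _ _ ((D * \sum_(z < L + M) F z ^+ 2 + D^-1 * \sum_(z < L + M) V z ^+ 2) / 2)).
    rewrite {1}QE !mulr_sumr -big_split mulr_suml /=; apply: ler_sum => z _.
    rewrite -subr_ge0 (_ : _ - _ = (D * F z - V z) ^+ 2 / (2 * D)); last by field; rewrite gt_eqF.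
    by rewrite divr_ge0 ?sqr_ge0// mulr_ge0// ltW.
  by rewrite ler_pM2r ?invr_gt0// lerD2l mulrC ler_pdivrMr// mulrC.
have half (p q : R) : q <= (p + q) / 2 -> q <= p by lra.
exact: half H.
Qed.

End Correlations.

Section Summation.
Context {R : realType}.

(** Cut the interval greedily into pieces over which the sum is nonnegative;
    less than one piece is left over. *)
Lemma greedy_sum_ge (v : nat -> R) (K : nat) (c : R) : 0 <= c ->
  (forall i, - c <= v i) ->
  (forall i, exists2 n, (0 < n <= K)%N & 0 <= \sum_(i <= k < i + n) v k) ->
  forall L i, - (K%:R * c) <= \sum_(i <= k < i + L) v k.
Proof.
move=> c0 vc vn; elim/ltn_ind => L IH i.
have [n /andP[n0 nK] sn] := vn i.
have [nL|Ln] := leqP n L.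
  rewrite (big_cat_nat (n := i + n))//= ?leq_addr ?leq_add2l//.
  rewrite -(subnKC nL) addnA -[leLHS]add0r lerD// IH//; lia.
apply: (@le_trans _ _ (\sum_(i <= k < i + L) (- c))).
  rewrite sumr_const_nat addKn mulNrn lerN2 -[leLHS]mulr_natl ler_wpM2r// ler_nat.
  exact: leq_trans (ltnW Ln) nK.
by apply: ler_sum => k _; exact: vc.
Qed.

(** Summation by parts: a linear bound on partial sums passes to sums with a
    decreasing weight. *)
Lemma weighted_sum_le (al lam : R) (F : nat -> R) m : 0 <= al ->
  (forall n, \sum_(1 <= k < n.+1) F k <= lam * n%:R) ->
  \sum_(1 <= k < m.+1) sigma al k * F k <= lam * Ehits al m.
Proof.
move=> al0 HF.
have H : \sum_(1 <= k < m.+1) sigma al k * F k - sigma al m * \sum_(1 <= k < m.+1) F k <=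
    lam * (Ehits al m - m%:R * sigma al m).
  elim: m => [|m IH]; first by rewrite /Ehits !big_geq// !(mulr0, mul0r) subrr mulr0.
  rewrite EhitsS !(big_nat_recr m.+1)//=.
  have : (sigma al m - sigma al m.+1) * \sum_(1 <= k < m.+1) F k <=
         (sigma al m - sigma al m.+1) * (lam * m%:R).
    case: m {IH} => [|m]; first by rewrite big_geq// !mulr0.
    by rewrite ler_wpM2l// subr_ge0 sigma_mono//=.
  by rewrite -natr1; move: IH; lra.
have : sigma al m * \sum_(1 <= k < m.+1) F k <= sigma al m * (lam * m%:R).
  by rewrite ler_wpM2l ?HF// powR_ge0.
by move: H; lra.
Qed.

(** Summation by parts: apart from the decrease of [sigma al], the weight changes
    only at the hits. *)
Lemma coboundary_sum_le (al : R) (e : nat -> bool) (b u : nat -> R) (C : R) M : 0 <= al ->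
  (forall n, (0 < n)%N -> `|b n| <= 1) -> (forall k, `|u k| <= C) ->
  `|\sum_(1 <= k < M.+1) sigma al k * b (hits e k.-1).+1 * (u k - u k.+1)| <=
  C * (2 + 2 * \sum_(1 <= k < M.+1) sigma al k * (e k)%:R).
Proof.
move=> al0 b1 uC.
have C0 : 0 <= C := le_trans (normr_ge0 _) (uC 0%N).
have se0 n : 0 <= \sum_(1 <= k < n.+1) sigma al k * (e k)%:R.
  by apply: sumr_ge0 => k _; rewrite mulr_ge0// powR_ge0.
case: M => [|m]; first by rewrite big_geq// normr0 mulr_ge0// addr_ge0// mulr_ge0.
pose th k := sigma al k * b (hits e k.-1).+1.
have th1 k : (0 < k)%N -> `|th k| <= sigma al k.
  move=> k0; rewrite normrM (ger0_norm (powR_ge0 _ _)) ler_piMr ?powR_ge0//.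
  exact: b1.
have H : `|\sum_(1 <= k < m.+2) th k * (u k - u k.+1) + th m.+1 * u m.+2| <=
    C * (2 - sigma al m.+1 + 2 * \sum_(1 <= k < m.+1) sigma al k * (e k)%:R).
  elim: m => [|m IH].
    rewrite big_nat1 big_geq// mulr0 addr0 mulrBr subrK normrM.
    apply: (le_trans (ler_pM (normr_ge0 _) (normr_ge0 _) (th1 1%N isT) (uC 1%N))).
    by rewrite /sigma powR1; lra.
  rewrite big_nat_recr//=.
  have -> : \sum_(1 <= k < m.+2) th k * (u k - u k.+1) + th m.+2 * (u m.+2 - u m.+3) +
      th m.+2 * u m.+3 = (\sum_(1 <= k < m.+2) th k * (u k - u k.+1) + th m.+1 * u m.+2) +
      (th m.+2 - th m.+1) * u m.+2 by ring.
  rewrite (le_trans (ler_normD _ _))// [X in _ <= C * (_ + 2 * X)]big_nat_recr//=.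
  have D : `|th m.+2 - th m.+1| <= sigma al m.+1 - sigma al m.+2 + 2 * (sigma al m.+1 * (e
      m.+1)%:R).
    have s12 : sigma al m.+2 <= sigma al m.+1 by rewrite sigma_mono//=.
    have s2 : 0 <= sigma al m.+2 by exact: powR_ge0.
    rewrite /th /= hitsS; case: (e m.+1); rewrite ?addn1 ?addn0 /=.
      have s1 : 0 <= sigma al m.+1 by exact: powR_ge0.
      rewrite (le_trans (ler_normB _ _))// !normrM (ger0_norm s1) (ger0_norm s2).
      have := ler_wpM2l s2 (b1 (hits e m).+2 isT); have := ler_wpM2l s1 (b1 (hits e m).+1 isT).
      lra.
    have s12' : 0 <= sigma al m.+1 - sigma al m.+2 by rewrite subr_ge0.
    rewrite -mulrBl normrM distrC (ger0_norm s12').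
    have := ler_wpM2l s12' (b1 (hits e m).+1 isT); lra.
  have := lerD IH (ler_pM (normr_ge0 _) (normr_ge0 _) D (uC m.+2)).
  rewrite -normrM => /le_trans; apply.
  move: (sigma al m.+1) (sigma al m.+2) (\sum_(_ <= _ < _) _) ((e m.+1)%:R : R) => s s' t q; lra.
have := lerD H (ler_pM (normr_ge0 _) (normr_ge0 _) (th1 m.+1 isT) (uC m.+2)).
rewrite -normrM => HH.
have := ler_normB (\sum_(1 <= k < m.+2) th k * (u k - u k.+1) + th m.+1 * u m.+2) (th m.+1 * u
    m.+2).
rewrite addrK => /le_trans; apply; apply: (le_trans HH).
rewrite [X in _ <= C * (_ + 2 * X)]big_nat_recr//=.
have : 0 <= C * (sigma al m.+1 * (e m.+1)%:R) by rewrite !mulr_ge0// powR_ge0.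
move: (sigma al m.+1) (\sum_(_ <= _ < _) _) ((e m.+1)%:R : R) => s t q; lra.
Qed.

End Summation.

(** * Upper limits, real integrals and the maximal ergodic theorem *)

Section RealLimsup.
Context {R : realType}.
Implicit Types (u : nat -> R).

Lemma bounded_seq_fun u C : (forall n, `|u n| <= C) -> bounded_fun u.
Proof.
move=> uC; exists C; split; first exact: num_real.
by move=> x Cx n _; apply: le_trans (uC n) _; exact: ltW.
Qed.

Lemma bounded_sups_le u C N k : (forall n, `|u n| <= C) -> (N <= k)%N -> u k <= sups u N.
Proof.
move=> uC Nk; apply: ub_le_sup; last by exists k.
by exists C => _ [n _ <-]; rewrite (le_trans (ler_norm _)).
Qed.

Lemma limn_sup_le_sups u C N : (forall n, `|u n| <= C) -> limn_sup u <= sups u N.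
Proof.
move=> uC; rewrite limn_supE; last exact: bounded_seq_fun uC.
apply: ge_inf; last by exists N.
exists (- C) => _ [n _ <-]; rewrite (le_trans _ (bounded_sups_le uC (leqnn n)))//.
by have := uC n; rewrite ler_norml => /andP[].
Qed.

Lemma limn_sup_frequently u C eps N : (forall n, `|u n| <= C) -> 0 < eps ->
  exists2 n, (N <= n)%N & limn_sup u - eps <= u n.
Proof.
move=> uC eps0.
have [|_ [n /= Nn <-] h] := @sup_adherent _ (sdrop u N) _ eps0.
  split; first by exists (u N); exists N => /=.
  by exists C => _ [n _ <-]; exact: le_trans (ler_norm _) (uC n).
exists n => //; rewrite ltW// (le_lt_trans _ h)// lerD2r.
exact: limn_sup_le_sups uC.
Qed.

Lemma limn_sup_eventually u C eps : (forall n, `|u n| <= C) -> 0 < eps ->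
  \forall n \near \oo, u n <= limn_sup u + eps.
Proof.
move=> uC eps0.
have [|_ [N _ <-] h] := @inf_adherent _ (range (sups u)) _ eps0.
  split; first by exists (sups u 0%N); exists 0%N.
  exists (- C) => _ [n _ <-]; rewrite (le_trans _ (bounded_sups_le uC (leqnn n)))//.
  by have := uC n; rewrite ler_norml => /andP[].
exists N => // n /= Nn; rewrite (le_trans (bounded_sups_le uC Nn))//.
by rewrite limn_supE; [exact: ltW|exact: bounded_seq_fun uC].
Qed.

Lemma limn_sup_bound u C : (forall n, `|u n| <= C) -> `|limn_sup u| <= C.
Proof.
move=> uC; rewrite ler_norml; apply/andP; split; apply/ler_addgt0Pr => eps eps0.
  have [N _ H] := limn_sup_eventually uC eps0.
  by have := uC N; rewrite ler_norml => /andP[/le_trans + _]; apply; apply: H => /=.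
have [n _] := limn_sup_frequently 0 uC eps0.
by have := ler_norm (u n); have := uC n; lra.
Qed.

Lemma limn_sup_eq u v C : (forall n, `|u n| <= C) -> (forall n, `|v n| <= C) ->
  (forall eps, 0 < eps -> \forall n \near \oo, `|u n - v n| <= eps) ->
  limn_sup u = limn_sup v.
Proof.
have H u1 u2 : (forall n, `|u1 n| <= C) -> (forall n, `|u2 n| <= C) ->
    (forall eps, 0 < eps -> \forall n \near \oo, `|u1 n - u2 n| <= eps) ->
    limn_sup u1 <= limn_sup u2.
  move=> u1C u2C d; apply/ler_addgt0Pr => eps eps0.
  have e3 : 0 < eps / 3 by rewrite divr_gt0.
  have [N _ HN] := d _ e3; have [N' _ HN'] := limn_sup_eventually u2C e3.
  have [n] := limn_sup_frequently (maxn N N') u1C e3; rewrite geq_max => /andP[Nn N'n].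
  have := HN n Nn; have := HN' n N'n => /=; rewrite ler_norml => ? /andP[_ ?] ?.
  by lra.
move=> uC vC d; apply/eqP; rewrite eq_le !H// => eps /d.
by apply: filterS => n; rewrite distrC.
Qed.

End RealLimsup.

Section RealIntegral.
Context {R : realType} {d : measure_display} {Y : measurableType d}.
Context (mu : probability Y R).
Implicit Types (f g : Y -> R).

(** [mean] is meaningful under [intg] only, hence the integrability assumptions
    in its calculus. *)
Definition intg f := mu.-integrable setT (EFin \o f).
Definition mean f : R := \int[mu]_y f y.

Lemma intg_measurable f : intg f -> measurable_fun setT f.
Proof. by move=> /(measurable_int mu) /measurable_EFinP. Qed.

Lemma intg_bounded f C : measurable_fun setT f -> (forall y, `|f y| <= C) -> intg f.
Proof.
move=> mf fC; apply: measurable_bounded_integrable => //.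
  exact: fin_num_fun_lty.
exists C; split; first exact: num_real.
by move=> x Cx y _; apply: le_trans (fC y) _; exact: ltW.
Qed.

Lemma intg_cst (c : R) : intg (fun=> c).
Proof. by apply: (@intg_bounded _ `|c|) => //; exact: measurable_cst. Qed.

Lemma intgD f g : intg f -> intg g -> intg (fun y => f y + g y).
Proof. by move=> intf intg; exact: (integrableD measurableT intf intg). Qed.

Lemma intgZ (c : R) f : intg f -> intg (fun y => c * f y).
Proof. by move=> intf; exact: (integrableZl measurableT c intf). Qed.

Lemma intgB f g : intg f -> intg g -> intg (fun y => f y - g y).
Proof. by move=> intf intg; exact: (integrableB measurableT intf intg). Qed.

Lemma intg_norm f : intg f -> intg (fun y => `|f y|).
Proof. exact: integrable_norm. Qed.

Lemma intg_sum (I : Type) (s : seq I) (F : I -> Y -> R) :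
  (forall i, intg (F i)) -> intg (fun y => \sum_(i <- s) F i y).
Proof.
move=> iF; elim: s => [|i s IH].
  by apply: eq_integrable (intg_cst 0) => // y _ /=; rewrite big_nil.
by apply: eq_integrable (intgD (iF i) IH) => // y _ /=; rewrite big_cons.
Qed.

Lemma intg_le f g : measurable_fun setT f -> (forall y, `|f y| <= g y) -> intg g -> intg f.
Proof.
move=> mf fg; apply: le_integrable => //; first exact/measurable_EFinP.
by move=> y _ /=; rewrite lee_fin (le_trans (fg y))// ler_norm.
Qed.

Lemma meanD f g : intg f -> intg g -> mean (fun y => f y + g y) = mean f + mean g.
Proof. exact: RintegralD. Qed.

Lemma meanB f g : intg f -> intg g -> mean (fun y => f y - g y) = mean f - mean g.
Proof. exact: RintegralB. Qed.

Lemma meanZ c f : intg f -> mean (fun y => c * f y) = c * mean f.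
Proof. exact: RintegralZl. Qed.

Lemma mean_cst c : mean (fun=> c) = c.
Proof.
rewrite /mean Rintegral_cst// -[RHS]mulr1; congr (_ * _); rewrite -[RHS]/(fine 1%E); congr fine.
exact: probability_setT.
Qed.

Lemma mean_sum (I : Type) (s : seq I) (F : I -> Y -> R) :
  (forall i, intg (F i)) -> mean (fun y => \sum_(i <- s) F i y) = \sum_(i <- s) mean (F i).
Proof.
move=> iF; elim: s => [|i s IH].
  rewrite big_nil -[RHS](mean_cst 0); apply: eq_Rintegral => y _.
  by rewrite big_nil.
rewrite big_cons -IH -meanD//; last exact: intg_sum.
by apply: eq_Rintegral => y _; rewrite big_cons.
Qed.

Lemma mean_le f g : intg f -> intg g -> (forall y, f y <= g y) -> mean f <= mean g.
Proof. by move=> intf intg fg; apply: le_Rintegral => // y _; exact: fg. Qed.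

Lemma mean_ge0 f : (forall y, 0 <= f y) -> 0 <= mean f.
Proof. by move=> f0; apply: Rintegral_ge0 => y _; exact: f0. Qed.

Lemma mean_eq f g : f =1 g -> mean f = mean g.
Proof. by move=> fg; apply: eq_Rintegral => y _. Qed.

Lemma meanE f : intg f -> (\int[mu]_y (f y)%:E)%E = (mean f)%:E.
Proof. by move=> intf; rewrite /mean /Rintegral fineK//; exact: integrable_fin_num. Qed.

Lemma intg_indic (A : set Y) : measurable A -> intg \1_A.
Proof.
move=> mA; apply: (@intg_bounded _ 1) => //.
by move=> y; rewrite indicE; case: (y \in A); rewrite ?normr1 ?normr0.
Qed.

Lemma mean_indic (A : set Y) : measurable A -> (mean \1_A)%:E = mu A.
Proof.
by move=> mA; rewrite -meanE; [rewrite integral_indic// setIT|exact: intg_indic].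
Qed.

Lemma measurable_gt_cst f c : measurable_fun setT f -> measurable [set y | c < f y].
Proof.
move=> mf; rewrite (_ : [set _ | _] = f @^-1` `]c, +oo[).
  by rewrite -[X in measurable X]setTI; exact: mf.
by apply/seteqP; split => y /=; rewrite in_itv/= andbT.
Qed.

(** The series of the functions has finite integral, so it converges almost
    everywhere. *)
Lemma ae_cvg0_of_summable_mean (g : nat -> Y -> R) (C : R) :
  (forall j, intg (g j)) -> (forall j y, 0 <= g j y) ->
  (forall J, \sum_(j < J) mean (g j) <= C) ->
  {ae mu, forall y, forall eps, 0 < eps -> \forall j \near \oo, g j y <= eps}.
Proof.
move=> ig g0 gC.
pose S y := (\sum_(j <oo) (g j y)%:E)%E.
have mg j : measurable_fun setT (EFin \o g j) by exact: measurable_int (ig j).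
have S0 y : (0 <= S y)%E by apply: nneseries_ge0 => j _ _; rewrite lee_fin.
have SE : (\int[mu]_y S y)%E = (\sum_(j <oo) \int[mu]_y (g j y)%:E)%E.
  by rewrite integral_nneseries// => j y _; rewrite lee_fin.
have iS : mu.-integrable setT S.
  apply/integrableP; split.
    apply: (@ge0_emeasurable_sum _ _ _ _ (fun j y => (g j y)%:E) xpredT) => //.
      by move=> j y _ _; rewrite lee_fin.
    by move=> j _; exact: mg.
  have -> : (\int[mu]_y `|S y|)%E = (\int[mu]_y S y)%E.
    by apply: eq_integral => y _; rewrite gee0_abs.
  rewrite SE (@le_lt_trans _ _ C%:E)//; last by rewrite ltry.
  apply: lime_le; first by apply: is_cvg_nneseries => j _ _; apply: integral_ge0 => y _;
      rewrite lee_fin.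
  apply: nearW => J; rewrite big_mkord.
  by under eq_bigr do rewrite meanE//; rewrite sumEFin lee_fin.
have := integrable_ae measurableT iS; apply: filterS => y /(_ I) fS eps eps0.
have : cvgn (series (fun j => g j y)).
  apply: nondecreasing_is_cvgn.
    by apply/nondecreasing_seqP => n; rewrite /series/= big_nat_recr//= lerDl.
  exists (fine (S y)) => _ [n _ <-].
  rewrite -lee_fin fineK// /series /= -sumEFin.
  by apply: nneseries_lim_ge => j _ _; rewrite lee_fin.
move=> /cvg_series_cvg_0 /cvgrPdist_le /(_ _ eps0).
by apply: filterS => j; rewrite sub0r normrN ger0_norm.
Qed.

End RealIntegral.

Section MeasurePreserving.
Context {R : realType} {d : measure_display} {Y : measurableType d}.
Context (mu : probability Y R) (T : Y -> Y).
Hypothesis mpT : measure_preserving mu T.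
Implicit Types (f g : Y -> R).

Lemma measurable_iter n : measurable_fun setT (iter n T).
Proof.
elim: n => [|n IH]; first exact: measurable_id.
by rewrite (_ : iter n.+1 T = T \o iter n T)//; apply: measurableT_comp => //; have [] := mpT.
Qed.

Lemma pushforward_iter n A : measurable A -> mu (iter n T @^-1` A) = mu A.
Proof.
have [mT TA] := mpT; elim: n A => [|n IH] A mA //.
have mTA : measurable (T @^-1` A) by rewrite -[X in measurable X]setTI; exact: mT.
by rewrite -(TA _ mA) -(IH _ mTA).
Qed.

Lemma measurable_comp_iter f n : measurable_fun setT f -> measurable_fun setT (fun y => f (iter
    n T y)).
Proof. by move=> mf; exact: (measurableT_comp mf (measurable_iter n)). Qed.

Lemma intg_iter_mean f n : intg mu f ->
  intg mu (fun y => f (iter n T y)) /\ mean mu (fun y => f (iter n T y)) = mean mu f.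
Proof.
move=> intf.
have mf : measurable_fun setT (EFin \o f) := measurable_int mu intf.
have eqm (h : Y -> \bar R) : (\int[pushforward mu (iter n T)]_y h y)%E = (\int[mu]_y h y)%E.
  apply: eq_measure_integral; first exact: measurable_iter.
  by move=> mn A mA _; exact: pushforward_iter.
have i : intg mu (fun y => f (iter n T y)).
  apply/integrableP; split.
    by apply/measurable_EFinP; apply: measurable_comp_iter; exact/measurable_EFinP.
  have /integrableP[_] := intf; rewrite -eqm ge0_integral_pushforward//.
    exact: measurable_iter.
  exact: measurableT_comp.
split => //; rewrite /mean /Rintegral -[in RHS]eqm integral_pushforward//.
exact: measurable_iter.
Qed.

Lemma intg_iter f n : intg mu f -> intg mu (fun y => f (iter n T y)).
Proof. by move=> /(intg_iter_mean n) []. Qed.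

Lemma mean_iter f n : intg mu f -> mean mu (fun y => f (iter n T y)) = mean mu f.
Proof. by move=> /(intg_iter_mean n) []. Qed.

(** The orbit of every point is cut greedily into pieces with nonnegative sums. *)
Lemma maximal_ergodic (v : Y -> R) (K : nat) (c : R) : intg mu v -> 0 <= c ->
  (forall y, - c <= v y) ->
  (forall y, exists2 n, (0 < n <= K)%N & 0 <= \sum_(0 <= k < n) v (iter k T y)) ->
  0 <= mean mu v.
Proof.
move=> iv c0 vc vn.
have H L : - (K%:R * c) <= L%:R * mean mu v.
  have -> : L%:R * mean mu v = mean mu (fun y => \sum_(0 <= k < 0 + L) v (iter k T y)).
    rewrite mean_sum; last by move=> k; exact: intg_iter.
    under eq_bigr do rewrite mean_iter//.
    by rewrite sumr_const_nat subn0 add0n mulr_natl.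
  rewrite -[leLHS](mean_cst mu); apply: mean_le; first exact: intg_cst.
    by apply: intg_sum => k; exact: intg_iter.
  move=> y; apply: (@greedy_sum_ge _ (fun k => v (iter k T y)) K c) => // j.
  have [n nK sn] := vn (iter j T y); exists n => //.
  rewrite -{1}[j]add0n big_addn addnC addnK.
  by under eq_bigr do rewrite iterD.
rewrite leNgt; apply/negP => v0.
have := H (Num.truncn (K%:R * c / - mean mu v)).+1.
have := truncnS_gt (K%:R * c / - mean mu v).
rewrite ltr_pdivrMr ?oppr_gt0//; lra.
Qed.

(** The greedy argument needs a bound [K] on the lengths; continuity of the
    measure removes it in the end. *)
Definition exceed (f : Y -> R) (lam : R) (K : nat) : set Y :=
  [set y | exists2 n, (0 < n <= K)%N & lam * n%:R < \sum_(0 <= k < n) f (iter k T y)].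

Lemma measurable_exceed f lam K : measurable_fun setT f -> measurable (exceed f lam K).
Proof.
move=> mf; rewrite (_ : exceed f lam K = \bigcup_(n in [set n | (0 < n <= K)%N])
    [set y | lam * n%:R < \sum_(0 <= k < n) f (iter k T y)]); last first.
  by apply/seteqP; split => y [n nK H]; exists n.
apply: bigcup_measurable => n _; apply: measurable_gt_cst.
by apply: measurable_sum => k; exact: measurable_comp_iter.
Qed.

(** The maximal ergodic inequality, from the greedy argument for
    [f - lam * \1_(exceed f lam K)]. *)
Lemma maximal_inequality f lam K : intg mu f -> (forall y, 0 <= f y) -> 0 <= lam ->
  ((lam%:E * mu (exceed f lam K)) <= (mean mu f)%:E)%E.
Proof.
move=> intf f0 lam0.
have mE : measurable (exceed f lam K).
  by apply: measurable_exceed; exact: intg_measurable intf.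
rewrite -mean_indic// -EFinM lee_fin -subr_ge0.
have i1 : intg mu (fun y => lam * \1_(exceed f lam K) y) by apply: intgZ; exact: intg_indic.
rewrite -(meanZ _ (intg_indic mu mE)) -meanB//.
apply: (@maximal_ergodic _ K.+1 lam) => //.
- exact: intgB.
- move=> y; have : lam * \1_(exceed f lam K) y <= lam.
    by rewrite ler_piMr// indicE; case: (_ \in _).
  by have := f0 y; lra.
move=> y; have [[n nK H]|ny] := pselect (exceed f lam K y).
  exists n; first by move/andP: nK => [-> /leqW ->].
  rewrite sumrB subr_ge0; apply: (@le_trans _ _ (\sum_(0 <= k < n) lam)).
    by apply: ler_sum => k _; rewrite ler_piMr// indicE; case: (_ \in _).
  by rewrite sumr_const_nat subn0 -mulr_natr ltW.
exists 1%N => //; rewrite big_nat1 /= indicE memNset// mulr0 subr0.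
exact: f0.
Qed.

End MeasurePreserving.

(** * Birkhoff's theorem for bounded functions *)

Section Birkhoff.
Context {R : realType} {d : measure_display} {Y : measurableType d}.
Context (mu : probability Y R) (T : Y -> Y).
Hypothesis mpT : measure_preserving mu T.
Implicit Types (f g : Y -> R).

(** Averages of length [n.+1], so that no length is zero. *)
Definition time_average f n y : R := (\sum_(0 <= k < n.+1) f (iter k T y)) / n.+1%:R.
Definition upper_average f y : R := limn_sup (fun n => time_average f n y).

Lemma measurable_time_average f n : measurable_fun setT f ->
  measurable_fun setT (time_average f n).
Proof.
move=> mf; apply: measurable_funM => //.
by apply: measurable_sum => k; exact: (measurable_comp_iter mpT).
Qed.

Lemma time_average_bound f C n y : (forall y, `|f y| <= C) -> `|time_average f n y| <= C.
Proof.
move=> fC; rewrite normrM normfV normr_nat ler_pdivrMr ?ltr0n//.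
apply: (le_trans (ler_norm_sum _ _ _)).
apply: (@le_trans _ _ (\sum_(0 <= k < n.+1) C)); first by apply: ler_sum => ? _; exact: fC.
by rewrite sumr_const_nat subn0 mulr_natr.
Qed.

Lemma measurable_upper_average f C : measurable_fun setT f -> (forall y, `|f y| <= C) ->
  measurable_fun setT (upper_average f).
Proof.
move=> mf fC; apply: measurable_fun_limn_sup => [y _|y _|n].
- exists C => _ [n _ <-]; apply: le_trans (ler_norm _) _.
  exact: time_average_bound.
- exists (- C) => _ [n _ <-].
  by have := time_average_bound n y fC; rewrite ler_norml => /andP[].
- exact: measurable_time_average.
Qed.

Lemma upper_average_bound f C y : (forall y, `|f y| <= C) -> `|upper_average f y| <= C.
Proof. by move=> fC; apply: limn_sup_bound => n; exact: time_average_bound. Qed.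

(** Invariance holds at every point, not only almost everywhere: averages at [y]
    and [T y] differ by at most [2 * C / n.+1]. *)
Lemma upper_average_invariant f C y : (forall y, `|f y| <= C) ->
  upper_average f (T y) = upper_average f y.
Proof.
move=> fC; apply: (@limn_sup_eq _ _ _ C) => [n|n|eps eps0]; try exact: time_average_bound.
near=> n.
have -> : time_average f n (T y) - time_average f n y = (f (iter n.+1 T y) - f y) / n.+1%:R.
  rewrite /time_average -mulrBl big_nat_recr//= [X in _ - X]big_nat_recl//=.
  have -> : \sum_(0 <= k < n) f (iter k T (T y)) = \sum_(0 <= k < n) f (iter k.+1 T y).
    by apply: eq_bigr => k _; rewrite iterSr.
  by rewrite -iterSr; congr (_ / _) => /=; ring.
rewrite normrM normfV normr_nat ler_pdivrMr ?ltr0n//.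
apply: (@le_trans _ _ (C + C)); first by rewrite (le_trans (ler_normB _ _))// lerD.
rewrite mulrC -ler_pdivrMr// (@le_trans _ _ n%:R)// ?ler_nat//.
by near: n; exact: nbhs_infty_ger.
Unshelve. all: by end_near. Qed.

Lemma upper_average_invariant_iter f C n y : (forall y, `|f y| <= C) ->
  upper_average f (iter n T y) = upper_average f y.
Proof. by move=> fC; elim: n => // n IH; rewrite iterS (upper_average_invariant _ fC). Qed.

(** The maximal ergodic theorem for [f - upper_average f + eps], corrected on the
    small set of points where the supremum is not approached in time [K]. *)
Lemma mean_upper_average_le f C : measurable_fun setT f -> (forall y, `|f y| <= C) ->
  mean mu (upper_average f) <= mean mu f.
Proof.
move=> mf fC.
have [y0|noY] := pselect (exists y : Y, True); last first.
  by rewrite (@mean_eq _ _ _ _ (upper_average f) f)// => y; exfalso; apply: noY; exists y.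
have C0 : 0 <= C by have [y _] := y0; exact: le_trans (normr_ge0 _) (fC y).
have intf := intg_bounded mu mf fC.
have mF := measurable_upper_average mf fC.
have FC y := upper_average_bound y fC.
have intF := intg_bounded mu mF FC.
apply/ler_addgt0Pr => eps eps0.
have e2 : 0 < eps / 2 by rewrite divr_gt0.
pose E (K : nat) := [set y | forall n, (n < K)%N -> 0 < upper_average f y - eps / 2 -
    time_average f n y].
have mE K : measurable (E K).
  rewrite (_ : E K = \bigcap_(n in [set n | (n < K)%N])
      [set y | 0 < upper_average f y - eps / 2 - time_average f n y]).
    apply: bigcap_measurableType => n _; apply: measurable_gt_cst.
    apply: measurable_funB; last exact: measurable_time_average.
    by apply: measurable_funB.
  by apply/seteqP; split => y.
have bound K : mean mu (upper_average f) <= mean mu f + eps / 2 + 2 * C * mean mu \1_(E K).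
  pose v y := f y + 2 * C * \1_(E K) y - upper_average f y + eps / 2.
  have iE := intg_indic mu (mE K).
  have i1 : intg mu (fun y => f y + 2 * C * \1_(E K) y) by apply: intgD => //; exact: intgZ.
  have i2 : intg mu (fun y => f y + 2 * C * \1_(E K) y - upper_average f y) by exact: intgB.
  have iv : intg mu v by apply: intgD => //; exact: intg_cst.
  have vE : mean mu v = mean mu f + 2 * C * mean mu \1_(E K) - mean mu (upper_average f) + eps
      / 2.
    rewrite /v meanD//; last exact: intg_cst.
    by rewrite meanB// meanD//; [rewrite meanZ// mean_cst|exact: intgZ].
  suff : 0 <= mean mu v by rewrite vE; lra.
  have bd (A : R) y : `|A| <= C -> - C <= A <= C by rewrite ler_norml.
  have ind0 y : 0 <= 2 * C * \1_(E K) y by rewrite mulr_ge0 ?mulr_ge0// indicE.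
  apply: (@maximal_ergodic _ _ _ mu T mpT v K.+1 (2 * C)) => //.
  - by rewrite mulr_ge0.
  - move=> y; rewrite /v; have := ind0 y; have := fC y; have := FC y.
    by rewrite !ler_norml => /andP[? ?] /andP[? ?] ?; lra.
  move=> y; have [yE|nE] := pselect (E K y).
    exists 1%N => //; rewrite big_nat1 /= /v indicE mem_set// mulr1.
    by have := fC y; have := FC y; rewrite !ler_norml => /andP[? ?] /andP[? ?]; lra.
  have [n nK H] : exists2 n, (n < K)%N & upper_average f y - eps / 2 <= time_average f n y.
    apply: contrapT => h; apply: nE => n nK; rewrite subr_gt0 ltNge; apply/negP => H.
    by apply: h; exists n.
  exists n.+1; first by rewrite /= ltnS ltnW.
  apply: (@le_trans _ _ (\sum_(0 <= k < n.+1) (f (iter k T y) - (upper_average f y - eps / 2)))).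
    rewrite sumrB subr_ge0 sumr_const_nat subn0 -[leLHS]mulr_natr.
    by rewrite -ler_pdivlMr ?ltr0n.
  apply: ler_sum => k _; rewrite /v (upper_average_invariant_iter _ _ fC).
  by have := ind0 (iter k T y); lra.
have [K HK] : exists K, 2 * C * mean mu \1_(E K) <= eps / 2.
  have ndE : nonincreasing_seq E.
    by move=> K L KL; apply/subsetPset => y EL n nK; apply: EL; exact: leq_trans KL.
  have E0 : \bigcap_K E K = set0.
    apply/seteqP; split => // y /= Ey.
    have [n _ Hn] := @limn_sup_frequently _ (fun n => time_average f n y) C (eps / 2) 0
      (fun n => time_average_bound n y fC) e2.
    have := Ey n.+1 I n (leqnn _); rewrite subr_gt0 => /lt_le_trans /(_ Hn).
    by rewrite ltxx.
  have := @nonincreasing_cvg_mu _ _ _ mu E; rewrite E0 measure0.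
  have mu0 : (mu (E 0%N) < +oo)%E.
    by rewrite -mean_indic// ltry.
  move=> /(_ mu0 mE measurable0 ndE) /fine_cvgP[_].
  have C1 : 0 < 2 * C + 1 by lra.
  have ec : 0 < eps / 2 / (2 * C + 1) by rewrite divr_gt0.
  move=> /cvgrPdist_le /(_ _ ec) [K _ /(_ K (leqnn _))].
  rewrite /= sub0r normrN -mean_indic//= => H; exists K.
  have m0 : 0 <= mean mu \1_(E K) by apply: mean_ge0 => y; rewrite indicE.
  move: H; rewrite ger0_norm// ler_pdivlMr// => H.
  by apply: le_trans H; rewrite mulrC ler_wpM2l//; lra.
by have := bound K; lra.
Qed.

(** Birkhoff's theorem in [L^1]: the upper averages of [f] and [- f] have
    opposite means, hence are opposite almost everywhere. *)
Lemma birkhoff_l1 f C : measurable_fun setT f -> (forall y, `|f y| <= C) ->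
  forall eps, 0 < eps -> exists n, mean mu (fun y => `|time_average f n y - upper_average f y|)
      <= eps.
Proof.
move=> mf fC eps eps0.
pose fN y := - f y.
have mfN : measurable_fun setT fN by exact: measurableT_comp.
have fNC y : `|fN y| <= C by rewrite normrN.
have avN n y : time_average fN n y = - time_average f n y.
  by rewrite /time_average -mulNr -sumrN.
have intf := intg_bounded mu mf fC.
have mF := measurable_upper_average mf fC.
have FC y := upper_average_bound y fC.
have intF := intg_bounded mu mF FC.
have intFN := intg_bounded mu (measurable_upper_average mfN fNC) (fun y => upper_average_bound
    y fNC).
pose gap y := upper_average f y + upper_average fN y.
have gap0 y : 0 <= gap y.
  apply/ler_addgt0Pr => del del0; rewrite /gap.
  have d2 : 0 < del / 2 by rewrite divr_gt0.
  have [N _ HN] := limn_sup_eventually (fun n => time_average_bound n y fNC) d2.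
  have [N' _ HN'] := limn_sup_eventually (fun n => time_average_bound n y fC) d2.
  have := HN (maxn N N') (leq_maxl _ _); have := HN' (maxn N N') (leq_maxr _ _).
  by rewrite /= avN /upper_average; lra.
have mgap : mean mu gap <= 0.
  rewrite /gap meanD//.
  have := mean_upper_average_le mf fC; have := mean_upper_average_le mfN fNC.
  rewrite (@mean_eq _ _ _ mu fN (fun y => -1 * f y)) ?meanZ//; first by lra.
  by move=> y; rewrite mulN1r.
have gap_ae : {ae mu, forall y, forall del, 0 < del -> \forall j \near \oo, gap y <= del}.
  apply: (@ae_cvg0_of_summable_mean _ _ _ mu (fun=> gap) 0) => // [j|J]; first exact: intgD.
  by apply: sumr_le0.
have cv : {ae mu, forall y, setT y -> EFin (time_average f n y) @[n --> \oo] --> EFin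
    (upper_average f y)}.
  apply: filterS gap_ae => y gy _; apply/fine_cvgP; split; first exact: nearW.
  apply/cvgrPdist_le => del del0.
  have d2 : 0 < del / 2 by rewrite divr_gt0.
  have [j _ /(_ j (leqnn _)) /= gapy] := gy _ d2.
  near=> n.
  have H1 : time_average fN n y <= upper_average fN y + del / 2.
    by near: n; apply: limn_sup_eventually d2 => n; exact: time_average_bound.
  have H2 : time_average f n y <= upper_average f y + del / 2.
    by near: n; apply: limn_sup_eventually d2 => n; exact: time_average_bound.
  move: H1 gapy; rewrite avN /gap ler_norml => ? ?.
  by apply/andP; split; lra.
have mA n : measurable_fun setT (EFin \o time_average f n).
  by apply/measurable_EFinP; exact: measurable_time_average.
have mF' : measurable_fun setT (EFin \o upper_average f) by exact/measurable_EFinP.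
have dom : {ae mu, forall y, forall n, setT y -> (`|(EFin \o time_average f n) y| <= (fun=>
    C%:E) y)%E}.
  by apply: aeW => y n _; rewrite /= lee_fin; exact: time_average_bound.
have [_ + _] := dominated_convergence measurableT mA mF' cv (intg_cst mu C) dom.
move=> /fine_cvgP[_ /cvgrPdist_le /(_ _ eps0)] [n _ /(_ n (leqnn _)) /= H].
exists n; move: H; rewrite sub0r normrN; apply: le_trans.
exact: ler_norm.
Unshelve. all: by end_near. Qed.

(** The difference of [f] and its time average is a coboundary, and the time
    average is close to the invariant upper average. *)
Lemma invariant_coboundary_approx f C : measurable_fun setT f -> (forall y, `|f y| <= C) ->
  forall eps, 0 < eps -> exists n (u : Y -> R) (D : R),
  [/\ measurable_fun setT u, (forall y, `|u y| <= D),
      (forall y, f y - time_average f n y = u y - u (T y)) &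
      mean mu (fun y => `|time_average f n y - upper_average f y|) <= eps].
Proof.
move=> mf fC eps eps0; have [n Hn] := birkhoff_l1 mf fC eps0.
pose u y := (\sum_(0 <= h < n.+1) \sum_(0 <= k < h) f (iter k T y)) / n.+1%:R.
exists n, u, (n.+1%:R * C); split => //.
- apply: measurable_funM => //; apply: measurable_sum => h; apply: measurable_sum => k.
  exact: (measurable_comp_iter mpT).
- move=> y; rewrite normrM normfV normr_nat ler_pdivrMr ?ltr0n//.
  apply: (le_trans (ler_norm_sum _ _ _)).
  apply: (@le_trans _ _ (\sum_(0 <= h < n.+1) n.+1%:R * C)).
    rewrite !big_nat; apply: ler_sum => h /andP[_ hn].
    apply: (le_trans (ler_norm_sum _ _ _)).
    apply: (@le_trans _ _ (\sum_(0 <= k < h) C)); first by apply: ler_sum => ? _; exact: fC.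
    rewrite sumr_const_nat subn0 -[leLHS]mulr_natl ler_wpM2r ?ler_nat ?(ltnW hn)//.
    exact: le_trans (normr_ge0 _) (fC y).
  by rewrite sumr_const_nat subn0 mulr_natr.
- move=> y; rewrite /u /time_average -mulrBl -sumrB.
  have -> : \sum_(0 <= h < n.+1) (\sum_(0 <= k < h) f (iter k T y) -
      \sum_(0 <= k < h) f (iter k T (T y))) = \sum_(0 <= h < n.+1) (f y - f (iter h T y)).
    apply: eq_bigr => h _; elim: h => [|h IH]; first by rewrite !big_geq// !subrr.
    rewrite !big_nat_recr//= opprD addrACA IH -iterSr iterS.
    by rewrite addrA subrK.
  by rewrite sumrB sumr_const_nat subn0 mulrBl -[f y *+ _]mulr_natr mulfK.
Qed.

End Birkhoff.

(** * Second moments along orbits *)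

Section GeometricSums.
Context {R : realType}.
Implicit Types (r x q : R).

Lemma geometric_sum_lt r x J : 1 < r -> 0 <= x ->
  \sum_(j < J) r ^+ j * (r ^+ j < x)%R%:R <= r / (r - 1) * x.
Proof.
move=> r1 x0; have rm : 0 < r - 1 by rewrite subr_gt0.
have r0 : 0 < r by apply: lt_trans r1.
have c0 : 0 <= r / (r - 1) * x by rewrite mulr_ge0// divr_ge0// ltW.
elim: J => [|J IH]; first by rewrite big_ord0.
rewrite big_ord_recr/=; have [xr|rx] := leP x (r ^+ J); first by rewrite mulr0 addr0.
rewrite mulr1; apply: (@le_trans _ _ (r ^+ J.+1 / (r - 1))); last first.
  by rewrite exprS mulrAC ler_wpM2l ?(ltW rx)// ltW// divr_gt0.
apply: (@le_trans _ _ (\sum_(j < J.+1) r ^+ j)).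
  rewrite [leRHS]big_ord_recr/= lerD2r; apply: ler_sum => j _.
  by rewrite ler_piMr ?exprn_ge0 ?(ltW r0)// lern1 leq_b1.
rewrite ler_pdivlMr// mulrC -subrX1 lerBlDr lerDl; exact: ler01.
Qed.

(** Dividing [x] by [r] drops the first term, which vanishes for [x > 1]; for
    [x <= 1] the sum is dominated by a geometric series. *)
Lemma geometric_sum_ge r x J : 1 < r -> 0 <= x ->
  \sum_(j < J) x * (x <= r ^+ j)%R%:R / r ^+ j <= r / (r - 1).
Proof.
move=> r1; have rm : 0 < r - 1 by rewrite subr_gt0.
have r0 : 0 < r by apply: lt_trans r1.
have c0 : 0 <= r / (r - 1) by rewrite divr_ge0// ltW.
elim: J x => [|J IH] x x0; first by rewrite big_ord0.
have [x1|x1] := leP x 1; last first.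
  rewrite big_ord_recl/= expr0 (lt_geF x1) mulr0 mul0r add0r.
  apply: le_trans (IH (x / r) (divr_ge0 x0 (ltW r0))).
  apply: ler_sum => j _; rewrite /bump/= add1n exprS.
  have -> : (x / r <= r ^+ j) = (x <= r * r ^+ j) by rewrite ler_pdivrMr// mulrC.
  by rewrite invfM; move: (_%R%:R : R) (r ^+ j)^-1 (r^-1) => b p q; lra.
apply: (@le_trans _ _ (\sum_(j < J.+1) r^-1 ^+ j)).
  apply: ler_sum => j _; rewrite exprVn ler_piMl ?invr_ge0 ?exprn_ge0 ?(ltW r0)//.
  by case: (x <= r ^+ j); rewrite ?mulr1 ?mulr0.
have ri : 0 < 1 - r^-1 by rewrite subr_gt0 invf_lt1.
have -> : r / (r - 1) = (1 - r^-1)^-1 by field; rewrite !gt_eqF.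
rewrite -[leRHS]mul1r ler_pdivlMr// mulrC.
have -> : (1 - r^-1) * \sum_(j < J.+1) r^-1 ^+ j = - ((r^-1 - 1) * \sum_(j < J.+1) r^-1 ^+ j)
    by ring.
by rewrite -subrX1 opprB lerBlDr lerDl exprn_ge0// invr_ge0 ltW.
Qed.

Lemma geometric_sum_le q J : 0 < q < 1 -> \sum_(j < J) q ^+ j <= (1 - q)^-1.
Proof.
move=> /andP[q0 q1]; have q1' : 0 < 1 - q by rewrite subr_gt0.
rewrite -[leRHS]mul1r ler_pdivlMr// mulrC.
have -> : (1 - q) * \sum_(j < J) q ^+ j = - ((q - 1) * \sum_(j < J) q ^+ j) by ring.
by rewrite -subrX1 opprB lerBlDr lerDl exprn_ge0// ltW.
Qed.

Lemma symmetric_sum (a : nat -> nat -> R) M : (forall k l, a k l = a l k) ->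
  \sum_(1 <= k < M.+1) \sum_(1 <= l < M.+1) a k l =
  \sum_(1 <= k < M.+1) a k k +
  2 * \sum_(1 <= j < M) \sum_(1 <= k < (M - j).+1) a k (k + j)%N.
Proof.
move=> aC; elim: M => [|M IH]; first by rewrite !big_geq// mulr0 addr0.
rewrite big_nat_recr//= [X in _ + X]big_nat_recr//=.
under eq_bigr do rewrite big_nat_recr//=.
rewrite big_split/= IH [in RHS]big_nat_recr//=.
have -> : \sum_(1 <= j < M.+1) \sum_(1 <= k < (M.+1 - j).+1) a k (k + j)%N =
  \sum_(1 <= j < M) \sum_(1 <= k < (M - j).+1) a k (k + j)%N + \sum_(1 <= k < M.+1) a k M.+1.
  transitivity (\sum_(1 <= j < M.+1) (\sum_(1 <= k < (M - j).+1) a k (k + j)%N + a (M.+1 - j)%N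
      M.+1)).
    apply: eq_big_nat => j /andP[j0 jM]; rewrite subSn -1?ltnS//.
    by rewrite big_nat_recr//= addSn subnK -1?ltnS.
  rewrite big_split/=; congr (_ + _).
    case: M {IH} => [|M]; first by rewrite !big_geq.
    by rewrite big_nat_recr//= subnn [X in _ + X]big_geq// addr0.
  rewrite big_nat_rev/=; apply: eq_big_nat => k /andP[k0 kM].
  by rewrite (_ : M.+1 - (1 + M.+1 - k.+1) = k)%N//; lia.
have -> : \sum_(1 <= l < M.+1) a M.+1 l = \sum_(1 <= l < M.+1) a l M.+1.
  by apply: eq_bigr => l _; rewrite aC.
ring.
Qed.

End GeometricSums.

Section SecondMoment.
Context {R : realType} {d : measure_display} {Y : measurableType d}.
Context (mu : probability Y R) (T : Y -> Y).
Hypothesis mpT : measure_preserving mu T.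

(** Invariance turns the second moment into a combination of the
    autocorrelations of [h], weighted by those of the coefficients. *)
Lemma second_moment_le (c : nat -> R) (h : Y -> R) (C r0 r : R) M :
  measurable_fun setT h -> (forall y, 0 <= h y <= C) ->
  \sum_(1 <= k < M.+1) c k ^+ 2 <= r0 ->
  (forall j, (0 < j)%N -> `|\sum_(1 <= k < (M - j).+1) c k * c (k + j)%N| <= r) ->
  mean mu (fun y => (\sum_(1 <= k < M.+1) c k * h (iter k T y)) ^+ 2) <=
  r0 * mean mu (fun y => h y ^+ 2) +
  2 * (r * \sum_(1 <= j < M) mean mu (fun y => h y * h (iter j T y))).
Proof.
move=> mh hC c0 cr.
have mhT k : measurable_fun setT (fun y => h (iter k T y)) by exact: (measurable_comp_iter mpT).
have hhC k l y : `|h (iter k T y) * h (iter l T y)| <= C * C.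
  have /andP[? ?] := hC (iter k T y); have /andP[? ?] := hC (iter l T y).
  by rewrite ger0_norm ?mulr_ge0// ler_pM.
have ihh k l : intg mu (fun y => h (iter k T y) * h (iter l T y)).
  by apply: (@intg_bounded _ _ _ _ _ (C * C)) => //; exact: measurable_funM.
pose G j := mean mu (fun y => h y * h (iter j T y)).
have G0 j : 0 <= G j.
  apply: mean_ge0 => y; have /andP[? _] := hC y; have /andP[? _] := hC (iter j T y).
  exact: mulr_ge0.
have GE k j : mean mu (fun y => h (iter k T y) * h (iter (k + j) T y)) = G j.
  rewrite /G -(mean_iter mpT k (ihh 0%N j)); apply: mean_eq => y /=.
  by rewrite -iterD addnC.
pose a k l := c k * c l * mean mu (fun y => h (iter k T y) * h (iter l T y)).
have aC k l : a k l = a l k.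
  by rewrite /a [c k * c l]mulrC; congr (_ * _); apply: mean_eq => y; rewrite mulrC.
have -> : mean mu (fun y => (\sum_(1 <= k < M.+1) c k * h (iter k T y)) ^+ 2) =
    \sum_(1 <= k < M.+1) \sum_(1 <= l < M.+1) a k l.
  transitivity (mean mu (fun y => \sum_(1 <= k < M.+1) \sum_(1 <= l < M.+1)
     (c k * c l) * (h (iter k T y) * h (iter l T y)))).
    apply: mean_eq => y; rewrite expr2 mulr_suml; apply: eq_bigr => k _.
    by rewrite mulr_sumr; apply: eq_bigr => l _; rewrite mulrACA.
  rewrite mean_sum => [|k]; last by apply: intg_sum => l; exact: intgZ.
  apply: eq_bigr => k _; rewrite mean_sum => [|l]; last exact: intgZ.
  by apply: eq_bigr => l _; rewrite meanZ.
rewrite symmetric_sum// lerD//.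
  have -> : mean mu (fun y => h y ^+ 2) = G 0%N by apply: mean_eq => y; rewrite expr2.
  apply: (@le_trans _ _ ((\sum_(1 <= k < M.+1) c k ^+ 2) * G 0%N)); last by rewrite ler_wpM2r.
  rewrite mulr_suml; apply: ler_sum => k _; rewrite /a -expr2.
  by rewrite -(GE k 0%N) addn0.
rewrite ler_wpM2l// mulr_sumr [leLHS]big_nat [leRHS]big_nat.
apply: ler_sum => j /andP[j0 _]; rewrite -/(G j).
have -> : \sum_(1 <= k < (M - j).+1) a k (k + j)%N = (\sum_(1 <= k < (M - j).+1) c k * c (k +
    j)%N) * G j.
  by rewrite mulr_suml; apply: eq_bigr => k _; rewrite /a GE.
by rewrite ler_wpM2r// (le_trans (ler_norm _))// cr.
Qed.

End SecondMoment.

(** * Sampled averages of integrable functions *)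

Lemma near_subsequence (Q : nat -> Prop) (Mj : nat -> nat) : (forall j, (j <= Mj j)%N) ->
  (\forall M \near \oo, Q M) -> \forall j \near \oo, Q (Mj j).
Proof. by move=> jM [M0 _ H]; exists M0 => // j /= M0j; apply: H => /=; exact: leq_trans (jM
    j). Qed.

Lemma near_shift (Q : nat -> Prop) j0 :
  (\forall j \near \oo, Q (j0 + j)%N) -> \forall j \near \oo, Q j.
Proof.
case=> J _ H; exists (j0 + J)%N => // j /= jJ.
rewrite -(@subnKC j0 j); last exact: leq_trans (leq_addr _ _) jJ.
by apply: H => /=; rewrite leq_subRL// (leq_trans (leq_addr _ _) jJ).
Qed.

Lemma sum_shift_le (R : realType) (F : nat -> R) j0 J : (forall j, 0 <= F j) ->
  \sum_(j < J) F (j0 + j)%N <= \sum_(j < j0 + J) F j.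
Proof. by move=> F0; rewrite big_split_ord/= lerDr sumr_ge0. Qed.

Section Sampling.
Context {R : realType} (al : R) (e : nat -> bool) (fam : nat -> seq (nat -> R)).
Hypotheses (al_gt0 : 0 < al) (al_lt : al < 1 / 2) (e_good : good al fam e).
Variable a : nat -> nat.
Hypothesis aE : forall (phi : nat -> nat -> R) m,
  \sum_(1 <= k < m.+1) (e k)%:R * phi (hits e k) k =
  \sum_(1 <= n < (hits e m).+1) phi n (a n).

Lemma near_hits_Ehits (eta : R) : 0 < eta ->
  \forall M \near \oo, (1 - eta) * Ehits al M <= (hits e M)%:R <= (1 + eta) * Ehits al M.
Proof.
move=> eta0; have [g1 _ _] := e_good; near=> M.
have H : `|(hits e M)%:R - Ehits al M| <= 2 * M%:R `^ (- (1 / 8)) * Ehits al M by near: M.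
have small : M%:R `^ (- (1 / 8)) <= eta / 2.
  by near: M; apply: powR_near_infty0; rewrite ?divr_gt0.
have w0 := Ehits_ge0 al_gt0 al_lt M.
have {}H : `|(hits e M)%:R - Ehits al M| <= eta * Ehits al M.
  by rewrite (le_trans H)// ler_wpM2r//; lra.
by move: H; rewrite ler_norml => /andP[? ?]; apply/andP; split; lra.
Unshelve. all: by end_near. Qed.

Lemma near_Ehits (A : R) : \forall M \near \oo, A <= Ehits al M.
Proof.
have a1 : 0 < 1 - al by have := al_lt; lra.
near=> M; apply: le_trans (Ehits_ge al_gt0 al_lt M).
by near: M; exact: powR_near_infty.
Unshelve. all: by end_near. Qed.

Lemma near_hits (A : R) : \forall M \near \oo, A <= (hits e M)%:R.
Proof.
near=> M.
have H : (1 - 1 / 2) * Ehits al M <= (hits e M)%:R <= (1 + 1 / 2) * Ehits al M.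
  by near: M; apply: near_hits_Ehits; lra.
have : 2 * A <= Ehits al M by near: M; exact: near_Ehits.
by case/andP: H => ? _; lra.
Unshelve. all: by end_near. Qed.

(** The first index after [J] whose number of hits exceeds [N] is [j + 1]. *)
Lemma hits_interpolation (Mj : nat -> nat) J : (forall j, (j <= Mj j)%N) ->
  \forall N \near \oo, exists2 j, (J <= j)%N &
    (hits e (Mj j) <= N)%N /\ (N < hits e (Mj j.+1))%N.
Proof.
move=> jM; exists (hits e (Mj J)) => // N /= HN.
have ex : exists j, (N < hits e (Mj (J + j)))%N.
  have [M0 _ H] := near_subsequence jM (near_hits N.+1%:R).
  exists M0; have := H (J + M0)%N (leq_addl _ _).
  by rewrite ler_nat.
case: (ex_minnP ex) => -[|j]; first by rewrite addn0 ltnNge HN.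
rewrite addnS => jN minj; exists (J + j)%N; first exact: leq_addr.
by split => //; rewrite leqNgt; apply/negP => /minj; rewrite ltnn.
Qed.

Section System.
Context {d : measure_display} {Y : measurableType d} (mu : probability Y R) (T : Y -> Y).
Hypothesis mpT : measure_preserving mu T.

(** The pointwise substitute for the weak type [(1, 1)] inequality.  Along the
    lengths [M = 2 ^ j], values of [f] above [M ^ (1 - al)] are eventually not
    sampled; the rest, restricted to points whose forward averages are at most
    [2 * lam], has deviations with summable second moments, since
    [|\sum_(d < M) h (T^d y)| <= 2 * lam * M] on the support of [h]. *)
Lemma sampled_average_le (f : Y -> R) (lam : R) :
  (\forall M \near \oo, (fun=> 1) \in fam M) ->
  intg mu f -> (forall y, 0 <= f y) -> 0 < lam ->
  {ae mu, forall y, (forall n, \sum_(0 <= k < n) f (iter k T y) <= lam * n%:R) ->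
    \forall N \near \oo, \sum_(1 <= n < N.+1) f (iter (a n) T y) <= 12 * lam * N%:R}.
Proof.
move=> fam1 intf f0 lam0.
have [_ _ g3] := e_good.
have mf := intg_measurable intf.
have al1 : 1 / 2 < 1 - al by have := al_lt; lra.
have al1' : 0 < 1 - al by lra.
pose g : R := 1 / 2 - al.
have g0 : 0 < g by rewrite subr_gt0.
pose M (j : nat) := (2 ^ j)%N.
have jM j : (j <= M j)%N by exact/ltnW/ltn_expl.
have M0 j : (0 < M j)%N by rewrite expn_gt0.
pose r : R := 2 `^ (1 - al).
have r1 : 1 < r.
  have := @gt0_ltr_powR R _ al1' 1 2; rewrite powR1; apply; rewrite ?nnegrE ?ltr1n//.
have r0 : 0 < r by exact: lt_trans r1.
have rE j : r ^+ j = (M j)%:R `^ (1 - al).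
  by rewrite /r -powR_mulrn ?powR_ge0// -powRrM mulrC powRrM powR_mulrn// /M natrX.
have rj0 j : 0 < r ^+ j by rewrite exprn_gt0.
have Wr j : r ^+ j <= Ehits al (M j) by rewrite rE; exact: Ehits_ge.
have W0 j : 0 < Ehits al (M j) by exact: lt_le_trans (rj0 j) (Wr j).
pose c k : R := (e k)%:R - sigma al k.
pose h j y := f y * (f y <= r ^+ j)%R%:R *
  (\sum_(0 <= k < M j) f (iter k T y) <= 2 * lam * (M j)%:R)%R%:R.
have h0 j y : 0 <= h j y by rewrite !mulr_ge0.
have hf j y : h j y <= f y.
  rewrite /h; case: (_ <= r ^+ j); case: (_ <= 2 * lam * _); rewrite ?mulr1 ?mulr0//.
have hr j y : h j y <= r ^+ j.
  rewrite /h; case: (leP (f y)) => // H; last by rewrite mulr0 mul0r ltW.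
  by rewrite mulr1; case: (_ <= 2 * lam * _); rewrite ?mulr1 ?mulr0 ?(ltW (rj0 j)).
have mSf j : measurable_fun setT (fun y => \sum_(0 <= k < M j) f (iter k T y)).
  by apply: measurable_sum => k; exact: (measurable_comp_iter mpT).
have mleE (u : Y -> R) (x : R) : measurable_fun setT u -> measurable_fun setT (fun y => (u y <=
    x)%R%:R : R).
  move=> mu_; rewrite (_ : (fun y => _) = \1_(~` [set y | x < u y])).
    apply: measurable_indic; apply: measurableC; exact: measurable_gt_cst.
  apply/funext => y; rewrite indicE; congr ((nat_of_bool _)%:R).
  by rewrite in_setC leNgt; congr (~~ _); apply/idP/idP; rewrite inE.
have mh j : measurable_fun setT (h j).
  apply: measurable_funM; last exact: mleE.
  by apply: measurable_funM => //; exact: mleE.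
have hC j y : 0 <= h j y <= r ^+ j by rewrite h0 hr.
have ih j : intg mu (h j).
  by apply: (intg_bounded mu (mh j) (C := r ^+ j)) => y; rewrite ger0_norm.
have [j0 _ near0] : \forall j \near \oo,
    ((1 - 1 / 2) * Ehits al (M j) <= (hits e (M j))%:R <= (1 + 1 / 2) * Ehits al (M j)) /\
    (forall i, (0 < i)%N ->
      `|\sum_(1 <= k < (M j - i).+1) c k * c (k + i)%N| <= (M j)%:R `^ (3 / 2 * g)).
  apply: (near_subsequence (Q := fun m =>
    ((1 - 1 / 2) * Ehits al m <= (hits e m)%:R <= (1 + 1 / 2) * Ehits al m) /\
    (forall i, (0 < i)%N ->
      `|\sum_(1 <= k < (m - i).+1) c k * c (k + i)%N| <= m%:R `^ (3 / 2 * g)))) => //.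
  near=> m; split; first by near: m; apply: near_hits_Ehits; lra.
  have H1 : (fun=> 1) \in fam m by near: m.
  have H2 : forall b b', b \in fam m -> b' \in fam m -> forall i, (0 < i)%N ->
        `|\sum_(1 <= k < (m - i).+1) coef al e b k * coef al e b' (k + i)| <=
          m%:R `^ (3 / 2 * g) by near: m.
  move=> i i0; have := H2 _ _ H1 H1 i i0; congr (`|_| <= _).
  by apply: eq_bigr => k _; rewrite /coef !mulr1.
have nearj j : (j0 <= j)%N -> _ := near0 j.
have Wr2 j : Ehits al (M j) <= 2 * r ^+ j.
  apply: (le_trans (Ehits_le al_gt0 al_lt _)); rewrite -rE ler_pdivrMr// -mulrA.
  by rewrite mulrCA ler_peMr ?ltW//; lra.
have mgt x : measurable [set y | x < f y] by exact: measurable_gt_cst.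
have gtE x y : (x < f y)%R%:R = \1_[set y | x < f y] y :> R.
  by rewrite indicE; congr ((nat_of_bool _)%:R); apply/idP/idP; rewrite inE.
have igt x : intg mu (fun y => (x < f y)%R%:R).
  by apply: eq_integrable (intg_indic mu (mgt x)) => // y _; rewrite /= gtE.
(* Large values are not sampled. *)
pose g1 j y : R := \sum_(1 <= k < (M j).+1) (e k)%:R * (r ^+ j < f (iter k T y))%R%:R.
have g1_ae : {ae mu, forall y, \forall j \near \oo, g1 j y <= 1 / 2}.
  have ig1 j : intg mu (g1 j).
    by apply: intg_sum => k; apply: intgZ; exact: (intg_iter mpT k (igt (r ^+ j))).
  have : {ae mu, forall y, forall eps, 0 < eps -> \forall j \near \oo, g1 (j0 + j)%N y <= eps}.
    apply: (@ae_cvg0_of_summable_mean _ _ _ mu _ (4 * (r / (r - 1) * mean mu f))) => //.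
      by move=> j y; apply: sumr_ge0 => k _; rewrite mulr_ge0.
    move=> J.
    pose F j := 4 * (r ^+ j * mean mu (fun y => (r ^+ j < f y)%R%:R)).
    have mean0 j : 0 <= mean mu (fun y => (r ^+ j < f y)%R%:R) by apply: mean_ge0 => y.
    have F0 j : 0 <= F j by rewrite !mulr_ge0 ?(ltW (rj0 j)).
    apply: (@le_trans _ _ (\sum_(j < J) F (j0 + j)%N)).
      apply: ler_sum => j _; set i := (j0 + j)%N.
      have -> : mean mu (g1 i) = (hits e (M i))%:R * mean mu (fun y => (r ^+ i < f y)%R%:R).
        rewrite /g1 mean_sum => [|k]; last by apply: intgZ; exact: (intg_iter mpT k (igt (r ^+
            i))).
        rewrite /hits natr_sum mulr_suml; apply: eq_bigr => k _.
        by rewrite meanZ ?(mean_iter mpT k (igt (r ^+ i)))//; exact: (intg_iter mpT k (igt (r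
            ^+ i))).
      rewrite /F mulrA ler_wpM2r//.
      have [/andP[_ H] _] := nearj i (leq_addr _ _).
      by have := Wr2 i; have := rj0 i; lra.
    apply: (le_trans (sum_shift_le j0 J F0)); rewrite /F -mulr_sumr ler_wpM2l//.
    rewrite -(meanZ _ intf).
    have -> : \sum_(j < j0 + J) r ^+ j * mean mu (fun y => (r ^+ j < f y)%R%:R) =
        mean mu (fun y => \sum_(j < j0 + J) r ^+ j * (r ^+ j < f y)%R%:R).
      by rewrite mean_sum => [|j]; [apply: eq_bigr => j _; rewrite meanZ|exact: intgZ].
    apply: mean_le => [||y]; last exact: geometric_sum_lt.
      by apply: intg_sum => j; exact: intgZ.
    exact: intgZ.
  by apply: filterS => y H; apply: (near_shift (j0 := j0)); apply: H; lra.
(* The deviations of the truncated functions tend to zero. *)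
pose K j y : R := \sum_(1 <= k < (M j).+1) c k * h j (iter k T y).
pose g2 j y : R := (Ehits al (M j))^-1 ^+ 2 * K j y ^+ 2.
have g2_ae : {ae mu, forall y, \forall j \near \oo, g2 j y <= lam ^+ 2}.
  have mK j : measurable_fun setT (K j).
    apply: measurable_sum => k; apply: measurable_funM => //.
    exact: (measurable_comp_iter mpT).
  have iK j : intg mu (fun y => K j y ^+ 2).
    pose B := \sum_(1 <= k < (M j).+1) `|c k| * r ^+ j.
    apply: (@intg_bounded _ _ _ mu _ (B ^+ 2)).
      by apply: measurable_funX.
    move=> y; rewrite normrX lerXn2r ?nnegrE//.
      by apply: sumr_ge0 => k _; rewrite mulr_ge0// ltW.
    apply: (le_trans (ler_norm_sum _ _ _)); apply: ler_sum => k _.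
    by rewrite normrM ler_wpM2l// ger0_norm.
  have ig2 j : intg mu (g2 j) by exact: intgZ.
  pose q : R := 2 `^ (- (g / 2)).
  have q01 : 0 < q < 1.
    rewrite /q powR_gt0//= powRN invf_lt1 ?powR_gt0//.
    have gh : 0 < g / 2 by rewrite divr_gt0.
    have := @gt0_ltr_powR R _ gh 1 2.
    by rewrite powR1; apply; rewrite ?nnegrE ?ltr1n.
  have qE j : q ^+ j = (M j)%:R `^ (- (g / 2)).
    by rewrite /q -powR_mulrn ?powR_ge0// -powRrM mulrC powRrM powR_mulrn// /M natrX.
  pose B1 j := mean mu (fun y => f y * (f y * (f y <= r ^+ j)%R%:R / r ^+ j)).
  have iB1 j : intg mu (fun y => f y * (f y * (f y <= r ^+ j)%R%:R / r ^+ j)).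
    apply: (intg_le _ _ intf).
      apply: measurable_funM => //; apply: measurable_funM => //.
      by apply: measurable_funM => //; exact: mleE.
    move=> y; rewrite ger0_norm ?mulr_ge0 ?invr_ge0 ?(ltW (rj0 j))//.
    rewrite ler_piMr// ler_pdivrMr// mul1r.
    by case: (leP (f y) (r ^+ j)) => H; rewrite ?mulr1 ?mulr0 ?(ltW (rj0 j)).
  have B10 j : 0 <= B1 j.
    by apply: mean_ge0 => y; rewrite !mulr_ge0 ?invr_ge0 ?(ltW (rj0 j)).
  have mf0 : 0 <= mean mu f by exact: mean_ge0.
  have bound j : (j0 <= j)%N -> mean mu (g2 j) <= 3 * B1 j + 4 * lam * mean mu f * q ^+ j.
    move=> jj; have [/andP[_ H1] H2] := nearj j jj.
    rewrite /g2 meanZ//.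
    have c3 : \sum_(1 <= k < (M j).+1) c k ^+ 2 <= 3 * Ehits al (M j).
      apply: (@le_trans _ _ (\sum_(1 <= k < (M j).+1) ((e k)%:R + sigma al k))).
        rewrite [leLHS]big_nat [leRHS]big_nat; apply: ler_sum => k /andP[k0 _].
        have := sigma_gt0 al k0; have := @sigma_le1 R al k (ltW al_gt0) k0.
        by rewrite /c; case: (e k) => /=; nra.
      rewrite big_split/= -/(Ehits al (M j)) -natr_sum -/(hits e (M j)).
      by have := W0 j; lra.
    have := second_moment_le mpT (mh j) (hC j) c3 H2.
    have corr : \sum_(1 <= i < M j) mean mu (fun y => h j y * h j (iter i T y)) <=
        2 * lam * (M j)%:R * mean mu f.
      have ihh i : intg mu (fun y => h j y * h j (iter i T y)).
        apply: (@intg_bounded _ _ _ mu _ (r ^+ j * r ^+ j)).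
          by apply: measurable_funM => //; exact: (measurable_comp_iter mpT).
        by move=> y; rewrite ger0_norm ?mulr_ge0// ler_pM.
      rewrite -mean_sum// -meanZ//; apply: mean_le => [||y]; first exact: intg_sum.
        exact: intgZ.
      rewrite -mulr_sumr {1}/h.
      case: (leP (\sum_(0 <= k < M j) f (iter k T y))) => H; last first.
        by rewrite mulr0 mul0r !mulr_ge0// ltW.
      rewrite mulr1 mulrC; apply: ler_pM => //.
      - by apply: sumr_ge0.
      - by rewrite mulr_ge0.
      - apply: le_trans H; case: (M j) (M0 j) => // m _.
        rewrite [leRHS]big_nat_recl//= big_add1/=.
        by rewrite -[leLHS]add0r lerD// ; apply: ler_sum.
      by rewrite ler_piMr// lern1 leq_b1.
    have mh2 : mean mu (fun y => h j y ^+ 2) <= r ^+ j * B1 j.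
      have ih2 : intg mu (fun y => h j y ^+ 2).
        apply: (@intg_bounded _ _ _ mu _ (r ^+ j ^+ 2)); first exact: measurable_funX.
        by move=> y; rewrite normrX ger0_norm// lerXn2r// nnegrE// ltW.
      rewrite -meanZ//; apply: mean_le => // [|y]; first exact: intgZ.
      rewrite [leRHS]mulrCA [r ^+ j * _]mulrC divfK ?gt_eqF//.
      apply: (@le_trans _ _ (f y * h j y)); first by rewrite expr2 ler_wpM2r.
      rewrite ler_wpM2l// /h -[leRHS]mulr1 ler_wpM2l ?mulr_ge0//.
      by rewrite lern1 leq_b1.
    set m2 := mean mu _ in mh2 *; set S := \sum_(1 <= i < M j) _ in corr * => H3.
    set V := (Ehits al (M j))^-1.
    have V0 : 0 < V by rewrite invr_gt0.
    have VW : V * Ehits al (M j) = 1 by rewrite mulVf// gt_eqF.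
    have Vr : V * r ^+ j <= 1 by rewrite -VW ler_pM2l.
    apply: (@le_trans _ _ (3 * (V * m2) + 2 * (V ^+ 2 * ((M j)%:R `^ (3 / 2 * g) * S)))).
      have := ler_wpM2l (sqr_ge0 V) H3.
      have -> : V ^+ 2 * (3 * Ehits al (M j) * m2 + 2 * ((M j)%:R `^ (3 / 2 * g) * S)) =
        3 * (V * m2) * (V * Ehits al (M j)) + 2 * (V ^+ 2 * ((M j)%:R `^ (3 / 2 * g) * S)) by
            ring.
      by rewrite VW mulr1.
    apply: lerD.
      rewrite ler_wpM2l//; apply: (@le_trans _ _ (V * (r ^+ j * B1 j))); first by rewrite
          ler_wpM2l// ltW.
      by rewrite mulrA ler_piMl.
    apply: (@le_trans _ _ (2 * (V ^+ 2 * ((M j)%:R `^ (3 / 2 * g) * (2 * lam * (M j)%:R * mean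
        mu f))))).
      by rewrite ler_wpM2l// ler_wpM2l ?sqr_ge0// ler_wpM2l ?powR_ge0.
    have -> : 2 * (V ^+ 2 * ((M j)%:R `^ (3 / 2 * g) * (2 * lam * (M j)%:R * mean mu f))) =
       4 * lam * mean mu f * (V ^+ 2 * ((M j)%:R `^ (3 / 2 * g) * (M j)%:R)) by ring.
    rewrite ler_wpM2l ?mulr_ge0 ?(ltW lam0)// qE.
    have -> : (M j)%:R `^ (3 / 2 * g) * (M j)%:R = (M j)%:R `^ (- (g / 2)) * (r ^+ j) ^+ 2 :> R.
      rewrite rE -[X in _ * X = _]powRr1// expr2 -!powRD_nat//; congr (_ `^ _).
      by rewrite /g; field.
    rewrite mulrCA ler_piMr ?powR_ge0// -exprMn exprn_ile1//.
    by rewrite mulr_ge0// ltW.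
  have : {ae mu, forall y, forall eps, 0 < eps -> \forall j \near \oo, g2 (j0 + j)%N y <= eps}.
    apply: (@ae_cvg0_of_summable_mean _ _ _ mu _
      (3 * (r / (r - 1) * mean mu f) + 4 * lam * mean mu f * (1 - q)^-1)) => //.
      by move=> j y; rewrite mulr_ge0// sqr_ge0.
    move=> J.
    pose F j := 3 * B1 j + 4 * lam * mean mu f * q ^+ j.
    have /andP[q0 _] := q01.
    have F0 j : 0 <= F j by rewrite addr_ge0 ?mulr_ge0 ?exprn_ge0 ?(ltW lam0) ?(ltW q0).
    apply: (@le_trans _ _ (\sum_(j < J) F (j0 + j)%N)).
      by apply: ler_sum => j _; apply: bound; exact: leq_addr.
    apply: (le_trans (sum_shift_le j0 J F0)); rewrite /F big_split/= -!mulr_sumr lerD//.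
      rewrite ler_wpM2l// -(meanZ _ intf) -mean_sum//.
      apply: mean_le => [||y]; first exact: intg_sum.
        exact: intgZ.
      by rewrite -mulr_sumr mulrC ler_wpM2r// geometric_sum_ge.
    by rewrite ler_wpM2l ?mulr_ge0 ?(ltW lam0)// geometric_sum_le.
  by apply: filterS => y H; apply: (near_shift (j0 := j0)); apply: H; rewrite exprn_gt0.
move: g1_ae g2_ae; apply: filterS2 => y g1y g2y fy.
have avg n : \sum_(1 <= k < n.+1) f (iter k T y) <= 2 * lam * n%:R.
  case: n => [|n]; first by rewrite big_geq// mulr0.
  apply: (@le_trans _ _ (\sum_(0 <= k < n.+2) f (iter k T y))).
    by rewrite [leRHS]big_nat_recl//= big_add1/= lerDr.
  apply: (le_trans (fy _)); rewrite -[n.+2%:R]natr1 mulrDr mulr1.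
  have : lam <= lam * n.+1%:R by rewrite ler_peMr ?ler1n// ltW.
  lra.
(* At a point with small averages, sampling [f] up to time [M j] amounts to
   sampling its truncation [h j]. *)
have [j1 _ Hj] : \forall j \near \oo,
    \sum_(1 <= k < (M j).+1) (e k)%:R * f (iter k T y) <= 3 * lam * Ehits al (M j).
  near=> j.
  have G1 : g1 j y <= 1 / 2 by near: j.
  have G2 : g2 j y <= lam ^+ 2 by near: j.
  have KW : K j y <= lam * Ehits al (M j).
    rewrite -ler_pdivrMr//; apply: (le_trans (ler_norm _)).
    by rewrite -(@ler_pXn2r _ 2) ?nnegrE ?(ltW lam0)// real_normK ?num_real// exprMn mulrC.
  have hfk k : (0 < k < (M j).+1)%N -> (e k)%:R * f (iter k T y) = (e k)%:R * h j (iter k T y).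
    move=> kM; case ek: (e k); last by rewrite !mul0r.
    rewrite !mul1r /h.
    have -> : (f (iter k T y) <= r ^+ j).
      rewrite leNgt; apply/negP => fr; move: G1; rewrite leNgt => /negP; apply.
      rewrite /g1 (bigD1_seq k)//= ?iota_uniq ?mem_index_iota// ek fr mulr1.
      apply: (@lt_le_trans _ _ 1); first lra.
      by rewrite lerDl; apply: sumr_ge0 => i _; rewrite mulr_ge0.
    have -> : (\sum_(0 <= k0 < M j) f (iter k0 T (iter k T y)) <= 2 * lam * (M j)%:R).
      apply: (@le_trans _ _ (\sum_(0 <= i < M j + M j) f (iter i T y))); last first.
        by apply: (le_trans (fy _)); rewrite natrD; lra.
      have kMj : (k <= M j)%N by case/andP: kM.
      rewrite [leRHS](big_cat_nat (leq0n k) (leq_trans kMj (leq_addr (M j) _)))/=.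
      have kMM : (k + M j <= M j + M j)%N by rewrite leq_add2r.
      rewrite [X in _ <= _ + X](big_cat_nat (leq_addr (M j) k) kMM)/=.
      have -> : \sum_(0 <= k0 < M j) f (iter k0 T (iter k T y)) = \sum_(k <= i < k + M j) f
          (iter i T y).
        rewrite -{2}[k]add0n big_addn addKn.
        by apply: eq_bigr => i _; rewrite iterD.
      by rewrite addrCA lerDl addr_ge0// sumr_ge0.
    by rewrite !mulr1.
  rewrite (eq_big_nat _ _ hfk).
  have -> : \sum_(1 <= k < (M j).+1) (e k)%:R * h j (iter k T y) =
      K j y + \sum_(1 <= k < (M j).+1) sigma al k * h j (iter k T y).
    by rewrite /K -big_split/=; apply: eq_bigr => k _; rewrite /c; ring.
  have : \sum_(1 <= k < (M j).+1) sigma al k * h j (iter k T y) <= 2 * lam * Ehits al (M j).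
    apply: le_trans (weighted_sum_le _ (ltW al_gt0) avg).
    by apply: ler_sum => k _; rewrite ler_wpM2l// powR_ge0.
  lra.
near=> N.
have [j jJ [jN Nj]] : exists2 j, (maxn j0 j1 <= j)%N & (hits e (M j) <= N)%N /\ (N < hits e (M
    j.+1))%N.
  by near: N; exact: hits_interpolation.
apply: (@le_trans _ _ (\sum_(1 <= n < (hits e (M j.+1)).+1) f (iter (a n) T y))).
  rewrite [leRHS](big_cat_nat (n := N.+1))//=; last by rewrite ltnS ltnW.
  by rewrite lerDl sumr_ge0.
rewrite -(aE (fun _ k => f (iter k T y))).
move: jJ; rewrite geq_max => /andP[jj0 jj1].
apply: (le_trans (Hj j.+1 (leqW jj1))).
have [/andP[H1 _] _] := nearj j jj0.
have H2 : Ehits al (M j.+1) <= 2 * Ehits al (M j).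
  have := @Ehits_ratio _ al al_gt0 (M j) (M j.+1); rewrite M0 leq_pexp2l//= => /(_ isT).
  have -> : (M j.+1)%:R = 2 * (M j)%:R :> R by rewrite /M expnS natrM.
  rewrite mulrA ler_pM2r ?ltr0n// mulrC.
  by [].
have H3 : (hits e (M j))%:R <= N%:R :> R by rewrite ler_nat.
have : Ehits al (M j.+1) <= 4 * N%:R by lra.
move=> /(ler_wpM2l (ltW lam0)); lra.
Unshelve. all: by end_near. Qed.

End System.
End Sampling.

(** * Suprema over finite families of weights *)

Section MaxOverSeq.
Context {R : realType} {I : eqType}.

Lemma bigmax_attained (s : seq I) (F : I -> R) : (forall i, 0 <= F i) -> s != [::] ->
  exists2 i, i \in s & \big[Num.max/0]_(j <- s) F j = F i.
Proof.
move=> F0; elim: s => // i s IH _; rewrite big_cons.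
have [->|/IH [j js ->]] := eqVneq s [::].
  by exists i; rewrite ?mem_head// big_nil max_l.
have [ij|ji] := leP (F i) (F j).
  by exists j; rewrite // in_cons js orbT.
by exists i; rewrite ?mem_head.
Qed.

Lemma le_bigmax_mem (s : seq I) (F : I -> R) i : i \in s ->
  F i <= \big[Num.max/0]_(j <- s) F j.
Proof.
elim: s => // j s IH; rewrite in_cons big_cons le_max => /predU1P[->|/IH ->].
  by rewrite lexx.
by rewrite orbT.
Qed.

Lemma bigmax_ge0 (s : seq I) (F : I -> R) : 0 <= \big[Num.max/0]_(j <- s) F j.
Proof. by elim: s => [|j s IH]; rewrite ?big_nil// big_cons le_max IH orbT. Qed.

End MaxOverSeq.

Section SupremumOverFamily.
Context {R : realType} {d : measure_display} {Y : measurableType d}.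
Context (mu : probability Y R) (T : Y -> Y).
Hypothesis mpT : measure_preserving mu T.

(** Integrate [l2_bound_choice] along orbits of length [M]; the bound does not
    depend on the number of weights. *)
Lemma mean_max_le (s : seq (nat -> R)) (c : (nat -> R) -> nat -> R) (g : Y -> R)
    (G r0 r D : R) M : (0 < M)%N -> s != [::] ->
  measurable_fun setT g -> (forall y, `|g y| <= G) ->
  (forall b, b \in s -> \sum_(1 <= k < M.+1) c b k ^+ 2 <= r0) ->
  (forall b b', b \in s -> b' \in s -> forall j, (0 < j)%N ->
    `|\sum_(1 <= k < (M - j).+1) c b k * c b' (k + j)%N| <= r) ->
  0 < D -> r0 + M%:R * r <= D ->
  intg mu (fun y => \big[Num.max/0]_(b <- s) (\sum_(1 <= k < M.+1) c b k * g (iter k T y)) ^+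
      2) /\
  mean mu (fun y => \big[Num.max/0]_(b <- s) (\sum_(1 <= k < M.+1) c b k * g (iter k T y)) ^+ 2)
    <= 2 * D * G ^+ 2.
Proof.
move=> M0 s0 mg gG c0 c1 D0 rD.
pose U b y := \sum_(1 <= k < M.+1) c b k * g (iter k T y).
pose Q y := \big[Num.max/0]_(b <- s) U b y ^+ 2.
have mgT k : measurable_fun setT (fun y => g (iter k T y)) by exact: (measurable_comp_iter mpT).
have mU b : measurable_fun setT (U b).
  by apply: measurable_sum => k; exact: measurable_funM.
have mQ : measurable_fun setT Q.
  rewrite /Q; elim: (s) => [|b t IH].
    by under eq_fun do rewrite big_nil; exact: measurable_cst.
  under eq_fun do rewrite big_cons.
  by apply: measurable_maxr => //; exact: measurable_funX.
have Q0 y : 0 <= Q y by exact: bigmax_ge0.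
have G0 (y : Y) : 0 <= G by exact: le_trans (normr_ge0 _) (gG y).
have QB y : `|Q y| <= \sum_(b <- s) (\sum_(1 <= k < M.+1) `|c b k| * G) ^+ 2.
  rewrite ger0_norm// /Q; have [b bs ->] := bigmax_attained (fun b => sqr_ge0 (U b y)) s0.
  have B0 b' : 0 <= \sum_(1 <= k < M.+1) `|c b' k| * G.
    by apply: sumr_ge0 => k _; rewrite mulr_ge0// (G0 y).
  apply: (@le_trans _ _ ((\sum_(1 <= k < M.+1) `|c b k| * G) ^+ 2)).
    rewrite -real_normK ?num_real// lerXn2r ?nnegrE ?normr_ge0//.
    apply: (le_trans (ler_norm_sum _ _ _)); apply: ler_sum => k _.
    by rewrite normrM ler_wpM2l.
  rewrite (big_rem b)//= lerDl; apply: sumr_ge0 => b' _; exact: sqr_ge0.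
have iQ : intg mu Q by exact: (intg_bounded mu mQ QB).
split => //.
have ig2 : intg mu (fun y => g y ^+ 2).
  apply: (@intg_bounded _ _ _ mu _ (G ^+ 2)); first exact: measurable_funX.
  by move=> y; rewrite normrX lerXn2r ?nnegrE ?normr_ge0 ?(G0 y).
have pointwise y : \sum_(x < M) Q (iter x T y) <= D * \sum_(z < M + M) g (iter z T y) ^+ 2.
  pose J := {b : nat -> R | b \in s}.
  have ch x : exists b : J, Q (iter x T y) = U (sval b) (iter x T y) ^+ 2.
    have [b bs E] := bigmax_attained (fun b => sqr_ge0 (U b (iter x T y))) s0.
    by exists (exist _ b bs).
  have [io ioE] := choice ch.
  have := @l2_bound_choice R J (fun b k => c (sval b) k) M r0 r D M io (fun z => g (iter z T y)).
  move=> /(_ (fun b => c0 _ (svalP b)) (fun b b' => c1 _ _ (svalP b) (svalP b')) D0 rD).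
  apply: le_trans; apply: ler_sum => x _; rewrite ioE /U.
  by under eq_bigr do rewrite -iterD.
have : mean mu (fun y => \sum_(x < M) Q (iter x T y)) <=
       mean mu (fun y => D * \sum_(z < M + M) g (iter z T y) ^+ 2).
  apply: mean_le => //; first by apply: intg_sum => x; exact: (intg_iter mpT).
  by apply: intgZ; apply: intg_sum => z; exact: (intg_iter mpT z ig2).
rewrite mean_sum => [|x]; last exact: (intg_iter mpT).
rewrite meanZ; last by apply: intg_sum => z; exact: (intg_iter mpT z ig2).
rewrite mean_sum => [|z]; last exact: (intg_iter mpT z ig2).
under eq_bigr do rewrite mean_iter//.
under [in X in _ <= X]eq_bigr do rewrite (mean_iter mpT _ ig2).
rewrite !sumr_const !card_ord => H.
have gG2 : mean mu (fun y => g y ^+ 2) <= G ^+ 2.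
  rewrite -[leRHS](mean_cst mu); apply: mean_le => //; first exact: intg_cst.
  by move=> y; rewrite -real_normK ?num_real// lerXn2r ?nnegrE ?normr_ge0 ?(G0 y).
have Mr : 0 < M%:R :> R by rewrite ltr0n.
rewrite -(ler_pM2l Mr) [leLHS]mulr_natl; apply: (le_trans H).
rewrite -[_ *+ (M + M)]mulr_natl natrD.
move: (mean mu _) gG2 => p pG.
rewrite (_ : M%:R * (2 * D * G ^+ 2) = D * ((M%:R + M%:R) * G ^+ 2)); last by ring.
by rewrite ler_wpM2l ?(ltW D0)// ler_wpM2l// addr_ge0.
Qed.

End SupremumOverFamily.

(** * Functions with uniformly null averages *)

Section WeightedAverages.
Context {R : realType} (al : R) (e : nat -> bool) (fam : nat -> seq (nat -> R)).
Hypotheses (al_gt0 : 0 < al) (al_lt : al < 1 / 2) (e_good : good al fam e).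
Variable a : nat -> nat.
Hypothesis aE : forall (phi : nat -> nat -> R) m,
  \sum_(1 <= k < m.+1) (e k)%:R * phi (hits e k) k =
  \sum_(1 <= n < (hits e m).+1) phi n (a n).
Variable Bs : set (nat -> R).
Hypothesis Bs_bounded : forall b n, Bs b -> (0 < n)%N -> `|b n| <= 1.
Hypothesis fam_bounded : forall M b n, b \in fam M -> (0 < n)%N -> `|b n| <= 1.
Hypothesis fam_cst1 : \forall M \near \oo, (fun=> 1) \in fam M.
Hypothesis Bs_approx : forall eta, 0 < eta -> \forall M \near \oo, forall b, Bs b ->
  exists2 b0, b0 \in fam M & forall t, (0 < t <= M)%N -> `|b t - b0 t| <= eta.
Hypothesis Bs_mean : forall eta, 0 < eta -> \forall N \near \oo, forall b, Bs b ->
  `|\sum_(1 <= n < N.+1) b n| <= eta * N%:R.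
Context {d : measure_display} {Y : measurableType d} (mu : probability Y R) (T : Y -> Y).
Hypothesis mpT : measure_preserving mu T.

Definition uniformly_null_at (f : Y -> R) (y : Y) : Prop :=
  forall eps, 0 < eps -> \forall N \near \oo, forall b, Bs b ->
    `|\sum_(1 <= n < N.+1) b n * f (iter (a n) T y)| <= eps * N%:R.

Lemma uniformly_null_add f g y : uniformly_null_at f y -> uniformly_null_at g y ->
  uniformly_null_at (fun y => f y + g y) y.
Proof.
move=> nf ng eps eps0; have e2 : 0 < eps / 2 by rewrite divr_gt0.
move: (nf _ e2) (ng _ e2); apply: filterS2 => N Hf Hg b Bb.
have -> : \sum_(1 <= n < N.+1) b n * (f (iter (a n) T y) + g (iter (a n) T y)) =
  \sum_(1 <= n < N.+1) b n * f (iter (a n) T y) + \sum_(1 <= n < N.+1) b n * g (iter (a n) T y).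
  by rewrite -big_split/=; apply: eq_bigr => n _; rewrite mulrDr.
rewrite (le_trans (ler_normD _ _))// (splitr eps) mulrDl lerD//; [exact: Hf|exact: Hg].
Qed.

Lemma invariant_uniformly_null (f : Y -> R) y : (forall y, f (T y) = f y) ->
  uniformly_null_at f y.
Proof.
move=> fT eps eps0.
have fn n : f (iter n T y) = f y by elim: n => // n IH; rewrite iterS fT.
have c0 : 0 < `|f y| + 1 by rewrite ltr_wpDl.
have := Bs_mean (divr_gt0 eps0 c0); apply: filterS => N H b Bb.
under eq_bigr do rewrite fn.
rewrite -mulr_suml normrM; apply: (le_trans (ler_wpM2r (normr_ge0 _) (H b Bb))).
rewrite mulrAC ler_wpM2r// mulrAC ler_pdivrMr// ler_wpM2l ?(ltW eps0)//.
by rewrite lerDl.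
Qed.

Let g : R := 1 / 2 - al.
Let g_gt0 : 0 < g. Proof. by rewrite subr_gt0. Qed.

(** By [mean_max_le] the squares, divided by [Ehits M ^ 2], have means of order
    [M ^ (- g / 2)], which is summable along the lengths [M = (j + 1) ^ p]. *)
Lemma martingale_part_null (f : Y -> R) (D : R) (p : nat) : 4 <= g * p%:R ->
  measurable_fun setT f -> (forall y, `|f y| <= D) ->
  {ae mu, forall y, forall eps, 0 < eps -> \forall j \near \oo,
    forall b, b \in fam (j.+1 ^ p)%N ->
    `|\sum_(1 <= k < (j.+1 ^ p).+1) coef al e b k * f (iter k T y)| <=
      eps * Ehits al (j.+1 ^ p)}.
Proof.
move=> gp mf fD; have [_ _ g3] := e_good.
pose M j := (j.+1 ^ p)%N.
have p0 : (0 < p)%N by case: p gp {M} => //; rewrite mulr0; lra.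
have jM j : (j <= M j)%N.
  by rewrite /M -(prednK p0) expnS (leq_trans (leqnSn j))// leq_pmulr// expn_gt0.
have M0 j : (0 < M j)%N by rewrite expn_gt0.
pose Q j y := \big[Num.max/0]_(b <- fam (M j))
  (\sum_(1 <= k < (M j).+1) coef al e b k * f (iter k T y)) ^+ 2.
pose Q' j y := (Ehits al (M j))^-1 ^+ 2 * Q j y.
have h2 : 0 < 1 / 2 :> R by lra.
have [j0 _ near0] : \forall j \near \oo, intg mu (Q j) /\
    mean mu (Q' j) <= 2 * D ^+ 2 * 4 * (j.+1%:R ^+ 2)^-1.
  near=> j.
  have H1 : (fun=> 1) \in fam (M j) by near: j; exact: (near_subsequence (Q := fun m => (fun=>
      1) \in fam m) jM fam_cst1).
  have H2 : forall b b', b \in fam (M j) -> b' \in fam (M j) -> forall i, (0 < i)%N ->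
      `|\sum_(1 <= k < (M j - i).+1) coef al e b k * coef al e b' (k + i)| <=
        (M j)%:R `^ (3 / 2 * g).
    by near: j; exact: (near_subsequence jM g3).
  have /andP[_ H3] : (1 - 1 / 2) * Ehits al (M j) <= (hits e (M j))%:R <= (1 + 1 / 2) * Ehits
      al (M j).
    by near: j; exact: (near_subsequence jM (near_hits_Ehits al_gt0 al_lt e_good h2)).
  set m := M j in H1 H2 H3 *; have m0 : (0 < m)%N by exact: M0.
  have W0 : 0 < Ehits al m by exact: Ehits_gt0.
  have c3 b : b \in fam m -> \sum_(1 <= k < m.+1) coef al e b k ^+ 2 <= 3 * Ehits al m.
    move=> bf.
    apply: (@le_trans _ _ (\sum_(1 <= k < m.+1) ((e k)%:R + sigma al k))).
      rewrite [leLHS]big_nat [leRHS]big_nat; apply: ler_sum => k /andP[k0 _].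
      have s0 := sigma_gt0 al k0; have s1 := @sigma_le1 R al k (ltW al_gt0) k0.
      rewrite /coef exprMn; apply: (@le_trans _ _ (((e k)%:R - sigma al k) ^+ 2)).
        rewrite ler_piMr ?sqr_ge0// -real_normK ?num_real// exprn_ile1//.
        exact: fam_bounded bf _.
      by move: s0 s1; case: (e k) => /=; move: (sigma al k) => s; nra.
    rewrite big_split/= -/(Ehits al m) -natr_sum -/(hits e m).
    have := H3; lra.
  pose DD : R := 3 * Ehits al m + m%:R * m%:R `^ (3 / 2 * g).
  have DD0 : 0 < DD by rewrite addr_gt0 ?mulr_gt0 ?powR_nat_gt0 ?ltr0n.
  have s0 : fam m != [::] by apply/eqP => E; rewrite E in H1.
  have [iQ mQ] := mean_max_le mpT m0 s0 mf fD c3 H2 DD0 (lexx _).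
  split; first exact: iQ.
  rewrite /Q' meanZ//.
  set V := (Ehits al m)^-1.
  have V0 : 0 < V by rewrite invr_gt0.
  have VW : V * Ehits al m = 1 by rewrite mulVf// gt_eqF.
  have Vm : V * m%:R `^ (1 - al) <= 1 by rewrite -[leRHS]VW ler_pM2l// Ehits_ge.
  pose t : R := m%:R `^ (- (g / 2)).
  have t0 : 0 <= t by exact: powR_ge0.
  have mt1 : V <= t.
    have : m%:R `^ (- (1 - al)) <= t.
      by rewrite /t powR_nat_le// /g; have := al_lt; lra.
    apply: le_trans; rewrite powRN -[leRHS]mul1r ler_pdivlMr ?powR_nat_gt0//.
  have mt2 : V ^+ 2 * (m%:R * m%:R `^ (3 / 2 * g)) <= t.
    have -> : m%:R * m%:R `^ (3 / 2 * g) = t * (m%:R `^ (1 - al)) ^+ 2 :> R.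
      rewrite -[X in X * _]powRr1// /t expr2 -!powRD_nat//; congr (_ `^ _).
      by rewrite /g; field.
    by rewrite mulrCA ler_piMr// -exprMn exprn_ile1// mulr_ge0 ?powR_ge0// ltW.
  have tj : t <= (j.+1%:R ^+ 2)^-1.
    have -> : (j.+1%:R ^+ 2)^-1 = j.+1%:R `^ (- 2) :> R by rewrite powRN powR_mulrn.
    rewrite /t /m /M natrX -powR_mulrn// -powRrM powR_nat_le//.
    by rewrite mulrN lerN2 mulrA ler_pdivlMr// [p%:R * g]mulrC (le_trans _ gp)// -natrM.
  have D2 : 0 <= 2 * D ^+ 2 by rewrite mulr_ge0// sqr_ge0.
  apply: (@le_trans _ _ (V ^+ 2 * (2 * DD * D ^+ 2))); first by rewrite ler_wpM2l ?sqr_ge0.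
  have -> : V ^+ 2 * (2 * DD * D ^+ 2) = 2 * D ^+ 2 * (3 * V * (V * Ehits al m) +
      V ^+ 2 * (m%:R * m%:R `^ (3 / 2 * g))) by rewrite /DD; ring.
  rewrite VW mulr1 -[leRHS]mulrA ler_wpM2l//.
  apply: (@le_trans _ _ (3 * t + t)); first by rewrite lerD// ler_pM2l.
  have -> : 3 * t + t = 4 * t by ring.
  by rewrite ler_wpM2l.
have Q0 j y : 0 <= Q j y by exact: bigmax_ge0.
have : {ae mu, forall y, forall eps, 0 < eps -> \forall j \near \oo, Q' (j0 + j)%N y <= eps}.
  apply: (@ae_cvg0_of_summable_mean _ _ _ mu _ (2 * D ^+ 2 * 4 * 2)) => [j|j y|J].
  - by apply: intgZ; have [] := near0 (j0 + j)%N (leq_addr _ _).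
  - by rewrite mulr_ge0// sqr_ge0.
  have c0 : 0 <= 2 * D ^+ 2 * 4 by rewrite mulr_ge0// mulr_ge0// sqr_ge0.
  apply: (@le_trans _ _ (\sum_(j < J) 2 * D ^+ 2 * 4 * (j.+1%:R ^+ 2)^-1)).
    apply: ler_sum => j _; have [_ /le_trans] := near0 (j0 + j)%N (leq_addr _ _); apply.
    rewrite ler_wpM2l// lef_pV2 ?posrE ?exprn_gt0 ?ltr0n//.
    by rewrite lerXn2r ?nnegrE// ler_nat ltnS leq_addl.
  by rewrite -mulr_sumr ler_wpM2l// sum_invsq_le.
apply: filterS => y Hy eps eps0.
have : \forall j \near \oo, Q' j y <= eps ^+ 2.
  by apply: (near_shift (j0 := j0)); apply: Hy; rewrite exprn_gt0.
apply: filterS => j H b bf.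
have W0 : 0 < Ehits al (M j) by exact: Ehits_gt0.
rewrite -ler_pdivrMr// -(@ler_pXn2r _ 2) ?nnegrE ?divr_ge0 ?(ltW W0) ?(ltW eps0)//.
apply: le_trans H; rewrite exprMn real_normK ?num_real// mulrC ler_wpM2l ?sqr_ge0//.
exact: (@le_bigmax_mem R _ _ (fun b => (\sum_(1 <= k < (M j).+1) coef al e b k * f (iter k T
    y)) ^+ 2)).
Unshelve. all: by end_near. Qed.

(** By [(1 + 1 / (j + 1)) ^ p <= exp (p / (j + 1))]. *)
Lemma near_pow_ratio p (eta : R) : 0 < eta ->
  \forall j \near \oo, (j.+2 ^ p)%:R <= (1 + eta) * (j.+1 ^ p)%:R :> R.
Proof.
move=> eta0; near=> j.
have j0 : 0 < j.+1%:R :> R by rewrite ltr0n.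
have big1 : 2 * p%:R <= j.+1%:R :> R.
  by rewrite (@le_trans _ _ j%:R)// ?ler_nat//; near: j; exact: nbhs_infty_ger.
have big2 : 2 * p%:R / eta <= j.+1%:R.
  by rewrite (@le_trans _ _ j%:R)// ?ler_nat//; near: j; exact: nbhs_infty_ger.
pose x : R := p%:R / j.+1%:R.
have x0 : 0 <= x by rewrite divr_ge0.
have x2 : x <= 1 / 2 by rewrite ler_pdivrMr//; lra.
have xe : 2 * x <= eta.
  by rewrite /x mulrA ler_pdivrMr// [eta * _]mulrC -ler_pdivrMr.
rewrite !natrX -ler_pdivrMr ?exprn_gt0// -expr_div_n.
have -> : j.+2%:R / j.+1%:R = 1 + j.+1%:R^-1 :> R.
  by rewrite -[j.+2%:R]natr1 mulrDl divff ?gt_eqF// mul1r.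
apply: (@le_trans _ _ (expR j.+1%:R^-1 ^+ p)).
  by rewrite lerXn2r ?nnegrE ?addr_ge0 ?invr_ge0 ?expR_ge0// expR_ge1Dx.
rewrite -expRM_natl -/x.
apply: (le_trans (expR_le_quad x2)); rewrite -addrA lerD2l (le_trans _ xe)//.
have quad (z : R) : 0 <= z -> z <= 1 / 2 -> z + 2 * z ^+ 2 <= 2 * z by move=> ? ?; nra.
exact: quad.
Unshelve. all: by end_near. Qed.

(** Along the lengths [M = (j + 1) ^ p] the average splits into its martingale
    part and a part with slowly varying weights, which is summed by parts. *)
Lemma coboundary_uniformly_null (u : Y -> R) (C : R) :
  measurable_fun setT u -> (forall y, `|u y| <= C) ->
  {ae mu, forall y, uniformly_null_at (fun y => u y - u (T y)) y}.
Proof.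
move=> mu_ uC; have [_ g2 _] := e_good.
have ratio (w w' s s' t : R) : (1 - t) * w <= s -> s' <= (1 + t) * w' -> w' <= (1 + t) * w ->
    0 <= w -> 0 <= t -> t <= 1 -> s' - s <= 4 * t * w.
  move=> ws sw ww w0 t0 t1; have t1' : 0 <= 1 + t by rewrite addr_ge0.
  have := ler_wpM2l t1' ww; have := ler_wpM2r w0 (ler_wpM2l t0 t1); lra.
have [y0|noY] := pselect (exists y : Y, True); last first.
  by apply: aeW => y; exfalso; apply: noY; exists y.
have C0 : 0 <= C by have [y _] := y0; exact: le_trans (normr_ge0 _) (uC y).
pose f y := u y - u (T y).
pose D : R := 2 * C.
have D0 : 0 <= D by rewrite mulr_ge0.
have fD y : `|f y| <= D by rewrite (le_trans (ler_normB _ _))// /D mulr2n mulrDl mul1r lerD.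
have mf : measurable_fun setT f.
  apply: measurable_funB => //; apply: measurableT_comp => //.
  by have [] := mpT.
(* The decay [M ^ (- g / 2)] of the martingale part is summable along these lengths. *)
pose p := (Num.truncn (4 / g)).+1.
have gp : 4 <= g * p%:R.
  by rewrite mulrC -ler_pdivrMr// ltW// truncnS_gt.
have p0 : (0 < p)%N by [].
pose M j := (j.+1 ^ p)%N.
have jM j : (j <= M j)%N.
  by rewrite /M -(prednK p0) expnS (leq_trans (leqnSn j))// leq_pmulr// expn_gt0.
have M0 j : (0 < M j)%N by rewrite expn_gt0.
have := martingale_part_null gp mf fD; apply: filterS => y Hy eps eps0.
pose S (b : nat -> R) n := \sum_(1 <= k < n.+1) b k * f (iter (a k) T y).
(* Between two lengths, the bound is [6 * eta] from the shorter one and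
   [8 * eta * D] from the samples in between; the last [eps] makes [eta <= 1]. *)
pose eta := eps / (6 + 8 * D + eps).
have den0 : 0 < 6 + 8 * D + eps by rewrite ltr_wpDl// addr_ge0// mulr_ge0.
have eta0 : 0 < eta by rewrite divr_gt0.
have eta1 : eta <= 1 by rewrite ler_pdivrMr// mul1r lerDr addr_ge0// mulr_ge0.
have etaE : (6 + 8 * D) * eta <= eps.
  rewrite mulrA ler_pdivrMr// mulrC ler_wpM2l ?(ltW eps0)// lerDl ltW//.
have h2 : 0 < 1 / 2 :> R by lra.
have d0 : 0 < eta / (2 * (D + 1)) by rewrite divr_gt0// mulr_gt0// ltr_wpDl.
have parts : \forall m \near \oo, C * (2 + 2 * \sum_(1 <= k < m.+1) sigma al k * (e k)%:R) <=
    eta * Ehits al m.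
  near=> m.
  have m0 : (0 < m)%N by near: m; exact: nbhs_infty_gt.
  have G2 : \sum_(1 <= k < m.+1) sigma al k * (e k)%:R <= (2 + g^-1) * m%:R `^ (2 * g) by near: m.
  have t1 : 1 <= m%:R `^ (2 * g) by rewrite -[leLHS](powRr0 m%:R) powR_nat_le// mulr_ge0// ltW.
  apply: (@le_trans _ _ (C * (2 + 2 * (2 + g^-1)) * m%:R `^ (2 * g))).
    rewrite -[leRHS]mulrA ler_wpM2l// [leRHS]mulrDl.
    by apply: lerD; [rewrite ler_peMr|rewrite -[leRHS]mulrA ler_wpM2l].
  apply: (@le_trans _ _ (eta * m%:R `^ (1 - al))); last by rewrite ler_wpM2l ?(ltW eta0)//
      Ehits_ge.
  have -> : 1 - al = (1 / 2 - g) + 2 * g by rewrite /g; field.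
  rewrite powRD_nat// mulrA ler_wpM2r ?powR_ge0// -ler_pdivrMl//.
  near: m; apply: powR_near_infty.
  by rewrite /g; have := al_gt0; lra.
have [j0 _ H] : \forall j \near \oo,
    (forall b, Bs b -> `|S b (hits e (M j))| <= 3 * eta * Ehits al (M j)) /\
    ((1 - 1 / 2) * Ehits al (M j) <= (hits e (M j))%:R) /\
    ((hits e (M j.+1))%:R - (hits e (M j))%:R <= 4 * eta * Ehits al (M j)).
  have near1 (Q : nat -> Prop) : (\forall m \near \oo, Q m) -> \forall j \near \oo, Q (M j.+1).
    by apply: near_subsequence => j; exact: leq_trans (leqnSn _) (jM j.+1).
  near=> j.
  have W0 : 0 < Ehits al (M j) by exact: Ehits_gt0.
  have A1 : forall b, b \in fam (M j) ->
      `|\sum_(1 <= k < (M j).+1) coef al e b k * f (iter k T y)| <= eta * Ehits al (M j).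
    by near: j; exact: Hy.
  have A2 : C * (2 + 2 * \sum_(1 <= k < (M j).+1) sigma al k * (e k)%:R) <= eta * Ehits al (M j).
    by near: j; exact: (near_subsequence jM parts).
  have A3 : forall b, Bs b -> exists2 b0, b0 \in fam (M j) &
      forall t, (0 < t <= M j)%N -> `|b t - b0 t| <= eta / (2 * (D + 1)).
    by near: j; exact: (near_subsequence jM (Bs_approx d0)).
  have A4 : (1 - 1 / 2) * Ehits al (M j) <= (hits e (M j))%:R <= (1 + 1 / 2) * Ehits al (M j).
    by near: j; exact: (near_subsequence jM (near_hits_Ehits al_gt0 al_lt e_good h2)).
  have A5 : (1 - eta) * Ehits al (M j) <= (hits e (M j))%:R <= (1 + eta) * Ehits al (M j).
    by near: j; exact: (near_subsequence jM (near_hits_Ehits al_gt0 al_lt e_good eta0)).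
  have A6 : (1 - eta) * Ehits al (M j.+1) <= (hits e (M j.+1))%:R <= (1 + eta) * Ehits al (M
      j.+1).
    by near: j; exact: (near1 _ (near_hits_Ehits al_gt0 al_lt e_good eta0)).
  have A7 : (M j.+1)%:R <= (1 + eta) * (M j)%:R :> R by near: j; exact: near_pow_ratio.
  case/andP: A4 => A4 A4'; case/andP: A5 => A5 _; case/andP: A6 => _ A6.
  split; last split => //; last first.
    have Wj : Ehits al (M j.+1) <= (1 + eta) * Ehits al (M j).
      have := @Ehits_ratio _ al al_gt0 (M j) (M j.+1); rewrite M0 /= leq_exp2r// leqnSn => /(_
          isT).
      have Mp : 0 < (M j)%:R :> R by rewrite ltr0n.
      move=> WR; rewrite -(ler_pM2r Mp) (le_trans WR)// mulrAC mulrC.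
      by rewrite ler_pM2r.
    exact: ratio A5 A6 Wj (ltW W0) (ltW eta0) eta1.
  move=> b Bb; have [b0 b0f bb0] := A3 b Bb.
  have B0 : `|S b0 (hits e (M j))| <= 2 * eta * Ehits al (M j).
    rewrite /S -(aE (fun n k => b0 n * f (iter k T y))).
    have -> : \sum_(1 <= k < (M j).+1) (e k)%:R * (b0 (hits e k) * f (iter k T y)) =
        \sum_(1 <= k < (M j).+1) coef al e b0 k * f (iter k T y) +
        \sum_(1 <= k < (M j).+1) sigma al k * b0 (hits e k.-1).+1 * (u (iter k T y) - u (iter
            k.+1 T y)).
      rewrite -big_split/=; apply: eq_big_nat => -[|k]//= _.
      rewrite /coef /= hitsS -/(f _); case: (e k.+1) => /=; last by rewrite /f; ring.
      by rewrite addn1 /f; ring.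
    rewrite (le_trans (ler_normD _ _))// mulr2n mulrDl mulrDl mul1r lerD ?A1//.
    apply: le_trans A2; apply: (@coboundary_sum_le _ al e b0 (fun k => u (iter k T y))) => //.
      exact: ltW.
    by move=> n; exact: fam_bounded b0f.
  have -> : S b (hits e (M j)) = (S b (hits e (M j)) - S b0 (hits e (M j))) + S b0 (hits e (M j)).
    by rewrite subrK.
  rewrite (le_trans (ler_normD _ _))//.
  have -> : 3 * eta * Ehits al (M j) = eta * Ehits al (M j) + 2 * eta * Ehits al (M j) by ring.
  apply: lerD => //.
  rewrite /S -sumrB; apply: (le_trans (ler_norm_sum _ _ _)).
  apply: (@le_trans _ _ (\sum_(1 <= k < (hits e (M j)).+1) eta / (2 * (D + 1)) * D)).
    rewrite [leLHS]big_nat [leRHS]big_nat; apply: ler_sum => k /andP[k0 kh].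
    rewrite -mulrBl normrM ler_pM// bb0// k0/= -ltnS (leq_trans kh)// ltnS.
    exact: hits_le.
  rewrite sumr_const_nat subSS subn0 -[_ *+ hits _ _]mulr_natl.
  apply: (@le_trans _ _ (2 * Ehits al (M j) * (eta / (2 * (D + 1)) * D))).
    apply: ler_wpM2r; first by apply: mulr_ge0 => //; exact: ltW.
    by move: A4' W0; lra.
  have D1 : 0 < D + 1 by rewrite ltr_wpDl.
  have -> : 2 * Ehits al (M j) * (eta / (2 * (D + 1)) * D) = eta * Ehits al (M j) * (D / (D + 1)).
    by field; rewrite gt_eqF.
  rewrite ler_piMr//; first by apply: mulr_ge0; exact: ltW.
  by rewrite ler_pdivrMr// mul1r lerDl.
near=> N => b Bb.
have [j jJ [jN Nj]] : exists2 j, (j0 <= j)%N & (hits e (M j) <= N)%N /\ (N < hits e (M j.+1))%N.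
  by near: N; exact: (hits_interpolation al_gt0 al_lt e_good j0 jM).
have [H1 [H2 H3]] := H j jJ.
have -> : \sum_(1 <= n < N.+1) b n * (u (iter (a n) T y) - u (T (iter (a n) T y))) =
   S b (hits e (M j)) + \sum_((hits e (M j)).+1 <= n < N.+1) b n * f (iter (a n) T y).
  by rewrite /S -big_cat_nat.
rewrite (le_trans (ler_normD _ _))//.
have tail : `|\sum_((hits e (M j)).+1 <= n < N.+1) b n * f (iter (a n) T y)| <=
    ((hits e (M j.+1))%:R - (hits e (M j))%:R) * D.
  apply: (le_trans (ler_norm_sum _ _ _)).
  apply: (@le_trans _ _ (\sum_((hits e (M j)).+1 <= n < N.+1) D)).
    rewrite [leLHS]big_nat [leRHS]big_nat; apply: ler_sum => n /andP[hn _].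
    rewrite normrM -[leRHS]mul1r ler_pM// Bs_bounded//.
    exact: leq_ltn_trans hn.
  rewrite sumr_const_nat subSS -[_ *+ _]mulr_natl ler_wpM2r// natrB// lerB//.
  by rewrite ler_nat ltnW.
have hN : (hits e (M j))%:R <= N%:R :> R by rewrite ler_nat.
apply: (le_trans (lerD (H1 b Bb) tail)).
apply: (@le_trans _ _ ((6 + 8 * D) * eta * N%:R)); last by rewrite ler_wpM2r.
have W2 : Ehits al (M j) <= 2 * N%:R by move: H2 hN; lra.
have T1 := ler_wpM2r D0 H3.
have De : 0 <= D * eta by rewrite mulr_ge0// ltW.
have T2 := ler_wpM2l (ltW eta0) W2.
have T3 := ler_wpM2l De W2.
by move: T1 T2 T3; move: (D) (eta) (Ehits al (M j)) (N%:R : R) ((hits e (M j.+1))%:R - _ : R)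
    => x t w n z; lra.
Unshelve. all: by end_near. Qed.

(** The functions with uniformly null averages are closed in [L^1]: the
    sampled averages of a small error [r] are controlled pointwise by its
    ergodic maximal function. *)
Lemma closure_uniformly_null (f : Y -> R) :
  (forall eps, 0 < eps -> exists f1 r : Y -> R,
    [/\ forall y, f y = f1 y + r y, {ae mu, forall y, uniformly_null_at f1 y},
        intg mu r & mean mu (fun y => `|r y|) <= eps]) ->
  {ae mu, forall y, uniformly_null_at f y}.
Proof.
move=> Hf.
(* At almost every point and for each [n], some error [r n i] has ergodic
   maximal function at most [lam n]. *)
pose lam (n : nat) : R := n.+1%:R^-1.
have lam0 n : 0 < lam n by rewrite invr_gt0.
have eps0 n i : 0 < lam n / i.+1%:R by rewrite divr_gt0.
have ch ni : exists fr : (Y -> R) * (Y -> R),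
    [/\ forall y, f y = fr.1 y + fr.2 y, {ae mu, forall y, uniformly_null_at fr.1 y},
        intg mu fr.2 & mean mu (fun y => `|fr.2 y|) <= lam ni.1 / ni.2.+1%:R].
  by have [f1 [r H]] := Hf _ (eps0 ni.1 ni.2); exists (f1, r).
have {Hf ch} [F' HF'] := choice ch.
pose F n i := F' (n, i); have HF n i := HF' (n, i).
pose r n i y := `|(F n i).2 y|.
have ir n i : intg mu (r n i) by have [_ _ ? _] := HF n i; exact: intg_norm.
have r0 n i y : 0 <= r n i y by exact: normr_ge0.
have rm n i : mean mu (r n i) <= lam n / i.+1%:R by have [] := HF n i.
have A1 : {ae mu, forall y, forall n i, uniformly_null_at (F n i).1 y}.
  by apply: ae_foralln => n; apply: ae_foralln => i; have [] := HF n i.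
have A2 : {ae mu, forall y, forall n i,
    (forall m, \sum_(0 <= k < m) r n i (iter k T y) <= lam n * m%:R) ->
    \forall N \near \oo, \sum_(1 <= m < N.+1) r n i (iter (a m) T y) <= 12 * lam n * N%:R}.
  apply: ae_foralln => n; apply: ae_foralln => i.
  exact: (sampled_average_le al_gt0 al_lt e_good aE mpT fam_cst1).
have A3 : {ae mu, forall y, forall n, exists i, forall m,
    \sum_(0 <= k < m) r n i (iter k T y) <= lam n * m%:R}.
  apply: ae_foralln => n.
  have mE i K : measurable (exceed T (r n i) (lam n) K).
    by apply: (measurable_exceed mpT); exact: intg_measurable (ir n i).
  pose E i := \bigcup_K exceed T (r n i) (lam n) K.
  have mEi i : measurable (E i) by exact: bigcupT_measurable.
  have Emu i : (mu (E i) <= (i.+1%:R^-1)%:E)%E.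
    have nd : nondecreasing_seq (exceed T (r n i) (lam n)).
      move=> K L KL; apply/subsetPset => y [m /andP[m0 mK] H].
      by exists m => //; rewrite m0 (leq_trans mK).
    have cv := nondecreasing_cvg_mu (mu := mu) (mE i) (mEi i) nd.
    rewrite -(cvg_lim _ cv)//; apply: lime_le; first exact: cvgP cv.
    apply: nearW => K /=.
    have := maximal_inequality mpT K (ir n i) (r0 n i) (ltW (lam0 n)).
    rewrite muleC -lee_pdivlMr//; move/le_trans; apply.
    by rewrite -EFinM lee_fin ler_pdivrMr// mulrC.
  exists (\bigcap_i E i); split.
  - exact: bigcapT_measurable.
  - apply/eqP; rewrite eq_le measure_ge0 andbT; apply/lee_addgt0Pr => eps eps_gt0.
    rewrite add0e.
    have [i _ Hi] : \forall i \near \oo, eps^-1 <= i%:R by exact: nbhs_infty_ger.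
    apply: (@le_trans _ _ (mu (E i))).
      by apply: le_measure; rewrite ?inE//; [exact: bigcapT_measurable|exact: bigcap_inf].
    apply: (le_trans (Emu i)); rewrite lee_fin -[leRHS]invrK lef_pV2 ?posrE ?invr_gt0 ?ltr0n//.
    by rewrite (le_trans (Hi i (leqnn i)))// ler_nat.
  move=> y /= ny i _; apply: contrapT => nE; apply: ny; exists i => m.
  rewrite leNgt; apply/negP => H; apply: nE; exists m => //; exists m => //.
  by rewrite leqnn andbT lt0n; apply/eqP => m0; move: H; rewrite m0 big_geq// mulr0 ltxx.
move: A1 A2 A3; apply: filterS3 => y H1 H2 H3 eps eps_gt0.
have [n _ Hn] : \forall n \near \oo, 13 / eps <= n%:R :> R by exact: nbhs_infty_ger.
have ln : 13 * lam n <= eps.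
  rewrite /lam ler_pdivrMr// mulrC -ler_pdivrMr//.
  by rewrite (le_trans (Hn n (leqnn n)))// ler_nat.
have [i Hi] := H3 n.
move: (H1 n i _ (lam0 n)) (H2 n i Hi); apply: filterS2 => N K1 K2 b Bb.
have [fE _ _ _] := HF n i.
have -> : \sum_(1 <= m < N.+1) b m * f (iter (a m) T y) =
    \sum_(1 <= m < N.+1) b m * (F n i).1 (iter (a m) T y) +
    \sum_(1 <= m < N.+1) b m * (F n i).2 (iter (a m) T y).
  by rewrite -big_split/=; apply: eq_bigr => m _; rewrite fE mulrDr.
rewrite (le_trans (ler_normD _ _))//.
apply: (@le_trans _ _ (13 * lam n * N%:R)); last by rewrite ler_wpM2r.
have -> : 13 * lam n * N%:R = lam n * N%:R + 12 * lam n * N%:R by ring.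
rewrite lerD ?K1//; apply: le_trans K2.
apply: (le_trans (ler_norm_sum _ _ _)); rewrite [leLHS]big_nat [leRHS]big_nat.
apply: ler_sum => m /andP[m0 _].
by rewrite normrM ler_piMl// Bs_bounded.
Qed.

(** Bounded functions are limits in [L^1] of invariant functions plus coboundaries. *)
Lemma bounded_uniformly_null (f : Y -> R) (C : R) :
  measurable_fun setT f -> (forall y, `|f y| <= C) ->
  {ae mu, forall y, uniformly_null_at f y}.
Proof.
move=> mf fC; apply: closure_uniformly_null => eps eps0.
have [n [u [D [mu_ uD uE Hn]]]] := invariant_coboundary_approx mpT mf fC eps0.
exists (fun y => upper_average T f y + (u y - u (T y))).
exists (fun y => time_average T f n y - upper_average T f y); split => //.
- by move=> y; rewrite -uE; ring.
- apply: filterS (coboundary_uniformly_null mu_ uD) => y nu.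
  apply: uniformly_null_add nu; apply: invariant_uniformly_null => z.
  exact: upper_average_invariant fC.
apply: intgB.
  apply: (intg_bounded mu (measurable_time_average mpT n mf)) => y.
  exact: time_average_bound fC.
apply: (intg_bounded mu (measurable_upper_average mpT mf fC)) => y.
exact: upper_average_bound fC.
Qed.

(** Truncation: bounded functions are dense in [L^1]. *)
Lemma integrable_uniformly_null (f : Y -> R) : intg mu f ->
  {ae mu, forall y, uniformly_null_at f y}.
Proof.
move=> intf; apply: closure_uniformly_null => eps eps0.
have mf := intg_measurable intf.
have mnf : measurable_fun setT (fun y => `|f y|) by exact: measurableT_comp.
pose ind (n : nat) y : R := \1_[set y | n%:R < `|f y|] y.
have mind n : measurable_fun setT (ind n).
  by apply: measurable_indic; exact: measurable_gt_cst.
have ind01 n y : 0 <= ind n y <= 1 by rewrite /ind indicE lern1 leq_b1 ler0n.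
pose t n y := `|f y| * ind n y.
have tf n y : `|t n y| <= `|f y|.
  have /andP[i0 i1] := ind01 n y.
  by rewrite ger0_norm ?mulr_ge0// ler_piMr.
have mt n : measurable_fun setT (t n) by exact: measurable_funM.
have it n : intg mu (t n) by exact: (intg_le (mt n) (tf n) (intg_norm intf)).
have mt' n : measurable_fun setT (EFin \o t n) by exact/measurable_EFinP.
have cv : {ae mu, forall y, setT y -> EFin (t n y) @[n --> \oo] --> (EFin \o (fun=> 0)) y}.
  apply: aeW => y _; apply/fine_cvgP; split; first exact: nearW.
  apply: cvg_near_cst; near=> n; rewrite /= /t /ind indicE memNset ?mulr0//=.
  by apply/negP; rewrite -leNgt; near: n; exact: nbhs_infty_ger.
have m0 : measurable_fun setT (EFin \o (fun=> 0 : R) : Y -> \bar R) by exact: measurable_cst.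
have dom : {ae mu, forall y, forall n, setT y -> (`|(EFin \o t n) y| <= (EFin \o (fun z => `|f
    z|%R)) y)%E}.
  by apply: aeW => y n _; rewrite /= lee_fin.
have [_ _] := dominated_convergence measurableT mt' m0 cv (intg_norm intf) dom.
rewrite [X in _ --> X](_ : _ = 0%E); last exact: integral0.
move=> /fine_cvgP[_ /cvgrPdist_le /(_ _ eps0)] [n _ /(_ n (leqnn _)) /= H].
pose f1 y := f y * (1 - ind n y).
pose r y := f y * ind n y.
have mr : measurable_fun setT r by exact: measurable_funM.
have rE y : `|r y| = t n y by rewrite /r normrM [X in _ * X]ger0_norm//; case/andP: (ind01 n y).
exists f1, r; split.
- by move=> y; rewrite /f1 /r; ring.
- apply: (@bounded_uniformly_null f1 n%:R).
    by apply: measurable_funM => //; apply: measurable_funB => //; exact: measurable_cst.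
  move=> y; rewrite /f1 /ind indicE; case: (boolP (y \in _)) => /=.
    by rewrite subrr mulr0 normr0.
  by rewrite notin_setE /= => /negP; rewrite -leNgt subr0 mulr1.
- by apply: (intg_le mr _ (it n)) => y; rewrite rE.
move: H; rewrite sub0r normrN; apply: le_trans.
rewrite (@mean_eq _ _ _ mu _ _ rE); exact: ler_norm.
Unshelve. all: by end_near. Qed.

End WeightedAverages.

(** * Complex weights and functions *)

Section ComplexParts.
Context {R : realType}.
Implicit Types (z : R[i]).

Lemma cmodE z : cmod z = Num.sqrt (complex.Re z ^+ 2 + complex.Im z ^+ 2).
Proof. by case: z. Qed.

Lemma Re_le_cmod z : `|complex.Re z| <= cmod z.
Proof. by rewrite cmodE -sqrtr_sqr ler_wsqrtr// lerDl sqr_ge0. Qed.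

Lemma Im_le_cmod z : `|complex.Im z| <= cmod z.
Proof. by rewrite cmodE -sqrtr_sqr ler_wsqrtr// lerDr sqr_ge0. Qed.

Lemma cmod_le z : cmod z <= `|complex.Re z| + `|complex.Im z|.
Proof.
rewrite cmodE -[leRHS]ger0_norm ?addr_ge0// -sqrtr_sqr ler_wsqrtr//.
rewrite sqrrD !real_normK ?num_real// lerD2r lerDl.
by rewrite mulrn_wge0// mulr_ge0.
Qed.

Lemma ReD z1 z2 : complex.Re (z1 + z2) = complex.Re z1 + complex.Re z2.
Proof. by case: z1 z2 => [? ?] [? ?]. Qed.

Lemma ImD z1 z2 : complex.Im (z1 + z2) = complex.Im z1 + complex.Im z2.
Proof. by case: z1 z2 => [? ?] [? ?]. Qed.

Lemma ReB z1 z2 : complex.Re (z1 - z2) = complex.Re z1 - complex.Re z2.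
Proof. by case: z1 z2 => [? ?] [? ?]. Qed.

Lemma ImB z1 z2 : complex.Im (z1 - z2) = complex.Im z1 - complex.Im z2.
Proof. by case: z1 z2 => [? ?] [? ?]. Qed.

Lemma ReM z1 z2 : complex.Re (z1 * z2) =
  complex.Re z1 * complex.Re z2 - complex.Im z1 * complex.Im z2.
Proof. by case: z1 z2 => [? ?] [? ?]. Qed.

Lemma ImM z1 z2 : complex.Im (z1 * z2) =
  complex.Re z1 * complex.Im z2 + complex.Im z1 * complex.Re z2.
Proof. by case: z1 z2 => [? ?] [? ?]. Qed.

Lemma Re_sum (u : nat -> R[i]) m n :
  complex.Re (\sum_(m <= k < n) u k) = \sum_(m <= k < n) complex.Re (u k).
Proof. by apply: (big_morph _ ReD); rewrite //. Qed.

Lemma Im_sum (u : nat -> R[i]) m n :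
  complex.Im (\sum_(m <= k < n) u k) = \sum_(m <= k < n) complex.Im (u k).
Proof. by apply: (big_morph _ ImD); rewrite //. Qed.

Lemma Re_average (u : nat -> R[i]) N : complex.Re (average u N) =
  N%:R^-1 * \sum_(1 <= k < N.+1) complex.Re (u k).
Proof.
rewrite /average -Re_sum.
rewrite (_ : (N%:R^-1 : R[i]) = real_complex R N%:R^-1); last by rewrite fmorphV rmorph_nat.
by rewrite ReM /= mul0r subr0.
Qed.

Lemma Im_average (u : nat -> R[i]) N : complex.Im (average u N) =
  N%:R^-1 * \sum_(1 <= k < N.+1) complex.Im (u k).
Proof.
rewrite /average -Im_sum.
rewrite (_ : (N%:R^-1 : R[i]) = real_complex R N%:R^-1); last by rewrite fmorphV rmorph_nat.
by rewrite ImM /= mul0r addr0.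
Qed.

Definition real_parts (B : set (nat -> R[i])) : set (nat -> R) :=
  [set b' | exists2 b, B b &
     b' = (fun n => complex.Re (b n)) \/ b' = (fun n => complex.Im (b n))].

Lemma sup_modulus_le (B : set (nat -> R[i])) F (x : R) :
  (forall b, B b -> cmod (F b) <= x) -> (sup_modulus B F <= x%:E)%E.
Proof. by move=> H; apply: ge_ereal_sup => _ [b Bb <-]; rewrite lee_fin H. Qed.

Lemma sup_modulus_ge (B : set (nat -> R[i])) F b :
  B b -> ((cmod (F b))%:E <= sup_modulus B F)%E.
Proof. by move=> Bb; apply: ereal_sup_ubound; exists b. Qed.

Lemma cmod_ge0 z : 0 <= cmod z.
Proof. by rewrite cmodE sqrtr_ge0. Qed.

Lemma sup_modulus_cvg0P (B : set (nat -> R[i])) (F : nat -> (nat -> R[i]) -> R[i]) b0 : B b0 ->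
  sup_modulus B (F N) @[N --> \oo] --> 0%E <->
  forall eps : R, 0 < eps -> \forall N \near \oo, forall b, B b -> cmod (F N b) <= eps.
Proof.
move=> Bb0.
have ge0 N : (0 <= sup_modulus B (F N))%E.
  by apply: le_trans (sup_modulus_ge _ Bb0); rewrite lee_fin cmod_ge0.
split=> [/fine_cvgP[fin /cvgrPdist_le H] eps eps0|H].
  move: fin (H _ eps0); apply: filterS2 => N finN; rewrite sub0r normrN => HN b Bb.
  rewrite -lee_fin (le_trans (sup_modulus_ge (F N) Bb))// -(fineK finN) lee_fin.
  exact: le_trans (ler_norm _) HN.
have bd eps : 0 < eps -> \forall N \near \oo, (sup_modulus B (F N) <= eps%:E)%E.
  by move=> /H; apply: filterS => N; exact: sup_modulus_le.
apply/fine_cvgP; split.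
  apply: filterS (bd 1 ltr01) => N H1.
  by rewrite ge0_fin_numE// (le_lt_trans H1)// ltry.
apply/cvgrPdist_le => eps eps0; apply: filterS (bd _ eps0) => N HN.
rewrite sub0r normrN ger0_norm ?fine_ge0//.
by rewrite -lee_fin fineK// ge0_fin_numE// (le_lt_trans HN)// ltry.
Qed.

End ComplexParts.

Section FiniteFamilies.
Context {R : realType} (B : set (nat -> R[i])) (delta : R).
Hypotheses (B_bounded : forall b n, B b -> (1 <= n)%N -> cmod (b n) <= 1).

(** The constant weight [1] is added to the real and imaginary parts: its
    correlations control the unweighted sampled averages. *)
Lemma approximating_families : 0 < delta -> approximable B ->
  exists (fam : nat -> seq (nat -> R)) (C : R),
  [/\ \forall M \near \oo, (size (fam M))%:R <= C * expR (M%:R `^ delta),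
      forall M b, b \in fam M -> forall n, (0 < n)%N -> `|b n| <= 1,
      forall M, (fun=> 1) \in fam M &
      forall eta, 0 < eta -> \forall M \near \oo, forall b, real_parts B b ->
        exists2 b0, b0 \in fam M & forall t, (0 < t <= M)%N -> `|b t - b0 t| <= eta].
Proof.
move=> d0 /(_ _ d0) [kappa [k0 [Cd [Ck H]]]].
pose good_BN N (BN : set (nat -> R[i])) := [/\ BN `<=` B, finite_set BN,
  (#|` fset_set BN|)%fset%:R <= Cd * expR (N%:R `^ delta) &
  forall b, B b -> exists2 b0, BN b0 & forall t, (1 <= t <= N)%N ->
    cmod (b t - b0 t) <= Ck * N%:R `^ (- kappa)].
(* The default [set0] keeps the bound on the weights valid for small [N]. *)
pose BN N := xget set0 (good_BN N).
have BN_sub N : BN N `<=` B by rewrite /BN; case: xgetP => [S _ []|_].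
pose re (b : nat -> R[i]) n := complex.Re (b n).
pose im (b : nat -> R[i]) n := complex.Im (b n).
pose fam N := (fun=> 1 : R) :: [seq re b | b <- fset_set (BN N)] ++ [seq im b | b <- fset_set
    (BN N)].
have BN_good : \forall N \near \oo, good_BN N (BN N).
  by move: H; apply: filterS => N [S HS]; rewrite /BN; exact: (xgetPex set0 (ex_intro _ S HS)).
exists fam, (1 + 2 * `|Cd|); split.
- apply: filterS BN_good => M [_ _ sz _].
  rewrite /fam /= size_cat !size_map -natr1 natrD.
  have e1 : 1 <= expR (M%:R `^ delta) :> R by rewrite -[leLHS]expR0 ler_expR powR_ge0.
  have {}sz : (size (fset_set (BN M)))%:R <= `|Cd| * expR (M%:R `^ delta).
    by rewrite (le_trans sz)// ler_wpM2r ?expR_ge0// ler_norm.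
  rewrite mulrDl mul1r addrC lerD// -mulrA [leRHS]mulrDl mul1r.
  by rewrite lerD.
- move=> M b; rewrite in_cons mem_cat => /predU1P[-> n _|]; first by rewrite normr1.
  have inB c : c \in fset_set (BN M) -> B c.
    move=> cB; apply: (BN_sub M); have [fS|nfS] := pselect (finite_set (BN M)).
      by move: cB; rewrite in_fset_set// inE.
    by move: cB; rewrite /fset_set; case: pselect.
  move=> /orP[] /mapP[c /inB Bc ->] n n0.
    by apply: le_trans (Re_le_cmod _) _; exact: B_bounded.
  by apply: le_trans (Im_le_cmod _) _; exact: B_bounded.
- by move=> M; rewrite mem_head.
move=> eta eta0.
have small : \forall M \near \oo, Ck * M%:R `^ (- kappa) <= eta.
  near=> M; have : M%:R `^ (- kappa) <= eta / (`|Ck| + 1).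
    by near: M; apply: powR_near_infty0 => //; rewrite divr_gt0// ltr_wpDl.
  rewrite ler_pdivlMr ?ltr_wpDl// => h; apply: le_trans h.
  rewrite mulrC ler_wpM2l ?powR_ge0//.
  by rewrite (le_trans (ler_norm _))// lerDl.
move: BN_good small; apply: filterS2 => M [_ fS _ appr] sm b [c Bc cE].
have [c0 c0S Hc0] := appr c Bc.
have c0f : c0 \in fset_set (BN M) by rewrite in_fset_set// inE.
case: cE => ->.
- exists (re c0); first by rewrite in_cons mem_cat map_f ?orbT.
  move=> t tM; apply: le_trans sm; apply: le_trans (Hc0 t tM).
  by rewrite /re -ReB Re_le_cmod.
- exists (im c0); first by rewrite in_cons mem_cat [X in _ || (_ || X)]map_f ?orbT.
  move=> t tM; apply: le_trans sm; apply: le_trans (Hc0 t tM).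
  by rewrite /im -ImB Im_le_cmod.
Unshelve. all: by end_near. Qed.

End FiniteFamilies.

(** * The theorem *)

Theorem mainTheorem2 (R : realType) (d : measure_display)
    (Omega : measurableType d) (P : probability Omega R)
    (alpha : R) (alpha_gt0 : 0 < alpha) (alpha_lt : alpha < 1 / 2)
    (X : nat -> {RV P >-> R})
    (X_01 : forall n w, (1 <= n)%N -> X n w = 0 \/ X n w = 1)
    (X_indep : mutually_independent [set n | (1 <= n)%N] X)
    (X_mean : forall n, (1 <= n)%N ->
      ('E_P[X n] = (n%:R `^ (- alpha))%:E)%E)
    (B : set (nat -> R[i]))
    (B_approx : approximable B)
    (B_bounded : forall b n, B b -> (1 <= n)%N -> cmod (b n) <= 1)
    (B_mean : sup_modulus B (fun b => average b N) @[N --> \oo] --> 0%E) :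
  {ae P, forall w,
    forall (d' : measure_display) (Y : measurableType d')
      (mu : probability Y R) (T : Y -> Y) (f : Y -> R[i]),
    measure_preserving mu T ->
    complex_integrable mu f ->
    {ae mu, forall y,
      sup_modulus B (fun b =>
        average (fun n =>
          b n * f (iter (counting_function (fun k => X k w) n) T y)) N)
        @[N --> \oo] --> 0%E}}.
Proof.
(* The supremum over an empty family is -oo, which does not tend to 0. *)
have Bne : exists b, B b.
  apply: contrapT => nB.
  have E N : sup_modulus B (fun b => average b N) = -oo%E.
    rewrite /sup_modulus (_ : [set _ | _ in _] = set0) ?ereal_sup0//.
    by apply/seteqP; split => // x [b Bb _]; apply: nB; exists b.
  by move/fine_cvgP: B_mean => [[n _ H] _]; have := H n (leqnn n); rewrite /= E.
have [b0 Bb0] := Bne.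
have delta0 : 0 < (1 / 2 - alpha) / 4 by rewrite divr_gt0// subr_gt0.
have [fam [C [famS famB fam1 famA]]] := approximating_families B_bounded delta0 B_approx.
have := ae_good alpha_gt0 alpha_lt X_01 X_indep X_mean famS famB.
apply: filterS => w gw d' Y mu T f mpT [fre fim].
pose x k := X k w.
have xe k : (0 < k)%N -> x k = (bits X w k)%:R by exact: bitsE.
have aE := sum_counting xe.
have RB1 b n : real_parts B b -> (0 < n)%N -> `|b n| <= 1.
  move=> [c Bc [->|->]] n0; apply: le_trans (B_bounded _ _ Bc n0).
    exact: Re_le_cmod.
  exact: Im_le_cmod.
have RBmean eta : 0 < eta -> \forall N \near \oo, forall b, real_parts B b ->
    `|\sum_(1 <= n < N.+1) b n| <= eta * N%:R.
  move=> eta0; have := (sup_modulus_cvg0P (fun N b => average b N) Bb0).1 B_mean _ eta0.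
  move=> H; near=> N => b [c Bc cE].
  have N0 : (0 < N)%N by near: N; exact: nbhs_infty_gt.
  have HN : forall b, B b -> cmod (average b N) <= eta by near: N.
  have := HN c Bc.
  have Nr : 0 < N%:R :> R by rewrite ltr0n.
  case: cE => ->.
    move=> /(le_trans (Re_le_cmod _)); rewrite Re_average normrM normfV normr_nat.
    by rewrite mulrC ler_pdivrMr.
  move=> /(le_trans (Im_le_cmod _)); rewrite Im_average normrM normfV normr_nat.
  by rewrite mulrC ler_pdivrMr.
have famB' M b n : b \in fam M -> (0 < n)%N -> `|b n| <= 1 by move=> bf; exact: famB bf n.
have null g : intg mu g -> {ae mu, forall y, uniformly_null_at
    (fun n => counting_function x n) (real_parts B) T g y}.
  exact: (integrable_uniformly_null alpha_gt0 alpha_lt gw aE RB1 famB' (nearW _ fam1) famA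
      RBmean mpT).
move: (null _ fre) (null _ fim); apply: filterS2 => y nre nim.
apply/(sup_modulus_cvg0P _ Bb0) => eps eps0.
have e4 : 0 < eps / 4 by rewrite divr_gt0.
near=> N => b Bb.
have N0 : (0 < N)%N by near: N; exact: nbhs_infty_gt.
have Nr : 0 < N%:R :> R by rewrite ltr0n.
have Hre : forall b, real_parts B b ->
  `|\sum_(1 <= n < N.+1) b n * complex.Re (f (iter (counting_function x n) T y))| <= eps / 4 *
      N%:R.
  by near: N; exact: nre.
have Him : forall b, real_parts B b ->
  `|\sum_(1 <= n < N.+1) b n * complex.Im (f (iter (counting_function x n) T y))| <= eps / 4 *
      N%:R.
  by near: N; exact: nim.
have Rb : real_parts B (fun n => complex.Re (b n)) by exists b => //; left.
have Ib : real_parts B (fun n => complex.Im (b n)) by exists b => //; right.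
apply: (le_trans (cmod_le _)); rewrite Re_average Im_average.
have half (S1 S2 S : R) : `|S1| <= eps / 4 * N%:R -> `|S2| <= eps / 4 * N%:R ->
    `|S| <= `|S1| + `|S2| -> `|N%:R^-1 * S| <= eps / 2.
  move=> h1 h2 hS; rewrite normrM normfV normr_nat mulrC ler_pdivrMr// (le_trans hS)//.
  by apply: (le_trans (lerD h1 h2)); rewrite -mulrDl ler_pM2r//; lra.
rewrite [leRHS]splitr; apply: lerD.
  apply: half (Hre _ Rb) (Him _ Ib) _; rewrite -[X in _ <= _ + X]normrN -sumrN.
  apply: le_trans (ler_normD _ _); rewrite -big_split/=.
  by under eq_bigr do rewrite ReM.
apply: half (Him _ Rb) (Hre _ Ib) _.
apply: le_trans (ler_normD _ _); rewrite -big_split/=.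
by under eq_bigr do rewrite ImM.
Unshelve. all: by end_near. Qed.
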